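(* Let $\mathcal C=\mathcal C(H,\lambda,\sigma,\beta)$ be the braided monoidal category associated with a braiding datum $(\lambda,\sigma,\beta)$ on a Hopf algebra $H$ (see context), and assume that $\mathrm{Ad}_\sigma^{\,2}=\mathrm{id}_H$. For $M\in\mathcal C_0$ and $X\in\mathcal C_1$ define $$\delta^{\mathcal C}_M=j_M\circ\rho_M\circ(g\otimes\mathrm{id}_M),\qquad \delta^{\mathcal C}_X=j_X .$$ Then $\delta^{\mathcal C}$ is a pivotal structure on $\mathcal C$, i.e. it is a natural monoidal isomorphism $\mathrm{Id}\to(-)^{**}$, where $(-)^*$ is the right duality on $\mathcal C$ described in the context.
   Context: **Base category.** $\mathcal S$ is a ribbon category, strict as a monoidal category, symmetric and with trivial twist; tensor product $\otimes$, unit $\mathbf 1$, braiding $c_{U,V}$, duals $U^\vee$ with $\mathrm{ev}_U:U^\vee\otimes U\to\mathbf 1$, $\mathrm{coev}_U:\mathbf 1\to U\otimes U^\vee$, and pivotal structure (natural monoidal isomorphism) $j_U:U\to U^{\vee\vee}$. $f^\vee$ is the dual of $f$. Fixed is a natural monoidal automorphism $\omega:\mathrm{Id}_{\mathcal S}\Rightarrow\mathrm{Id}_{\mathcal S}$ with $\omega\circ\omega=\mathrm{id}$. **Hopf algebras.** A Hopf algebra in $\mathcal S$ is an object $H$ with $\mu,\eta,\Delta,\varepsilon,S$ such that $(H,\mu,\eta)$ is an algebra, $(H,\Delta,\varepsilon)$ a coalgebra, $\Delta$ is an algebra map for $\mu_{H\otimes H}=(\mu\otimes\mu)\circ(\mathrm{id}\otimes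 c_{H,H}\otimes\mathrm{id})$, $\varepsilon$ is an algebra map, and $\mu\circ(S\otimes\mathrm{id})\circ\Delta=\eta\circ\varepsilon=\mu\circ(\mathrm{id}\otimes S)\circ\Delta$; $S$ is always assumed invertible. The dual Hopf algebra $H^\vee$ has $\mathrm{ev}_H\circ(\mu_{H^\vee}\otimes\mathrm{id}_H)=\mathrm{ev}_H\circ(\mathrm{id}\otimes\mathrm{ev}_H\otimes\mathrm{id})\circ(\mathrm{id}_{H^\vee\otimes H^\vee}\otimes\Delta)$, $\mathrm{ev}_H\circ(\mathrm{id}\otimes\mathrm{ev}_H\otimes\mathrm{id})\circ(\Delta_{H^\vee}\otimes\mathrm{id}_{H\otimes H})=\mathrm{ev}_H\circ(\mathrm{id}_{H^\vee}\otimes\mu)$, $\eta_{H^\vee}=\varepsilon^\vee$, $\varepsilon_{H^\vee}=\eta^\vee$, $S_{H^\vee}=S^\vee$. For $x:\mathbf 1\to H$: ${}_xM=\mu\circ(x\otimes\mathrm{id})$, $M_x=\mu\circ(\mathrm{id}\otimes x)$; $x^{-1}$ denotes the multiplicative inverse, $\mathrm{Ad}_x={}_xM\circ M_{x^{-1}}$. A right cointegral is $\lambda:H\to\mathbf 1$ with $(\lambda\otimes\mathrm{id})\circ\Delta=\eta\circ\lambda$. **Braiding datum.** A triple $(\lambda,\sigma,\beta)$ with $\lambda:H\to\mathbf 1$, $\sigma:\mathbf 1\to H$ having a multiplicative inverse, $\beta\in\mathrm{End}(\mathbf 1)$ invertible, such that, with $\Gamma:H^\vee\to H$ defined by $(\mathrm{id}_H\otimes\Gamma)\circ\mathrm{coev}_H=(M_\sigma\otimes{}_\sigma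 M)\circ\Delta\circ\sigma^{-1}$: (1) $\Gamma$ is a Hopf algebra isomorphism; (2) $\lambda$ is a right cointegral, there is $g:\mathbf 1\to H$ (then unique and with multiplicative inverse) with $(\mathrm{id}_H\otimes\lambda)\circ\Delta=g\circ\lambda$, and $(\lambda\otimes\lambda)\circ(\mathrm{id}_H\otimes\Gamma)\circ\mathrm{coev}_H=\mathrm{id}_{\mathbf 1}$; (3) $\Gamma^\vee=j_H\circ S^2\circ\mathrm{Ad}_{g^{-1}}\circ\Gamma$; (4) $\lambda\circ S=\lambda\circ\mathrm{Ad}_\sigma$, $\lambda\circ\sigma=\beta\circ\beta$; (5) $\varepsilon\circ\mathrm{Ad}_\sigma=\varepsilon$, $\Delta\circ\mathrm{Ad}_\sigma=(\mathrm{Ad}_\sigma\otimes\mathrm{Ad}_\sigma)\circ c_{H,H}\circ\Delta$, $\mathrm{Ad}_\sigma\circ S=S^{-1}\circ\mathrm{Ad}_\sigma$; (6) $S\circ\sigma=\mu\circ(g\otimes\sigma)=\mu\circ(\sigma\otimes g^{-1})$; (7) $\omega_H=S\circ\mathrm{Ad}_\sigma^{-1}\circ\Gamma\circ(\mathrm{Ad}_\sigma)^\vee\circ\Gamma^{-1}$. **Modules.** $\mathrm{Rep}_{\mathcal S}(H)$ is the category of left $H$-modules $(M,\rho_M)$; $\rho^{H\otimes H}_{M\otimes N}=(\rho_M\otimes\rho_N)\circ(\mathrm{id}_H\otimes c_{H,M}\otimes\mathrm{id}_N)$, action on $M\otimes N$: $\rho^{H\otimes H}_{M\otimes N}\circ(\Delta\otimes\mathrm{id})$.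 **The braided category $\mathcal C(H,\lambda,\sigma,\beta)=\mathcal C_0+\mathcal C_1$** ($+$ is disjoint union, or direct sum when $\mathcal S$ is additive), $\mathcal C_0=\mathrm{Rep}_{\mathcal S}(H)$, $\mathcal C_1=\mathcal S$. Tensor product (forgetful functor suppressed): $A\otimes B$ in $\mathrm{Rep}_{\mathcal S}(H)$ for $A,B\in\mathcal C_0$; $A\otimes B\in\mathcal C_1$ if exactly one of $A,B$ is in $\mathcal C_1$; $H\otimes A\otimes B\in\mathcal C_0$ with $H$ acting by multiplication on $H$ if $A,B\in\mathcal C_1$. Morphisms: $f\otimes g$, resp. $\mathrm{id}_H\otimes f\otimes g$ in the last case. Unit: $\mathbf 1$ with action via $\varepsilon$. Put $\gamma=(S^{-1}\otimes\Gamma)\circ\mathrm{coev}_H$, $\delta=(S\otimes(M_g\circ\Gamma))\circ\mathrm{coev}_H$, $\phi=(\mathrm{id}_H\otimes(\lambda\circ\mu))\circ(((\mathrm{id}_H\otimes\Gamma)\circ\mathrm{coev}_H)\otimes\mathrm{id}_H)$, $R=({}_\sigma M\otimes{}_\sigma M)\circ\Delta\circ\sigma^{-1}$, $\nu=\beta\cdot\sigma^{-1}$. Associativity isomorphisms $\alpha_{A,B,C}:A\otimes_{\mathcal C}(B\otimes_{\mathcal C}C)\to(A\otimes_{\mathcal C}B)\otimes_{\mathcal C}C$ (superscripts indicate degrees): - $\alpha_{A^0,B^0,C^0},\ \alpha_{A^0,B^0,C^1},\ \alpha_{A^1,B^0,C^0}$ are identities. - $\alpha_{A^0,B^1,C^0}=(\mathrm{id}_A\otimes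 c_{C,B})\circ[(\rho^{H\otimes H}_{A\otimes C}\circ(\gamma\otimes\mathrm{id}_{A\otimes C}))\otimes\mathrm{id}_B]\circ(\mathrm{id}_A\otimes c_{C,B}^{-1})$. - $\alpha_{A^0,B^1,C^1}=[(\mathrm{id}_H\otimes\rho_A)\circ(((\mathrm{id}_H\otimes S^{-1})\circ c_{H,H}^{-1}\circ\Delta)\otimes\mathrm{id}_A)\circ c_{H,A}^{-1}]\otimes\mathrm{id}_{B\otimes C}$. - $\alpha_{A^1,B^0,C^1}=[(\mu\otimes\mathrm{id}_A\otimes\rho_B)\circ(\mathrm{id}_{H\otimes H}\otimes c_{H,A}\otimes\mathrm{id}_B)\circ(\mathrm{id}_H\otimes\delta\otimes\mathrm{id}_{A\otimes B})]\otimes\mathrm{id}_C$. - $\alpha_{A^1,B^1,C^0}=(\mathrm{id}_{H\otimes A\otimes B}\otimes\rho_C)\circ(\mathrm{id}_H\otimes c_{H,A\otimes B}\otimes\mathrm{id}_C)\circ(\Delta\otimes\mathrm{id}_{A\otimes B\otimes C})$. - $\alpha_{A^1,B^1,C^1}=[(\phi\otimes\mathrm{id}_A)\circ c_{H,A}^{-1}]\otimes\mathrm{id}_{B\otimes C}$. Braiding: $c^{\mathcal C}_{A^0,B^0}=c_{A,B}\circ\rho^{H\otimes H}_{A\otimes B}\circ(R\otimes\mathrm{id}_{A\otimes B})$; $c^{\mathcal C}_{A^0,B^1}=c_{A,B}\circ((\rho_A\circ(\sigma\otimes\mathrm{id}_A))\otimes\mathrm{id}_B)$; $c^{\mathcal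 C}_{A^1,B^0}=c_{A,B}\circ(\mathrm{id}_A\otimes(\omega_B\circ\rho_B\circ(\sigma\otimes\mathrm{id}_B)))$; $c^{\mathcal C}_{A^1,B^1}=M_\nu\otimes(c_{A,B}\circ(\mathrm{id}_A\otimes\omega_B))$. **Right duality on $\mathcal C$.** For $M\in\mathcal C_0$, $M^*=M^\vee$ with action determined by $\mathrm{ev}_M\circ(\rho_{M^*}\otimes\mathrm{id}_M)=\mathrm{ev}_M\circ(\mathrm{id}_{M^\vee}\otimes\rho_M)\circ((c_{H,M^\vee}\circ(S\otimes\mathrm{id}_{M^\vee}))\otimes\mathrm{id}_M)$, $\mathrm{ev}^{\mathcal C}_M=\mathrm{ev}_M:M^*\otimes_{\mathcal C}M\to\mathbf 1$, $\mathrm{coev}^{\mathcal C}_M=\mathrm{coev}_M:\mathbf 1\to M\otimes_{\mathcal C}M^*$. For $X\in\mathcal C_1$, $X^*=X^\vee$, $\mathrm{ev}^{\mathcal C}_X=\varepsilon\otimes\mathrm{ev}_X$, $\mathrm{coev}^{\mathcal C}_X=\Lambda\otimes\mathrm{coev}_X$ with $\Lambda=(\lambda\otimes\Gamma)\circ\mathrm{coev}_H$. The monoidal structure of $(-)^{**}$ is the one canonically induced by this duality. *)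

(* Defs.v *)
From mathcomp Require Import ssreflect ssrfun ssrbool.
From Stdlib Require Import ClassicalEpsilon.

Set Implicit Arguments.
Unset Strict Implicit.
Unset Printing Implicit Defensive.

Declare Scope mcat_scope.
Delimit Scope mcat_scope with mcat.
Local Open Scope mcat_scope.

Reserved Notation "g ∘ f" (at level 40, left associativity).
Reserved Notation "f ⊗ g" (at level 35, right associativity).
Reserved Notation "U ^∨" (at level 1, format "U ^∨").
Reserved Notation "f ∈ A ⟶ B" (at level 70, A at next level, B at next level).

(** * Monoidal categories with right duals, arrows-only presentation

    Objects are the [A : Ob] with [isOb A]; morphisms [A -> B] are the
    [f : Ar] with [isHom A B f].  Composition and tensor product of arrows are
    total functions whose values only matter on well-typed arguments.  With
    this presentation the equalities [(U ⊗ V) ⊗ W = U ⊗ (V ⊗ W)] and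
    [(f ⊗ g) ⊗ h = f ⊗ (g ⊗ h)] of a strict monoidal category are plain
    equalities, without transports.

    The record contains the structure only: it is what is needed to say what
    the functor [(-)^∨^∨] and a pivotal structure are. *)

Record rigid_data := RigidData {
  Ob : Type;
  Ar : Type;
  isOb : Ob -> Prop;
  isHom : Ob -> Ob -> Ar -> Prop;
  idA : Ob -> Ar;
  compA : Ar -> Ar -> Ar;                  (* [compA g f] is "g after f" *)
  tensO : Ob -> Ob -> Ob;
  tensA : Ar -> Ar -> Ar;
  unitO : Ob;
  assocA : Ob -> Ob -> Ob -> Ar;           (* A ⊗ (B ⊗ C) -> (A ⊗ B) ⊗ C *)
  lunitA : Ob -> Ar;                       (* 1 ⊗ A -> A *)
  runitA : Ob -> Ar;                       (* A ⊗ 1 -> A *)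
  dualO : Ob -> Ob;
  evA : Ob -> Ar;                          (* A^∨ ⊗ A -> 1 *)
  coevA : Ob -> Ar                         (* 1 -> A ⊗ A^∨ *)
}.

Section Pivotal.
Context (C : rigid_data).
Implicit Types (A B : Ob C) (f g : Ar C).

Local Notation "g ∘ f" := (compA g f).
Local Notation "f ⊗ g" := (tensA f g).
Local Notation id := (@idA C).
Local Notation "A ⊠ B" := (tensO A B) (at level 35, right associativity).
Local Notation "A ^∨" := (dualO A).

Definition is_inverse A B f g : Prop :=
  [/\ isHom B A g, g ∘ f = id A & f ∘ g = id B].

Definition is_iso A B f : Prop :=
  isHom A B f /\ exists g, is_inverse A B f g.

(* The inverse of an isomorphism [f : A -> B]; unspecified otherwise. *)
Definition inv A B f : Ar C := epsilon (inhabits f) (is_inverse A B f).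

(* [f^∨ : B^∨ -> A^∨] for [f : A -> B]. *)
Definition dual_arr A B f : Ar C :=
  lunitA A^∨ ∘ (evA B ⊗ id A^∨) ∘ assocA B^∨ B A^∨
    ∘ (id B^∨ ⊗ (f ⊗ id A^∨)) ∘ (id B^∨ ⊗ coevA A)
    ∘ inv (B^∨ ⊠ unitO C) B^∨ (runitA B^∨).

(* [(B^∨ ⊗ A^∨) ⊗ (A ⊗ B) -> 1]: evaluate A first, then B. *)
Definition ev_tens A B : Ar C :=
  evA B ∘ (runitA B^∨ ⊗ id B) ∘ ((id B^∨ ⊗ evA A) ⊗ id B)
    ∘ (inv (B^∨ ⊠ (A^∨ ⊠ A)) ((B^∨ ⊠ A^∨) ⊠ A) (assocA B^∨ A^∨ A) ⊗ id B)
    ∘ assocA (B^∨ ⊠ A^∨) A B.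

(* The canonical isomorphism [B^∨ ⊗ A^∨ -> (A ⊗ B)^∨] between two right duals
   of [A ⊗ B], and its nullary version [1 -> 1^∨]. *)
Definition dual_tens A B : Ar C :=
  let W := B^∨ ⊠ A^∨ in let Z := A ⊠ B in
  lunitA Z^∨ ∘ (ev_tens A B ⊗ id Z^∨) ∘ assocA W Z Z^∨
    ∘ (id W ⊗ coevA Z) ∘ inv (W ⊠ unitO C) W (runitA W).

Definition dual_unit : Ar C := lunitA (unitO C)^∨ ∘ coevA (unitO C).

(* The induced monoidal structure [A^∨* ⊗ B^∨* -> (A ⊗ B)^∨*], [1 -> 1^∨*]
   of the functor [(-)^∨*]. *)
Definition ddual_tens A B : Ar C :=
  inv (A ⊠ B)^∨^∨ (B^∨ ⊠ A^∨)^∨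
      (dual_arr (B^∨ ⊠ A^∨) (A ⊠ B)^∨ (dual_tens A B))
    ∘ dual_tens B^∨ A^∨.

Definition ddual_unit : Ar C :=
  inv (unitO C)^∨^∨ (unitO C)^∨ (dual_arr (unitO C) (unitO C)^∨ dual_unit)
    ∘ dual_unit.

Definition ddual_arr A B f : Ar C := dual_arr B^∨ A^∨ (dual_arr A B f).

Record is_pivotal (d : Ob C -> Ar C) : Prop := IsPivotal {
  pivotal_iso : forall A, isOb A -> is_iso A A^∨^∨ (d A);
  pivotal_nat : forall A B f, isOb A -> isOb B -> isHom A B f ->
    d B ∘ f = ddual_arr A B f ∘ d A;
  pivotal_tens : forall A B, isOb A -> isOb B ->
    d (A ⊠ B) = ddual_tens A B ∘ (d A ⊗ d B);
  pivotal_unit : d (unitO C) = ddual_unit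
}.

End Pivotal.

(** * The base category *)

(* Braided strict monoidal categories with right duals. *)
Record strict_rigid := StrictRigid {
  ob : Type;
  ar : Type;
  dom : ar -> ob;
  cod : ar -> ob;
  idm : ob -> ar;
  comp : ar -> ar -> ar;                   (* [comp g f] is "g after f" *)
  otens : ob -> ob -> ob;
  tens : ar -> ar -> ar;
  one : ob;
  brai : ob -> ob -> ar;
  braiV : ob -> ob -> ar;                  (* inverse of [brai] *)
  dual : ob -> ob;
  ev : ob -> ar;
  coev : ob -> ar;

  dom_id : forall U, dom (idm U) = U;
  cod_id : forall U, cod (idm U) = U;
  dom_comp : forall f g, dom g = cod f -> dom (comp g f) = dom f;
  cod_comp : forall f g, dom g = cod f -> cod (comp g f) = cod g;
  comp_idl : forall f, comp (idm (cod f)) f = f;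
  comp_idr : forall f, comp f (idm (dom f)) = f;
  comp_assoc : forall f g h, dom g = cod f -> dom h = cod g ->
    comp h (comp g f) = comp (comp h g) f;

  otens_assoc : forall U V W, otens U (otens V W) = otens (otens U V) W;
  otens_1l : forall U, otens one U = U;
  otens_1r : forall U, otens U one = U;
  dom_tens : forall f g, dom (tens f g) = otens (dom f) (dom g);
  cod_tens : forall f g, cod (tens f g) = otens (cod f) (cod g);
  tens_id : forall U V, tens (idm U) (idm V) = idm (otens U V);
  tens_comp : forall f g f' g', dom g = cod f -> dom g' = cod f' ->
    tens (comp g f) (comp g' f') = comp (tens g g') (tens f f');
  tens_assoc : forall f g h, tens f (tens g h) = tens (tens f g) h;
  tens_1l : forall f, tens (idm one) f = f;
  tens_1r : forall f, tens f (idm one) = f;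

  dom_brai : forall U V, dom (brai U V) = otens U V;
  cod_brai : forall U V, cod (brai U V) = otens V U;
  dom_braiV : forall U V, dom (braiV U V) = otens V U;
  cod_braiV : forall U V, cod (braiV U V) = otens U V;
  braiK : forall U V, comp (braiV U V) (brai U V) = idm (otens U V);
  braiVK : forall U V, comp (brai U V) (braiV U V) = idm (otens V U);
  brai_nat : forall f g,
    comp (brai (cod f) (cod g)) (tens f g) =
    comp (tens g f) (brai (dom f) (dom g));
  brai_tensl : forall U V W, brai (otens U V) W =
    comp (tens (brai U W) (idm V)) (tens (idm U) (brai V W));
  brai_tensr : forall U V W, brai U (otens V W) =
    comp (tens (idm V) (brai U W)) (tens (brai U V) (idm W));

  dom_ev : forall U, dom (ev U) = otens (dual U) U;
  cod_ev : forall U, cod (ev U) = one;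
  dom_coev : forall U, dom (coev U) = one;
  cod_coev : forall U, cod (coev U) = otens U (dual U);
  zigzag : forall U,
    comp (tens (idm U) (ev U)) (tens (coev U) (idm U)) = idm U;
  zigzag_dual : forall U,
    comp (tens (ev U) (idm (dual U))) (tens (idm (dual U)) (coev U)) =
    idm (dual U)
}.

Arguments idm {s}.
Arguments one {s}.
Arguments brai {s}.
Arguments braiV {s}.
Arguments ev {s}.
Arguments coev {s}.

Notation "g ∘ f" := (comp g f) : mcat_scope.
Notation "f ⊗ g" := (tens f g) : mcat_scope.
Notation "U ⊠ V" := (otens U V) (at level 35, right associativity) : mcat_scope.
Notation "U ^∨" := (dual U) : mcat_scope.

Definition hom (S : strict_rigid) (U V : ob S) (f : ar S) : Prop :=
  dom f = U /\ cod f = V.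
Notation "f ∈ A ⟶ B" := (hom A B f) : mcat_scope.

Definition base_data (S : strict_rigid) : rigid_data := {|
  Ob := ob S;
  Ar := ar S;
  isOb := fun _ => True;
  isHom := @hom S;
  idA := @idm S;
  compA := @comp S;
  tensO := @otens S;
  tensA := @tens S;
  unitO := @one S;
  assocA := fun U V W => idm (U ⊠ (V ⊠ W));
  lunitA := @idm S;
  runitA := @idm S;
  dualO := @dual S;
  evA := @ev S;
  coevA := @coev S
|}.

(* The dual [f^∨ : (cod f)^∨ -> (dom f)^∨] in the base category. *)
Definition dualm (S : strict_rigid) (f : ar S) : ar S :=
  @dual_arr (base_data S) (dom f) (cod f) f.

Record ribbon := Ribbon {
  ribbon_rigid :> strict_rigid;
  twist : ob ribbon_rigid -> ar ribbon_rigid;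
  piv : ob ribbon_rigid -> ar ribbon_rigid;

  twist_iso : forall U, @is_iso (base_data ribbon_rigid) U U (twist U);
  twist_nat : forall f, twist (cod f) ∘ f = f ∘ twist (dom f);
  twist_tens : forall U V,
    twist (U ⊠ V) = brai V U ∘ brai U V ∘ (twist U ⊗ twist V);
  twist_dual : forall U, twist U^∨ = dualm (twist U);
  piv_pivotal : @is_pivotal (base_data ribbon_rigid) piv;
  (* The pivotal structure is the Drinfeld isomorphism composed with the
     twist. *)
  piv_twist : forall U,
    piv U = (ev U ⊗ idm U^∨^∨) ∘ (brai U U^∨ ⊗ idm U^∨^∨)
              ∘ (idm U ⊗ coev U^∨) ∘ twist U
}.

Definition symmetric (S : ribbon) : Prop :=
  forall U V : ob S, brai V U ∘ brai U V = idm (U ⊠ V).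

Definition trivial_twist (S : ribbon) : Prop :=
  forall U : ob S, twist U = idm U.

(* Natural monoidal automorphisms of the identity functor with square one. *)
Record involution (S : ribbon) := Involution {
  omega :> ob S -> ar S;
  omega_hom : forall U, omega U ∈ U ⟶ U;
  omega_nat : forall f, omega (cod f) ∘ f = f ∘ omega (dom f);
  omega_tens : forall U V, omega (U ⊠ V) = omega U ⊗ omega V;
  omega_one : omega one = idm one;
  omegaK : forall U, omega U ∘ omega U = idm U
}.

(** * Hopf algebras *)

Record hopf_data (S : ribbon) := HopfData {
  carrier :> ob S;
  mul : ar S;
  uni : ar S;
  comul : ar S;
  counit : ar S;
  antip : ar S
}.

Record hopf_alg (S : ribbon) := HopfAlg {
  hopf :> hopf_data S;
  antipV : ar S;

  mul_hom : mul hopf ∈ hopf ⊠ hopf ⟶ hopf;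
  uni_hom : uni hopf ∈ one ⟶ hopf;
  comul_hom : comul hopf ∈ hopf ⟶ hopf ⊠ hopf;
  counit_hom : counit hopf ∈ hopf ⟶ one;
  antip_hom : antip hopf ∈ hopf ⟶ hopf;
  antipV_hom : antipV ∈ hopf ⟶ hopf;

  mul_assoc : mul hopf ∘ (mul hopf ⊗ idm hopf) =
              mul hopf ∘ (idm hopf ⊗ mul hopf);
  mul_1l : mul hopf ∘ (uni hopf ⊗ idm hopf) = idm hopf;
  mul_1r : mul hopf ∘ (idm hopf ⊗ uni hopf) = idm hopf;
  comul_assoc : (comul hopf ⊗ idm hopf) ∘ comul hopf =
                (idm hopf ⊗ comul hopf) ∘ comul hopf;
  comul_1l : (counit hopf ⊗ idm hopf) ∘ comul hopf = idm hopf;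
  comul_1r : (idm hopf ⊗ counit hopf) ∘ comul hopf = idm hopf;
  comul_mul : comul hopf ∘ mul hopf =
    (mul hopf ⊗ mul hopf) ∘ (idm hopf ⊗ brai hopf hopf ⊗ idm hopf)
      ∘ (comul hopf ⊗ comul hopf);
  comul_uni : comul hopf ∘ uni hopf = uni hopf ⊗ uni hopf;
  counit_mul : counit hopf ∘ mul hopf = counit hopf ⊗ counit hopf;
  counit_uni : counit hopf ∘ uni hopf = idm one;
  antip_l : mul hopf ∘ (antip hopf ⊗ idm hopf) ∘ comul hopf =
            uni hopf ∘ counit hopf;
  antip_r : mul hopf ∘ (idm hopf ⊗ antip hopf) ∘ comul hopf =
            uni hopf ∘ counit hopf;
  antipK : antipV ∘ antip hopf = idm hopf;
  antipVK : antip hopf ∘ antipV = idm hopf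
}.

(* The adjunct [A -> B ⊗ M^∨] of [f : A ⊗ M -> B]. *)
Definition transp (S : strict_rigid) (A M : ob S) (f : ar S) : ar S :=
  (f ⊗ idm M^∨) ∘ (idm A ⊗ coev M).

Lemma comp_id (S : strict_rigid) (U : ob S) : idm U ∘ idm U = idm U.
Proof. by rewrite -{1}(cod_id U) comp_idl. Qed.

Lemma comp_tens_id (S : strict_rigid) (f g : ar S) (U : ob S) :
  dom g = cod f -> (g ∘ f) ⊗ idm U = (g ⊗ idm U) ∘ (f ⊗ idm U).
Proof.
by move=> gf; rewrite -tens_comp ?dom_id ?cod_id // comp_id.
Qed.

Lemma transpK (S : strict_rigid) (A M B : ob S) (f : ar S) :
  f ∈ A ⊠ M ⟶ B -> (idm B ⊗ ev M) ∘ (transp A M f ⊗ idm M) = f.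
Proof.
case=> fA fB; rewrite /transp comp_tens_id; last first.
  by rewrite !dom_tens !cod_tens !dom_id !cod_id cod_coev fA otens_assoc.
have -> : (f ⊗ idm M^∨) ⊗ idm M = f ⊗ idm (M^∨ ⊠ M).
  by rewrite -tens_assoc tens_id.
rewrite comp_assoc; last 2 first.
- by rewrite !dom_tens !cod_tens !dom_id !cod_id cod_coev fA !otens_assoc.
- by rewrite !dom_tens !cod_tens !dom_id !cod_id dom_ev fB.
have -> : (idm B ⊗ ev M) ∘ (f ⊗ idm (M^∨ ⊠ M)) = f ∘ (idm (A ⊠ M) ⊗ ev M).
  have fl : idm B ∘ f = f by rewrite -fB comp_idl.
  have fr : f ∘ idm (A ⊠ M) = f by rewrite -fA comp_idr.
  have el : idm one ∘ ev M = ev M by rewrite -(cod_ev M) comp_idl.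
  have er : ev M ∘ idm (M^∨ ⊠ M) = ev M by rewrite -dom_ev comp_idr.
  rewrite -tens_comp ?dom_id ?cod_id ?dom_ev ?fB // fl er -{1}fr -{1}el.
  by rewrite tens_comp ?dom_id ?cod_id ?cod_ev ?fA // tens_1r.
rewrite -comp_assoc; last 2 first.
- by rewrite !dom_tens !cod_tens !dom_id !cod_id cod_coev dom_ev !otens_assoc.
- by rewrite cod_tens cod_id cod_ev otens_1r.
rewrite -tens_id -!tens_assoc -tens_comp ?dom_id ?cod_id //; last first.
  by rewrite !dom_tens !cod_tens !dom_id !cod_id dom_ev cod_coev !otens_assoc.
by rewrite zigzag comp_id tens_id -fA comp_idr.
Qed.

Lemma transp1K (S : strict_rigid) (A M : ob S) (f : ar S) :
  f ∈ A ⊠ M ⟶ one -> ev M ∘ (transp A M f ⊗ idm M) = f.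
Proof. by move=> /transpK; rewrite tens_1l. Qed.

Lemma transp_hom (S : strict_rigid) (A M B : ob S) f :
  f ∈ A ⊠ M ⟶ B -> transp A M f ∈ A ⟶ B ⊠ M^∨.
Proof.
case=> fA fB; rewrite /transp; split.
  rewrite dom_comp ?(dom_tens, cod_tens, dom_id, cod_id, dom_coev, cod_coev) //.
    by rewrite otens_1r.
  by rewrite fA otens_assoc.
rewrite cod_comp ?(dom_tens, cod_tens, dom_id, cod_id, dom_coev, cod_coev) //.
  by rewrite fB.
by rewrite fA otens_assoc.
Qed.

(* The multiplication and comultiplication are the unique solutions of the
   equations [ev_dual_mul] and [ev_dual_comul] below. *)
Definition dual_hopf (S : ribbon) (H : hopf_data S) : hopf_data S := {|
  carrier := H^∨;
  mul := transp (H^∨ ⊠ H^∨) H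
           (ev H ∘ (idm H^∨ ⊗ ev H ⊗ idm H) ∘ (idm (H^∨ ⊠ H^∨) ⊗ comul H));
  uni := dualm (counit H) ∘ coev one;
  comul := transp H^∨ H (transp (H^∨ ⊠ H) H (ev H ∘ (idm H^∨ ⊗ mul H)));
  counit := ev one ∘ dualm (uni H);
  antip := dualm (antip H)
|}.

Lemma ev_dual_mul (S : ribbon) (H : hopf_alg S) :
  ev H ∘ (mul (dual_hopf H) ⊗ idm H) =
  ev H ∘ (idm H^∨ ⊗ ev H ⊗ idm H) ∘ (idm (H^∨ ⊠ H^∨) ⊗ comul H).
Proof.
have [h1 h2] := comul_hom H; apply: transp1K.
have e1 : dom (ev H) = cod (idm H^∨ ⊗ ev H ⊗ idm H).
  by rewrite dom_ev !cod_tens !cod_id cod_ev otens_1l.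
have e2 : dom (idm H^∨ ⊗ ev H ⊗ idm H) = cod (idm (H^∨ ⊠ H^∨) ⊗ comul H).
  by rewrite !dom_tens cod_tens !cod_id !dom_id dom_ev h2 !otens_assoc.
split; first by rewrite !dom_comp // dom_tens dom_id h1.
by rewrite !cod_comp ?cod_ev ?dom_comp.
Qed.

Lemma ev_dual_comul (S : ribbon) (H : hopf_alg S) :
  ev H ∘ (idm H^∨ ⊗ ev H ⊗ idm H) ∘ (comul (dual_hopf H) ⊗ idm (H ⊠ H)) =
  ev H ∘ (idm H^∨ ⊗ mul H).
Proof.
have [h1 h2] := mul_hom H.
set f := ev H ∘ (idm H^∨ ⊗ mul H).
have fP : f ∈ (H^∨ ⊠ H) ⊠ H ⟶ one.
  have e : dom (ev H) = cod (idm H^∨ ⊗ mul H).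
    by rewrite dom_ev cod_tens cod_id h2.
  split; last by rewrite cod_comp // cod_ev.
  by rewrite dom_comp // dom_tens dom_id h1 otens_assoc.
have gP := transp_hom fP; rewrite otens_1l in gP.
have [kA kB] := transp_hom gP.
rewrite -[comul _]/(transp H^∨ H (transp (H^∨ ⊠ H) H f)).
rewrite -{2}(transp1K fP) -{2}(transpK gP) comp_tens_id; last first.
  by rewrite !dom_tens cod_tens !dom_id cod_id dom_ev kB -otens_assoc.
rewrite comp_assoc.
- by rewrite -!tens_assoc tens_id.
- by rewrite !(dom_tens, cod_tens) dom_id !cod_id !dom_id dom_ev kB !otens_assoc.
- by rewrite !cod_tens !cod_id cod_ev dom_ev otens_1r.
Qed.

Record is_hopf_iso (S : ribbon) (H K : hopf_data S) (f : ar S) : Prop :=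
IsHopfIso {
  hopf_iso_iso : @is_iso (base_data S) (carrier H) (carrier K) f;
  hopf_iso_mul : f ∘ mul H = mul K ∘ (f ⊗ f);
  hopf_iso_uni : f ∘ uni H = uni K;
  hopf_iso_comul : comul K ∘ f = (f ⊗ f) ∘ comul H;
  hopf_iso_counit : counit K ∘ f = counit H;
  hopf_iso_antip : antip K ∘ f = f ∘ antip H
}.

(* Left and right multiplication with, and conjugation by, [x : 1 -> H]. *)
Definition lmul (S : ribbon) (H : hopf_data S) (x : ar S) : ar S :=
  mul H ∘ (x ⊗ idm H).
Definition rmul (S : ribbon) (H : hopf_data S) (x : ar S) : ar S :=
  mul H ∘ (idm H ⊗ x).
Definition mul_inverse (S : ribbon) (H : hopf_data S) (x y : ar S) : Prop :=
  [/\ x ∈ one ⟶ H, y ∈ one ⟶ H,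
      mul H ∘ (x ⊗ y) = uni H & mul H ∘ (y ⊗ x) = uni H].
(* [Adj H x y] is [Ad_x] when [y] is the inverse of [x]. *)
Definition Adj (S : ribbon) (H : hopf_data S) (x y : ar S) : ar S :=
  lmul H x ∘ rmul H y.

(* The uniquely determined [σ^-1], [g], [g^-1], [β^-1], [Γ] and [Γ^-1] are
   carried along with the triple (λ, σ, β). *)
Record braiding_datum (S : ribbon) (om : involution S) (H : hopf_alg S) :=
BraidingDatum {
  lam : ar S;
  sig : ar S;
  bet : ar S;
  sigV : ar S;
  gel : ar S;
  gelV : ar S;
  betV : ar S;
  Gam : ar S;
  GamV : ar S;

  lam_hom : lam ∈ H ⟶ one;
  sigVP : mul_inverse H sig sigV;
  gelVP : mul_inverse H gel gelV;
  bet_hom : bet ∈ one ⟶ one;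
  betVP : @is_inverse (base_data S) one one bet betV;
  Gam_hom : Gam ∈ H^∨ ⟶ H;
  GamE : (idm H ⊗ Gam) ∘ coev H =
         (rmul H sig ⊗ lmul H sig) ∘ comul H ∘ sigV;
  GamVP : @is_inverse (base_data S) H^∨ (carrier H) Gam GamV;

  datum1 : is_hopf_iso (dual_hopf H) H Gam;
  datum2_cointegral : (lam ⊗ idm H) ∘ comul H = uni H ∘ lam;
  datum2_g : (idm H ⊗ lam) ∘ comul H = gel ∘ lam;
  datum2_norm : (lam ⊗ lam) ∘ (idm H ⊗ Gam) ∘ coev H = idm one;
  datum3 : dualm Gam =
           piv H ∘ (antip H ∘ antip H) ∘ Adj H gelV gel ∘ Gam;
  datum4_antip : lam ∘ antip H = lam ∘ Adj H sig sigV;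
  datum4_bet : lam ∘ sig = bet ∘ bet;
  datum5_counit : counit H ∘ Adj H sig sigV = counit H;
  datum5_comul : comul H ∘ Adj H sig sigV =
    (Adj H sig sigV ⊗ Adj H sig sigV) ∘ brai H H ∘ comul H;
  datum5_antip : Adj H sig sigV ∘ antip H = antipV H ∘ Adj H sig sigV;
  datum6_l : antip H ∘ sig = mul H ∘ (gel ⊗ sig);
  datum6_r : antip H ∘ sig = mul H ∘ (sig ⊗ gelV);
  datum7 : om H =
    antip H ∘ Adj H sigV sig ∘ Gam ∘ dualm (Adj H sig sigV) ∘ GamV
}.

(** * Modules *)

Section Modules.
Context (S : ribbon) (H : hopf_alg S).

Record module_data := ModuleData { mcar :> ob S; act : ar S }.

Record is_module (M : module_data) : Prop := IsModule {
  act_hom : act M ∈ H ⊠ M ⟶ M;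
  act_mul : act M ∘ (mul H ⊗ idm M) = act M ∘ (idm H ⊗ act M);
  act_uni : act M ∘ (uni H ⊗ idm M) = idm M
}.

Definition module_hom (M N : module_data) (f : ar S) : Prop :=
  f ∈ M ⟶ N /\ f ∘ act M = act N ∘ (idm H ⊗ f).

Definition act2 (M N : module_data) : ar S :=
  (act M ⊗ act N) ∘ (idm H ⊗ brai H M ⊗ idm N).

Definition mod_tens (M N : module_data) : module_data :=
  ModuleData (M ⊠ N) (act2 M N ∘ (comul H ⊗ idm (M ⊠ N))).

Definition mod_unit : module_data := ModuleData one (counit H).

Definition mod_free (U : ob S) : module_data :=
  ModuleData (H ⊠ U) (mul H ⊗ idm U).

(* The action is the unique solution of [ev_mod_dual] below. *)
Definition mod_dual (M : module_data) : module_data :=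
  ModuleData M^∨ (transp (H ⊠ M^∨) M
    (ev M ∘ (idm M^∨ ⊗ act M)
      ∘ ((brai H M^∨ ∘ (antip H ⊗ idm M^∨)) ⊗ idm M))).

End Modules.

Lemma ev_mod_dual (S : ribbon) (H : hopf_alg S) (M : module_data S) :
  is_module H M ->
  ev M ∘ (act (mod_dual H M) ⊗ idm M) =
  ev M ∘ (idm M^∨ ⊗ act M)
    ∘ ((brai H M^∨ ∘ (antip H ⊗ idm M^∨)) ⊗ idm M).
Proof.
case=> [[a1 a2] _ _]; have [s1 s2] := antip_hom H; apply: transp1K.
have e0 : dom (brai H M^∨) = cod (antip H ⊗ idm M^∨).
  by rewrite dom_brai cod_tens cod_id s2.
have e1 : dom (ev M) = cod (idm M^∨ ⊗ act M).
  by rewrite dom_ev cod_tens cod_id a2.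
have e2 : dom (idm M^∨ ⊗ act M) =
          cod ((brai H M^∨ ∘ (antip H ⊗ idm M^∨)) ⊗ idm M).
  rewrite dom_tens dom_id a1 cod_tens cod_comp // cod_brai cod_id.
  by rewrite !otens_assoc.
split; last by rewrite !cod_comp ?cod_ev ?dom_comp.
rewrite !dom_comp ?dom_comp // dom_tens dom_comp // dom_tens dom_id s1.
by rewrite dom_id.
Qed.

(** * The category C(H, λ, σ, β), with [+] the disjoint union

    A morphism of C is represented by its degree and its underlying morphism
    in S. *)

Section DisjointUnion.
Context (S : ribbon) (om : involution S) (H : hopf_alg S).
Context (D : braiding_datum om H).

Local Notation lam := (lam D).
Local Notation Gam := (Gam D).
Local Notation gel := (gel D).
Local Notation μ := (mul H).
Local Notation Δ := (comul H).

Inductive C_ob := Ob0 of module_data S | Ob1 of ob S.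
Inductive C_ar := Ar0 of ar S | Ar1 of ar S.

Definition under (f : C_ar) : ar S := match f with Ar0 f => f | Ar1 f => f end.

Definition C_isOb (A : C_ob) : Prop :=
  match A with Ob0 M => is_module H M | Ob1 _ => True end.

Definition C_isHom (A B : C_ob) (f : C_ar) : Prop :=
  match A, B, f with
  | Ob0 M, Ob0 N, Ar0 f => module_hom H M N f
  | Ob1 X, Ob1 Y, Ar1 f => f ∈ X ⟶ Y
  | _, _, _ => False
  end.

Definition C_id (A : C_ob) : C_ar :=
  match A with Ob0 M => Ar0 (idm M) | Ob1 X => Ar1 (idm X) end.

(* Arrows of different degrees are not composable; the value is then junk. *)
Definition C_comp (g f : C_ar) : C_ar :=
  match f with
  | Ar0 f => Ar0 (under g ∘ f)
  | Ar1 f => Ar1 (under g ∘ f)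
  end.

Definition C_tensO (A B : C_ob) : C_ob :=
  match A, B with
  | Ob0 M, Ob0 N => Ob0 (mod_tens H M N)
  | Ob0 M, Ob1 Y => Ob1 (M ⊠ Y)
  | Ob1 X, Ob0 N => Ob1 (X ⊠ N)
  | Ob1 X, Ob1 Y => Ob0 (mod_free H (X ⊠ Y))
  end.

Definition C_tensA (f g : C_ar) : C_ar :=
  match f, g with
  | Ar0 f, Ar0 g => Ar0 (f ⊗ g)
  | Ar0 f, Ar1 g => Ar1 (f ⊗ g)
  | Ar1 f, Ar0 g => Ar1 (f ⊗ g)
  | Ar1 f, Ar1 g => Ar0 (idm H ⊗ f ⊗ g)
  end.

Definition elt_gamma : ar S := (antipV H ⊗ Gam) ∘ coev H.
Definition elt_delta : ar S := (antip H ⊗ (rmul H gel ∘ Gam)) ∘ coev H.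
Definition map_phi : ar S :=
  (idm H ⊗ (lam ∘ μ)) ∘ (((idm H ⊗ Gam) ∘ coev H) ⊗ idm H).
Definition elt_Lambda : ar S := (lam ⊗ Gam) ∘ coev H.

Definition C_assoc (A B C : C_ob) : C_ar :=
  match A, B, C with
  | Ob0 A, Ob0 B, Ob0 C => Ar0 (idm (A ⊠ B ⊠ C))
  | Ob0 A, Ob0 B, Ob1 C => Ar1 (idm (A ⊠ B ⊠ C))
  | Ob1 A, Ob0 B, Ob0 C => Ar1 (idm (A ⊠ B ⊠ C))
  | Ob0 A, Ob1 B, Ob0 C =>
      Ar1 ((idm A ⊗ brai C B)
             ∘ ((act2 H A C ∘ (elt_gamma ⊗ idm (A ⊠ C))) ⊗ idm B)
             ∘ (idm A ⊗ braiV C B))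
  | Ob0 A, Ob1 B, Ob1 C =>
      Ar0 (((idm H ⊗ act A)
              ∘ (((idm H ⊗ antipV H) ∘ braiV H H ∘ Δ) ⊗ idm A)
              ∘ braiV H A) ⊗ idm (B ⊠ C))
  | Ob1 A, Ob0 B, Ob1 C =>
      Ar0 (((μ ⊗ idm A ⊗ act B)
              ∘ (idm (H ⊠ H) ⊗ brai H A ⊗ idm B)
              ∘ (idm H ⊗ elt_delta ⊗ idm (A ⊠ B))) ⊗ idm C)
  | Ob1 A, Ob1 B, Ob0 C =>
      Ar0 ((idm (H ⊠ A ⊠ B) ⊗ act C)
             ∘ (idm H ⊗ brai H (A ⊠ B) ⊗ idm C)
             ∘ (Δ ⊗ idm (A ⊠ B ⊠ C)))
  | Ob1 A, Ob1 B, Ob1 C =>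
      Ar1 (((map_phi ⊗ idm A) ∘ braiV H A) ⊗ idm (B ⊠ C))
  end.

Definition C_dual (A : C_ob) : C_ob :=
  match A with Ob0 M => Ob0 (mod_dual H M) | Ob1 X => Ob1 X^∨ end.

Definition C_ev (A : C_ob) : C_ar :=
  match A with Ob0 M => Ar0 (ev M) | Ob1 X => Ar0 (counit H ⊗ ev X) end.

Definition C_coev (A : C_ob) : C_ar :=
  match A with Ob0 M => Ar0 (coev M) | Ob1 X => Ar0 (elt_Lambda ⊗ coev X) end.

Definition C_data : rigid_data := {|
  Ob := C_ob;
  Ar := C_ar;
  isOb := C_isOb;
  isHom := C_isHom;
  idA := C_id;
  compA := C_comp;
  tensO := C_tensO;
  tensA := C_tensA;
  unitO := Ob0 (mod_unit H);
  assocA := C_assoc;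
  lunitA := C_id;
  runitA := C_id;
  dualO := C_dual;
  evA := C_ev;
  coevA := C_coev
|}.

Definition C_delta (A : C_ob) : C_ar :=
  match A with
  | Ob0 M => Ar0 (piv M ∘ act M ∘ (gel ⊗ idm M))
  | Ob1 X => Ar1 (piv X)
  end.

End DisjointUnion.

(** * The category C(H, λ, σ, β) over an additive base, with [+] the direct
      sum of categories

    Objects are pairs [(A_0, A_1)] with [A_0] an H-module and [A_1] an object
    of S; all structure is extended additively from the homogeneous objects. *)

Definition parallel (S : strict_rigid) (f g : ar S) : Prop :=
  dom f = dom g /\ cod f = cod g.

(* Additive monoidal structures, with chosen zero object and biproducts. *)
Record additive (S : strict_rigid) := Additive {
  azero : ob S -> ob S -> ar S;
  aadd : ar S -> ar S -> ar S;
  aopp : ar S -> ar S;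
  zob : ob S;
  bsum : ob S -> ob S -> ob S;
  in1 : ob S -> ob S -> ar S;
  in2 : ob S -> ob S -> ar S;
  pr1 : ob S -> ob S -> ar S;
  pr2 : ob S -> ob S -> ar S;

  azero_hom : forall U V, azero U V ∈ U ⟶ V;
  aadd_hom : forall U V f g, f ∈ U ⟶ V -> g ∈ U ⟶ V -> aadd f g ∈ U ⟶ V;
  aopp_hom : forall U V f, f ∈ U ⟶ V -> aopp f ∈ U ⟶ V;
  aaddA : forall f g h, parallel f g -> parallel g h ->
    aadd f (aadd g h) = aadd (aadd f g) h;
  aaddC : forall f g, parallel f g -> aadd f g = aadd g f;
  aadd0 : forall f, aadd f (azero (dom f) (cod f)) = f;
  aaddN : forall f, aadd f (aopp f) = azero (dom f) (cod f);
  comp_addl : forall f g h, parallel g h -> dom g = cod f ->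
    aadd g h ∘ f = aadd (g ∘ f) (h ∘ f);
  comp_addr : forall f g h, parallel g h -> dom f = cod g ->
    f ∘ aadd g h = aadd (f ∘ g) (f ∘ h);
  tens_addl : forall f g h, parallel g h ->
    aadd g h ⊗ f = aadd (g ⊗ f) (h ⊗ f);
  tens_addr : forall f g h, parallel g h ->
    f ⊗ aadd g h = aadd (f ⊗ g) (f ⊗ h);

  zobP : idm zob = azero zob zob;
  in1_hom : forall U V, in1 U V ∈ U ⟶ bsum U V;
  in2_hom : forall U V, in2 U V ∈ V ⟶ bsum U V;
  pr1_hom : forall U V, pr1 U V ∈ bsum U V ⟶ U;
  pr2_hom : forall U V, pr2 U V ∈ bsum U V ⟶ V;
  pr1_in1 : forall U V, pr1 U V ∘ in1 U V = idm U;
  pr2_in2 : forall U V, pr2 U V ∘ in2 U V = idm V;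
  pr1_in2 : forall U V, pr1 U V ∘ in2 U V = azero V U;
  pr2_in1 : forall U V, pr2 U V ∘ in1 U V = azero U V;
  bsumP : forall U V,
    aadd (in1 U V ∘ pr1 U V) (in2 U V ∘ pr2 U V) = idm (bsum U V)
}.

Section DirectSum.
Context (S : ribbon) (om : involution S) (H : hopf_alg S).
Context (D : braiding_datum om H) (a : additive S).

Definition sum2 (F : bool -> ar S) : ar S := aadd a (F false) (F true).

Definition mod_sum (M N : module_data S) : module_data S :=
  ModuleData (bsum a M N)
    (aadd a (in1 a M N ∘ act M ∘ (idm H ⊗ pr1 a M N))
            (in2 a M N ∘ act N ∘ (idm H ⊗ pr2 a M N))).

Definition DS_ob : Type := module_data S * ob S.
Definition DS_ar : Type := ar S * ar S.

(* Underlying pair of objects of S, and homogeneous components. *)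
Definition carr (A : DS_ob) : ob S * ob S := (mcar A.1, A.2).
Definition obc (A : DS_ob) (i : bool) : C_ob S :=
  if i then Ob1 A.2 else Ob0 A.1.
Definition arc (f : DS_ar) (i : bool) : C_ar S :=
  if i then Ar1 f.2 else Ar0 f.1.
Definition mkc (i : bool) (f : ar S) : C_ar S := if i then Ar1 f else Ar0 f.

Definition DS_tensO (A B : DS_ob) : DS_ob :=
  (mod_sum (mod_tens H A.1 B.1) (mod_free H (A.2 ⊠ B.2)),
   bsum a (A.1 ⊠ B.2) (A.2 ⊠ B.1)).

(* Injection of [A_i ⊗ B_j] into, and projection to it from, the component of
   degree [i + j] of [A ⊗ B], in terms of the underlying objects. *)
Definition inj (U V : ob S * ob S) (i j : bool) : C_ar S :=
  mkc (i (+) j) match i, j with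
  | false, false => in1 a (U.1 ⊠ V.1) (H ⊠ U.2 ⊠ V.2)
  | true, true => in2 a (U.1 ⊠ V.1) (H ⊠ U.2 ⊠ V.2)
  | false, true => in1 a (U.1 ⊠ V.2) (U.2 ⊠ V.1)
  | true, false => in2 a (U.1 ⊠ V.2) (U.2 ⊠ V.1)
  end.
Definition prj (U V : ob S * ob S) (i j : bool) : C_ar S :=
  mkc (i (+) j) match i, j with
  | false, false => pr1 a (U.1 ⊠ V.1) (H ⊠ U.2 ⊠ V.2)
  | true, true => pr2 a (U.1 ⊠ V.1) (H ⊠ U.2 ⊠ V.2)
  | false, true => pr1 a (U.1 ⊠ V.2) (U.2 ⊠ V.1)
  | true, false => pr2 a (U.1 ⊠ V.2) (U.2 ⊠ V.1)
  end.

Local Notation "g ∘c f" := (C_comp g f) (at level 40, left associativity).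
Local Notation "f ⊗c g" := (C_tensA H f g) (at level 35).

Definition DS_tensA (f g : DS_ar) : DS_ar :=
  let U := (dom f.1, dom f.2) in let U' := (cod f.1, cod f.2) in
  let V := (dom g.1, dom g.2) in let V' := (cod g.1, cod g.2) in
  let block i j := under
    (inj U' V' i j ∘c (arc f i ⊗c arc g j) ∘c prj U V i j) in
  (sum2 (fun i => block i i), sum2 (fun i => block i (~~ i))).

Definition DS_assoc (A B C : DS_ob) : DS_ar :=
  let block i j k := under
    (inj (carr (DS_tensO A B)) (carr C) (i (+) j) k
       ∘c (inj (carr A) (carr B) i j ⊗c C_id (obc C k))
       ∘c C_assoc D (obc A i) (obc B j) (obc C k)
       ∘c (C_id (obc A i) ⊗c prj (carr B) (carr C) j k)
       ∘c prj (carr A) (carr (DS_tensO B C)) i (j (+) k)) in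
  (sum2 (fun i => sum2 (fun j => block i j (i (+) j))),
   sum2 (fun i => sum2 (fun j => block i j (~~ (i (+) j))))).

Definition DS_unit : DS_ob := (mod_unit H, zob a).

(* Since [1 ⊗ U = U] in S, the projections below are onto [A_i]. *)
Definition DS_lunit (A : DS_ob) : DS_ar :=
  (under (prj (carr DS_unit) (carr A) false false),
   under (prj (carr DS_unit) (carr A) false true)).
Definition DS_runit (A : DS_ob) : DS_ar :=
  (under (prj (carr A) (carr DS_unit) false false),
   under (prj (carr A) (carr DS_unit) true false)).

Definition DS_dual (A : DS_ob) : DS_ob := (mod_dual H A.1, A.2^∨).

Definition DS_ev (A : DS_ob) : DS_ar :=
  let A' := DS_dual A in
  (sum2 (fun i => under (C_ev H (obc A i) ∘c prj (carr A') (carr A) i i)),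
   azero a (DS_tensO A' A).2 (zob a)).

Definition DS_coev (A : DS_ob) : DS_ar :=
  let A' := DS_dual A in
  (sum2 (fun i => under (inj (carr A) (carr A') i i ∘c C_coev D (obc A i))),
   azero a (zob a) (DS_tensO A A').2).

Definition DS_data : rigid_data := {|
  Ob := DS_ob;
  Ar := DS_ar;
  isOb := fun A => is_module H A.1;
  isHom := fun A B f => module_hom H A.1 B.1 f.1 /\ f.2 ∈ A.2 ⟶ B.2;
  idA := fun A => (idm A.1, idm A.2);
  compA := fun g f => (g.1 ∘ f.1, g.2 ∘ f.2);
  tensO := DS_tensO;
  tensA := DS_tensA;
  unitO := DS_unit;
  assocA := DS_assoc;
  lunitA := DS_lunit;
  runitA := DS_runit;
  dualO := DS_dual;
  evA := DS_ev;
  coevA := DS_coev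
|}.

Definition DS_delta (A : DS_ob) : DS_ar :=
  (under (C_delta D (obc A false)), under (C_delta D (obc A true))).

End DirectSum.

(* Main.v *)
From Stdlib Require Import ClassicalEpsilon.
From mathcomp Require Import all_boot.
Require Import Defs.

Set Implicit Arguments.
Unset Strict Implicit.
Unset Printing Implicit Defensive.
Local Open Scope mcat_scope.

(** The claim is that δ is natural, linear and monoidal.

    Linearity in degree zero, where δ_M = j_M ∘ g, says S^2(k) g = g k, because
    H acts on a double dual through S^2. The datum relates Γ^∨ to j, S^2 and
    conjugation by g. The copairing (id ⊗ Γ) ∘ coev is built from Δ(σ^-1), and
    conjugation by σ reverses the comultiplication; so when Ad_σ is an
    involution the copairing is symmetric ([cop_sym]), which means Γ^∨ = j ∘ Γ,
    and the relation becomes the required one ([antip2], [antip2_gel]).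

    For monoidality, let p_{A,B} be the pairing of B^∨ ⊗ A^∨ with A ⊗ B that
    the duality of C provides. Its adjunct is the canonical map to the dual of
    A ⊗ B. Write δ = j ∘ z, where z is the action of g in degree 0 and the
    identity in degree 1. As j exchanges the arguments of an evaluation, δ is
    monoidal if p_{B^∨,A^∨} applied to δ_A ⊗ δ_B in its first argument is p_{A,B}
    applied to z_{A ⊗ B} in its second argument, with the arguments exchanged
    ([dualm_transp_piv]). The pairings follow from the associativity
    isomorphisms ([ev_tensE]): nested evaluation if B has degree 0; the same
    with g acting on A if only B has degree 1; the same times λ(S(k) h) on the
    two copies of H if both have degree 1. What has to be shown in these cases
    ([dtens_delta]) is that g is group-like, that S(g) = g^-1, and that
    λ(S(k) g h) = λ(S(h) k). The last identity follows from λ(S(h) g) = λ(h) and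
    S^2(k) g = g k ([fpair_gel]).

    The canonical maps have to be inverted, and the associativity isomorphisms
    too, since their inverses occur in the pairings. This rests on copairings
    dual to the pairings, among them Δ(Λ), with the integral Λ, for λ(S(k) h),
    and on the invertibility of γ, δ and the transform φ. Duals and adjuncts of
    objects of degree one are those of the base category because φ(Λ) = 1.

    In the direct sum every structure map is a sum of blocks, one for each choice
    of homogeneous components. The canonical map to the dual of A ⊗ B is the sum
    of those of C ([dtensS_inS]), and each identity reduces to the one in C
    because arrows between biproducts are determined by their blocks.

    Equations between arrows of the base category are proved by a verified
    rewriting procedure on string diagrams ([net_sound] and the tactic [net]):
    a diagram is a list of boxes joined by named wires, so that two expressions
    equal by the axioms of symmetric monoidal categories have diagrams that
    differ only by renaming wires and reordering boxes. *)

(** * Sources and targets of arrows *)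

Section Hom.
Context {S : strict_rigid}.
Implicit Types (U V W : ob S) (f g h : ar S).

Lemma hom_id U : idm U ∈ U ⟶ U.
Proof. by split; rewrite ?dom_id ?cod_id. Qed.

Lemma hom_comp U V V' W f g :
  f ∈ U ⟶ V -> g ∈ V' ⟶ W -> V = V' -> g ∘ f ∈ U ⟶ W.
Proof.
by case=> f1 f2 [g1 g2] e; split; rewrite ?dom_comp ?cod_comp // g1 f2.
Qed.

Lemma hom_tens U V U' V' f g :
  f ∈ U ⟶ V -> g ∈ U' ⟶ V' -> f ⊗ g ∈ U ⊠ U' ⟶ V ⊠ V'.
Proof. by case=> f1 f2 [g1 g2]; split; rewrite ?dom_tens ?cod_tens ?f1 ?f2 ?g1 ?g2. Qed.

Lemma hom_brai U V : brai U V ∈ U ⊠ V ⟶ V ⊠ U.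
Proof. by split; rewrite ?dom_brai ?cod_brai. Qed.

Lemma hom_braiV U V : braiV U V ∈ V ⊠ U ⟶ U ⊠ V.
Proof. by split; rewrite ?dom_braiV ?cod_braiV. Qed.

Lemma hom_ev U : ev U ∈ U^∨ ⊠ U ⟶ one.
Proof. by split; rewrite ?dom_ev ?cod_ev. Qed.

Lemma hom_coev U : coev U ∈ one ⟶ U ⊠ U^∨.
Proof. by split; rewrite ?dom_coev ?cod_coev. Qed.

Lemma hom_cast U V U' V' f : f ∈ U' ⟶ V' -> U' = U -> V' = V -> f ∈ U ⟶ V.
Proof. by move=> h <- <-. Qed.

Lemma hom_match U V V' W f g :
  f ∈ U ⟶ V -> g ∈ V' ⟶ W -> V = V' -> dom g = cod f.
Proof. by case=> _ -> [-> _] ->. Qed.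

Lemma idlm V U f : f ∈ U ⟶ V -> idm V ∘ f = f.
Proof. by case=> _ <-; rewrite comp_idl. Qed.

Lemma idrm V U f : f ∈ U ⟶ V -> f ∘ idm U = f.
Proof. by case=> <- _; rewrite comp_idr. Qed.

End Hom.

Create HintDb homdb.
#[export] Hint Resolve hom_id hom_brai hom_braiV hom_ev hom_coev : homdb.

(** Objects are compared up to associativity and units of the tensor product,
    which are strict but not computational. *)
Ltac obeq := solve [reflexivity | rewrite -?otens_assoc ?otens_1l ?otens_1r;
   solve [reflexivity | rewrite ?otens_assoc ?otens_1l ?otens_1r; reflexivity]].

(** Structural arrows determine their source and target; those of the other
    arrows are looked up in the context and among the hints of [homdb]. *)
Ltac hinfer :=
  lazymatch goal with
  | |- hom _ _ (comp _ _) => eapply hom_comp; [hinfer | hinfer | obeq]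
  | |- hom _ _ (tens _ _) => eapply hom_tens; [hinfer | hinfer]
  | |- hom _ _ (idm _) => eapply hom_id
  | |- hom _ _ _ => solve [eassumption | eauto 3 with homdb]
  end.
Ltac hm := lazymatch goal with
  | |- hom _ _ _ => eapply hom_cast; [hinfer | obeq | obeq]
  | |- dom _ = cod _ => eapply hom_match; [hinfer | hinfer | obeq]
  end.

Section Basic.
Context {S : strict_rigid}.
Implicit Types (U V W : ob S) (f g h : ar S).

Lemma tens_idl_comp U f g : dom g = cod f ->
  idm U ⊗ (g ∘ f) = (idm U ⊗ g) ∘ (idm U ⊗ f).
Proof. by move=> gf; rewrite -tens_comp ?dom_id ?cod_id // comp_id. Qed.

Lemma interl U V U' V' f g : f ∈ U ⟶ V -> g ∈ U' ⟶ V' ->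
  (f ⊗ idm V') ∘ (idm U ⊗ g) = f ⊗ g.
Proof.
move=> hf hg; rewrite -tens_comp; [|hm|hm].
by rewrite (idrm hf) (idlm hg).
Qed.

Lemma interr U V U' V' f g : f ∈ U ⟶ V -> g ∈ U' ⟶ V' ->
  (idm V ⊗ g) ∘ (f ⊗ idm U') = f ⊗ g.
Proof.
move=> hf hg; rewrite -tens_comp; [|hm|hm].
by rewrite (idlm hf) (idrm hg).
Qed.

Lemma exch U V U' V' f g : f ∈ U ⟶ V -> g ∈ U' ⟶ V' ->
  (f ⊗ idm V') ∘ (idm U ⊗ g) = (idm V ⊗ g) ∘ (f ⊗ idm U').
Proof. by move=> hf hg; rewrite (interl hf hg) (interr hf hg). Qed.

Lemma brai_natH U V U' V' f g : f ∈ U ⟶ V -> g ∈ U' ⟶ V' ->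
  brai V V' ∘ (f ⊗ g) = (g ⊗ f) ∘ brai U U'.
Proof. by case=> <- <- [<- <-]; exact: brai_nat. Qed.

Context (sym : forall U V, brai V U ∘ brai U V = idm (U ⊠ V)).

Lemma braiVE U V : braiV U V = brai V U.
Proof.
rewrite -(idrm (hom_braiV U V)) -sym comp_assoc; [|hm|hm].
by rewrite braiK (idlm (hom_brai V U)).
Qed.

(** [brai U one] is idempotent by the hexagon identity, and it is invertible. *)
Lemma brai_1r U : brai U one = idm U.
Proof.
have hb : brai U one ∈ U ⟶ U.
  by apply: hom_cast (hom_brai _ _) _ _; rewrite ?otens_1l ?otens_1r.
have e := brai_tensr U one one.
rewrite tens_1l tens_1r otens_1l in e.
have := congr1 (comp (braiV U one)) e.
rewrite comp_assoc; [|hm|hm].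
by rewrite braiK otens_1r (idlm hb).
Qed.

Lemma brai_1l U : brai one U = idm U.
Proof.
have hb : idm U ∈ U ⟶ U by exact: hom_id.
have hc : brai one U ∈ U ⟶ U.
  by apply: hom_cast (hom_brai _ _) _ _; rewrite ?otens_1l ?otens_1r.
by have := sym one U; rewrite brai_1r (idlm hc) otens_1l.
Qed.

End Basic.

(** * Coherence for symmetric braidings *)

(** An edge of a diagram, as a name and the index of the object it carries.
    Distinct edges may carry the same object: names tell a permutation of such
    edges from the identity. *)
Definition wire : Type := (nat * nat)%type.

Section Perm.
Context (S : strict_rigid) (sym : forall U V : ob S, brai V U ∘ brai U V = idm (U ⊠ V)).
Context (O : nat -> ob S).
Implicit Types (a b c l x y r s : seq wire) (u v w : wire).

Definition ty w : ob S := O w.2.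
Definition TO (l : seq nat) : ob S := foldr (fun k X => O k ⊠ X) one l.
Definition TW l : ob S := TO (map snd l).

Lemma TO_cat (k l : seq nat) : TO (k ++ l) = TO k ⊠ TO l.
Proof. by elim: k => [|i k IH] /=; rewrite ?otens_1l // IH otens_assoc. Qed.
Lemma TW_cat a b : TW (a ++ b) = TW a ⊠ TW b.
Proof. by rewrite /TW map_cat TO_cat. Qed.
Lemma TWE l : TW l = TO (map snd l). Proof. by []. Qed.
Lemma TW_cons w b : TW (w :: b) = ty w ⊠ TW b. Proof. by []. Qed.

Fixpoint pull w l : ar S :=
  if l is v :: l' then
    if v == w then idm (TW l)
    else (brai (ty v) (ty w) ⊗ idm (TW (rem w l'))) ∘ (idm (ty v) ⊗ pull w l')
  else idm one.

(** The coherence isomorphism between two orderings of the same wires: the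
    target is produced from left to right, each wire being braided to the front
    of those that remain. Any other way to permute the wires gives the same
    arrow, by [perm_comp], [perm_catl], [perm_catr] and [perm_swap]. *)
Fixpoint perm a b : ar S :=
  if b is w :: b' then (idm (ty w) ⊗ perm (rem w a) b') ∘ pull w a
  else idm one.

Lemma hom_pull w l : w \in l -> pull w l ∈ TW l ⟶ ty w ⊠ TW (rem w l).
Proof.
elim: l => // v l IH; rewrite inE /= [w == v]eq_sym.
case: (v =P w) => [->|_] /=; first by move=> _; hm.
move/IH => h; rewrite !TW_cons; hm.
Qed.

Lemma hom_perm a b : perm_eq a b -> perm a b ∈ TW a ⟶ TW b.
Proof.
elim: b a => [|w b IH] a; first by move/perm_nilP => -> /=; hm.
move=> ab; have wa : w \in a by rewrite (perm_mem ab) inE eqxx.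
have := ab; rewrite (permPl (perm_to_rem wa)) perm_cons => /IH h /=.
rewrite TW_cons; have := hom_pull wa => hp; hm.
Qed.

Lemma perm_remH a b w : perm_eq a b -> perm_eq (rem w a) (rem w b).
Proof.
move=> ab; case wa: (w \in a); last first.
  by rewrite !rem_id -?(perm_mem ab) ?wa.
have wb : w \in b by rewrite -(perm_mem ab).
by rewrite -(perm_cons w) -(permPl (perm_to_rem wa)) -(permPr (perm_to_rem wb)).
Qed.

Lemma perm_id a : perm a a = idm (TW a).
Proof.
elim: a => //= w a IH; rewrite eqxx IH tens_id.
by rewrite comp_id.
Qed.

Lemma rem_rem v w l : rem v (rem w l) = rem w (rem v l).
Proof.
elim: l => //= u l IH.
case: (u =P w) => [->|uw]; case: (_ =P v) => [e|uv] //=.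
- by rewrite e.
- by rewrite eqxx.
- by rewrite e eqxx.
- by move/eqP/negbTE: uw => ->; move/eqP/negbTE: uv => ->; rewrite IH.
Qed.

Lemma mem_rem_neq v w l : v != w -> v \in l -> v \in rem w l.
Proof.
move=> vw; elim: l => //= u l IH; rewrite inE.
case: (u =P w) => [->|uw]; first by rewrite (negbTE vw).
by rewrite inE; case: (v == u) => //=.
Qed.

(** The Yang-Baxter equation: naturality of a braiding with respect to
    another one. *)
Lemma brai_YB (U V W : ob S) :
  (brai V W ⊗ idm U) ∘ (idm V ⊗ brai U W) ∘ (brai U V ⊗ idm W) =
  (idm W ⊗ brai U V) ∘ (brai U W ⊗ idm V) ∘ (idm U ⊗ brai V W).
Proof.
rewrite -brai_tensl -[RHS]comp_assoc; try hm.
rewrite -brai_tensl.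
by apply: brai_natH; hm.
Qed.

(** Two wires can be brought to the front in either order, up to crossing
    them. When one of them already is at the front, this is the symmetry of the
    braiding; when a third wire is, the Yang-Baxter equation. *)
Lemma pull_pull v w a : v != w -> v \in a -> w \in a ->
  (brai (ty v) (ty w) ⊗ idm (TW (rem w (rem v a)))) ∘
    (idm (ty v) ⊗ pull w (rem v a)) ∘ pull v a =
  (idm (ty w) ⊗ pull v (rem w a)) ∘ pull w a.
Proof.
move=> vw; elim: a => // u a IH; rewrite !inE.
have wv : w != v by rewrite eq_sym.
case: (u =P v) => [->|uv].
  rewrite eqxx (negbTE wv) /= eqxx /= => _ wa.
  rewrite (negbTE vw) /= eqxx.
  have hp := hom_pull wa.
  rewrite (idrm (U := ty v ⊠ TW a) (V := ty w ⊠ ty v ⊠ TW (rem w a))); last by hm.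
  rewrite TW_cons tens_id (idlm (U := ty v ⊠ TW a)) //.
  by hm.
case: (u =P w) => [->|uw].
  rewrite eqxx (negbTE vw) /= eqxx /= => va _.
  rewrite (negbTE wv) /= eqxx.
  have hp := hom_pull va.
  rewrite (idrm (U := ty w ⊠ TW a) (V := ty w ⊠ ty v ⊠ TW (rem v a))); last by hm.
  rewrite TW_cons tens_id (idrm (V := ty w ⊠ ty v ⊠ TW (rem v a))); last by hm.
  rewrite comp_assoc; try hm.
  rewrite -tens_comp ?dom_id ?cod_id //; last by hm.
  rewrite sym comp_id tens_id (idlm (U := ty w ⊠ TW a)) //; by hm.
move/eqP/negbTE in uv; move/eqP/negbTE in uw.
rewrite ![_ == u]eq_sym uv uw /= uv uw /= => va wa.
rewrite uv uw /=.
have IH' := IH va wa => {IH}.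
have hv := hom_pull va; have hw := hom_pull wa.
have wrv : w \in rem v a by apply: mem_rem_neq.
have vrw : v \in rem w a by apply: mem_rem_neq.
have hwv := hom_pull wrv; have hvw := hom_pull vrw.
set X := TW (rem w (rem v a)) in hwv *.
have eX : TW (rem v (rem w a)) = X by rewrite rem_rem.
rewrite eX in hvw *.
set p1 := pull v a in IH' hv *; set p2 := pull w a in IH' hw *.
set q1 := pull w (rem v a) in IH' hwv *; set q2 := pull v (rem w a) in IH' hvw *.
set A := ty u; set B := ty v in hv hw hvw hwv IH' *; set C := ty w in hv hw hvw hwv IH' *.

rewrite TW_cons -/A.
transitivity ((((brai B C ⊗ idm A) ∘ (idm B ⊗ brai A C) ∘ (brai A B ⊗ idm C)) ⊗ idm X)
   ∘ (idm (A ⊠ B) ⊗ q1) ∘ (idm A ⊗ p1)).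
  rewrite !comp_tens_id; try hm.
  rewrite -!tens_assoc !tens_id.
  rewrite tens_idl_comp; last by hm.
  rewrite -!comp_assoc; try hm.
  congr (_ ∘ _).
  congr (_ ∘ _).
  rewrite -(tens_id A B) -tens_assoc.
  rewrite !comp_assoc; try hm.
  congr (_ ∘ _).
  rewrite tens_assoc tens_id -/A -/B.
  symmetry; rewrite !tens_assoc tens_id; apply: exch; hm.
rewrite brai_YB -tens_id -tens_assoc.
transitivity ((((idm C ⊗ brai A B) ∘ (brai A C ⊗ idm B)) ⊗ idm X) ∘
   (idm A ⊗ ((brai B C ⊗ idm X) ∘ (idm B ⊗ q1) ∘ p1))).
  rewrite !comp_tens_id; try hm.
  rewrite !tens_idl_comp; try hm.
  rewrite -!tens_assoc; rewrite !comp_assoc //; try hm.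
rewrite IH' !comp_tens_id; try hm.
rewrite !tens_idl_comp; try hm.
rewrite -!tens_assoc.
rewrite -!comp_assoc; try hm; congr (_ ∘ _).
rewrite !comp_assoc; try hm; congr (_ ∘ _).
rewrite tens_id.
rewrite !tens_assoc !tens_id; apply: exch; hm.
Qed.

Lemma pull_perm w a b : perm_eq a b -> w \in b ->
  pull w b ∘ perm a b = (idm (ty w) ⊗ perm (rem w a) (rem w b)) ∘ pull w a.
Proof.
elim: b a => // v b IH a ab.
have va : v \in a by rewrite (perm_mem ab) inE eqxx.
have rab : perm_eq (rem v a) b.
  by have := ab; rewrite (permPl (perm_to_rem va)) perm_cons.
have hv := hom_pull va; have hp := hom_perm rab.
rewrite inE eq_sym /=; case: (v =P w) => [<-|vw] /=.
  by move=> _; rewrite TW_cons (idlm (U := TW a)) //; hm.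
move=> wb; have vw' : v != w by apply/eqP.
have wra : w \in rem v a by rewrite (perm_mem rab).
have wa : w \in a by apply: mem_rem wra.
have vra : v \in rem w a by apply: mem_rem_neq => //; apply/eqP.
have hvr := hom_pull vra; have hwr := hom_pull wra; have hw := hom_pull wa.
have hwb := hom_pull wb.
have hpr := hom_perm (perm_remH w rab).
have hpp := pull_pull vw' va wa.
rewrite (rem_rem v w a) in hvr *.
rewrite tens_idl_comp; last by hm.
rewrite -[RHS]comp_assoc; try hm.
rewrite -hpp.
rewrite [LHS]comp_assoc; try hm.
rewrite -[X in X ∘ pull v a = _]comp_assoc; try hm.
rewrite -tens_idl_comp; try hm.
rewrite IH // tens_idl_comp; try hm.
rewrite !comp_assoc; try hm.
congr (_ ∘ _ ∘ _).
by rewrite !tens_assoc !tens_id; apply: exch; hm.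
Qed.

(** By induction on the last ordering: its first wire is followed back
    through [perm a b] by [pull_perm]. *)
Lemma perm_comp a b c : perm_eq a b -> perm_eq b c ->
  perm b c ∘ perm a b = perm a c.
Proof.
elim: c a b => [|w c IH] a b ab.
  by move/perm_nilP => eb; move: ab; rewrite eb => /perm_nilP -> /=; rewrite comp_id.
move=> bc; have wb : w \in b by rewrite (perm_mem bc) inE eqxx.
have wa : w \in a by rewrite (perm_mem ab).
have rbc : perm_eq (rem w b) c.
  by have := bc; rewrite (permPl (perm_to_rem wb)) perm_cons.
have rab := perm_remH w ab.
have h1 := hom_perm ab; have h2 := hom_perm rbc; have h3 := hom_perm rab.
have h4 := hom_pull wa; have h5 := hom_pull wb.
rewrite /= -comp_assoc; try hm.
rewrite pull_perm // comp_assoc; try hm.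
by rewrite -tens_idl_comp; [|hm]; rewrite IH.
Qed.

Lemma perm_catl x a b : perm_eq a b ->
  perm (x ++ a) (x ++ b) = idm (TW x) ⊗ perm a b.
Proof.
move=> ab; have hp := hom_perm ab.
elim: x => [|w x IH] /=; first by rewrite tens_1l.
rewrite eqxx /= IH tens_assoc tens_id.
rewrite TW_cons TW_cat (idrm (V := TW (w :: x) ⊠ TW b)) //.
by rewrite !TW_cons; hm.
Qed.

Lemma rem_cat_in w a r : w \in a -> rem w (a ++ r) = rem w a ++ r.
Proof.
elim: a => //= v a IH; rewrite inE eq_sym.
by case: (v == w) => //= /IH ->.
Qed.
Lemma rem_cat_notin w a r : w \notin a -> rem w (a ++ r) = a ++ rem w r.
Proof.
elim: a => //= v a IH; rewrite inE negb_or eq_sym.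
by case: (v == w) => //= /IH ->.
Qed.

Lemma pull_catr w a r : w \in a -> pull w (a ++ r) = pull w a ⊗ idm (TW r).
Proof.
elim: a => // v a IH; rewrite inE eq_sym /=.
case: (v =P w) => [_ _|_ /= wa]; first by rewrite !TW_cons TW_cat tens_id otens_assoc.
have hp := hom_pull wa.
rewrite IH // rem_cat_in // TW_cat -tens_id comp_tens_id; last by hm.
by rewrite !tens_assoc.
Qed.

Lemma perm_catr a b r : perm_eq a b ->
  perm (a ++ r) (b ++ r) = perm a b ⊗ idm (TW r).
Proof.
elim: b a => [|w b IH] a.
  by move/perm_nilP => -> /=; rewrite perm_id tens_1l.
move=> ab; have wa : w \in a by rewrite (perm_mem ab) inE eqxx.
have rab : perm_eq (rem w a) b.
  by have := ab; rewrite (permPl (perm_to_rem wa)) perm_cons.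
have h1 := hom_pull wa; have h2 := hom_perm rab.
by rewrite /= rem_cat_in // IH // pull_catr // comp_tens_id ?tens_assoc //; hm.
Qed.

Lemma pull_catl w x y : w \notin x ->
  pull w (x ++ w :: y) = brai (TW x) (ty w) ⊗ idm (TW y).
Proof.
elim: x => [|v x IH] /=.
  by rewrite eqxx brai_1l // tens_id.
rewrite inE negb_or eq_sym; case: (v =P w) => //= vw wx.
rewrite IH // rem_cat_notin //= eqxx TW_cat TW_cons brai_tensl.
rewrite comp_tens_id; last by hm.
by rewrite -!tens_assoc tens_id.
Qed.

Lemma perm_swap x y : uniq (x ++ y) -> perm (x ++ y) (y ++ x) = brai (TW x) (TW y).
Proof.
elim: y => [|w y IH]; first by rewrite cats0 perm_id brai_1r.
rewrite uniq_catC /= mem_cat negb_or => /andP [/andP [wy wx] yx].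
rewrite rem_cat_notin //= eqxx IH 1?uniq_catC //.
by rewrite pull_catl // brai_tensr.
Qed.

Lemma rem_map (m : wire -> wire) w l : {in l &, injective m} -> w \in l ->
  rem (m w) (map m l) = map m (rem w l).
Proof.
elim: l => // v l IH inj wl /=.
rewrite (inj_in_eq inj) ?mem_head //.
case: (v =P w) => //= vw; move: wl; rewrite inE eq_sym; case: (v =P w) => //= _ wl.
rewrite IH // => a b al bl; apply: inj; by rewrite inE ?al ?bl orbT.
Qed.

Lemma TW_map (m : wire -> wire) l :
  (forall v, v \in l -> (m v).2 = v.2) -> TW (map m l) = TW l.
Proof.
move=> tm; rewrite /TW -map_comp; congr TO; apply/eq_in_map => z zx /=; exact: tm.
Qed.

Lemma pull_map (m : wire -> wire) w l : {in l &, injective m} -> w \in l ->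
  (forall v, v \in l -> (m v).2 = v.2) -> pull (m w) (map m l) = pull w l.
Proof.
elim: l => // v l IH inj wl tm; rewrite /=.
rewrite (inj_in_eq inj) ?mem_head //.
case: (v =P w) => [_|vw]; first by rewrite -[m v :: _]/(map m (v :: l)) TW_map.
have {}wl : w \in l by move: wl; rewrite inE eq_sym; case: (v =P w).
have inj' : {in l &, injective m}.
  by move=> a b al bl; apply: inj; rewrite inE ?al ?bl orbT.
have tm' z : z \in l -> (m z).2 = z.2 by move=> zl; apply: tm; rewrite inE zl orbT.
rewrite IH // rem_map // TW_map; last by move=> z /mem_rem; exact: tm'.
by rewrite /ty !tm ?mem_head // inE wl orbT.
Qed.

Lemma perm_rename (m : wire -> wire) a b : {in a &, injective m} -> perm_eq a b ->
  (forall v, v \in a -> (m v).2 = v.2) -> perm (map m a) (map m b) = perm a b.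
Proof.
elim: b a => //= w b IH a inj ab tm.
have wa : w \in a by rewrite (perm_mem ab) inE eqxx.
have rab : perm_eq (rem w a) b.
  by have := ab; rewrite (permPl (perm_to_rem wa)) perm_cons.
rewrite rem_map // IH //; first by rewrite pull_map // /ty tm.
- by move=> x y /mem_rem xa /mem_rem ya; apply: inj.
- by move=> x /mem_rem; exact: tm.
Qed.

End Perm.

(** * String diagrams *)

(** A vertex: the index of its arrow, incoming wires, outgoing wires. A diagram
    is a list of boxes, run on a state, which is the list of the wires alive. A
    box takes its incoming wires wherever they stand and leaves its outgoing
    ones in front. As wires have names, the order of a state carries no
    information, and braidings need not be represented. *)
Definition box : Type := (nat * (seq wire * seq wire))%type.
Definition ins (b : box) : seq wire := b.2.1.
Definition outs (b : box) : seq wire := b.2.2.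
Definition minus (s l : seq wire) : seq wire := [seq w <- s | w \notin l].
Definition step (s : seq wire) (b : box) : seq wire := outs b ++ minus s (ins b).
Definition all_outs (bs : seq box) : seq wire := flatten (map outs bs).

Section Wf.
Context (sg : nat -> seq nat * seq nat).
Implicit Types (s o l r : seq wire) (w : wire) (b : box) (bs : seq box).

Definition ok_box s (b : box) : bool :=
  [&& map snd (ins b) == (sg b.1).1, map snd (outs b) == (sg b.1).2,
      uniq (ins b) & all (mem s) (ins b)].

Fixpoint wf0 s bs o : bool :=
  if bs is b :: bs' then ok_box s b && wf0 (step s b) bs' o else perm_eq s o.

(** No name is ever used for two wires, so that a name denotes the same edge
    wherever it occurs in a diagram. *)
Definition wf s bs o := uniq (s ++ all_outs bs) && wf0 s bs o.

Lemma wfE s bs o : wf s bs o = uniq (s ++ all_outs bs) && wf0 s bs o.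
Proof. by []. Qed.

Lemma ok_box_perm s s' b : s =i s' -> ok_box s b = ok_box s' b.
Proof.
move=> ss; rewrite /ok_box; congr [&& _, _, _ & _].
by apply: eq_all => w; rewrite /= ss.
Qed.

Lemma minus_perm s s' l : perm_eq s s' -> perm_eq (minus s l) (minus s' l).
Proof. exact: perm_filter. Qed.

Lemma step_perm s s' b : perm_eq s s' -> perm_eq (step s b) (step s' b).
Proof. by move=> h; rewrite perm_cat2l; exact: minus_perm. Qed.

Lemma wf0_perm s s' bs o : perm_eq s s' -> wf0 s bs o = wf0 s' bs o.
Proof.
elim: bs s s' => [|b bs IH] s s' ss /=; first by rewrite (permPl ss).
by rewrite (ok_box_perm _ (perm_mem ss)) (IH _ _ (step_perm b ss)).
Qed.

Lemma wf_perm s s' bs o : perm_eq s s' -> wf s bs o = wf s' bs o.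
Proof.
move=> ss; rewrite /wf (wf0_perm _ _ ss); congr (_ && _).
by apply: perm_uniq; rewrite perm_cat2r.
Qed.

Lemma ok_split s b : uniq s -> ok_box s b -> perm_eq s (ins b ++ minus s (ins b)).
Proof.
move=> us /and4P [_ _ ui /allP si]; apply: uniq_perm => //.
  rewrite cat_uniq ui filter_uniq // andbT /=.
  by apply/hasPn => w; rewrite mem_filter => /andP [].
move=> w; rewrite mem_cat mem_filter.
case wi: (w \in ins b) => //=.
by move/si: wi.
Qed.

Lemma wf_uniq s bs o : wf s bs o -> uniq s.
Proof. by case/andP; rewrite cat_uniq => /andP []. Qed.

Lemma wf_step s b bs o : wf s (b :: bs) o -> ok_box s b /\ wf (step s b) bs o.
Proof.
case/andP => u /= /andP [h hw]; split => //; rewrite /wf hw andbT /step.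
have {}u : uniq ((outs b ++ s) ++ all_outs bs).
  by move: u; rewrite /all_outs /= catA;
    rewrite -(perm_uniq (s1 := (outs b ++ s) ++ all_outs bs)) // perm_cat2r perm_catC.
apply: subseq_uniq u; apply: cat_subseq => //.
by apply: cat_subseq => //; exact: filter_subseq.
Qed.

Lemma wf_perm_out s bs o o' : perm_eq o o' -> wf s bs o = wf s bs o'.
Proof.
move=> oo; congr (_ && _); elim: bs s => [|b bs IH] s /=; last by rewrite IH.
exact: permPr.
Qed.

Fixpoint after s bs : seq wire := if bs is b :: bs' then after (step s b) bs' else s.

Lemma wf_uniqo s bs o : wf s bs o -> uniq o.
Proof.
elim: bs s => [|b bs IH] s; last by case/wf_step => _; exact: IH.
by case/andP; rewrite cats0 => u so; rewrite -(perm_uniq so).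
Qed.

Lemma wf_cat s bs cs m o : wf s bs m -> wf m cs o -> uniq (s ++ all_outs (bs ++ cs)) ->
  wf s (bs ++ cs) o.
Proof.
move=> h1 h2 u; rewrite /wf u /= {u}.
elim: bs s h1 => [|b bs IH] s /=.
  by move=> /andP [_ sm]; rewrite (wf0_perm _ _ sm); case/andP: h2.
by case/wf_step => -> h /=; exact: IH.
Qed.

Lemma wf_cat_inv s bs cs o : wf s (bs ++ cs) o ->
  wf s bs (after s bs) /\ wf (after s bs) cs o.
Proof.
elim: bs s => [|b bs IH] s /=.
  by move=> h; split => //; rewrite /wf /= perm_refl cats0 (wf_uniq h).
move=> h; have [h1 h2] := wf_step h; have [h3 h4] := IH _ h2; split => //.
case/andP: h3 => _ h3; rewrite /wf /= h1 h3 !andbT.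
case/andP: h => u _; move: u.
by rewrite /all_outs /= map_cat flatten_cat !catA cat_uniq => /andP [].
Qed.

Lemma minus_catr s r l : all (mem s) l -> uniq (s ++ r) -> minus (s ++ r) l = minus s l ++ r.
Proof.
move=> /allP ls; rewrite cat_uniq => /and3P [_ /hasPn sr _].
rewrite /minus filter_cat; congr (_ ++ _); apply/all_filterP/allP => w wr.
by apply/negP => /ls; apply/negP; exact: sr.
Qed.

Lemma ok_box_sub s s' b : {subset s <= s'} -> ok_box s b -> ok_box s' b.
Proof.
move=> ss /and4P [h1 h2 h3 /allP h4]; apply/and4P; split => //.
by apply/allP => w /h4 /ss.
Qed.

Lemma ok_in s b : ok_box s b -> all (mem s) (ins b).
Proof. by case/and4P. Qed.

Lemma wf_frame s r bs o : uniq ((s ++ r) ++ all_outs bs) -> wf s bs o ->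
  wf (s ++ r) bs (o ++ r).
Proof.
move=> u h; rewrite /wf u /=.
elim: bs s h u => [|b bs IH] s /=.
  by case/andP => _ /= h _; rewrite perm_cat2r.
case/wf_step => h1 h2 u; rewrite (ok_box_sub _ h1) /=; last first.
  by move=> w ws; rewrite mem_cat ws.
have usr : uniq (s ++ r) by move: u; rewrite cat_uniq => /andP [].
rewrite /step (minus_catr (ok_in h1)) // catA; apply: IH => //.
move: u; rewrite /all_outs /= catA => u.
have {}u : uniq (((outs b ++ s) ++ r) ++ all_outs bs).
  move: u; congr is_true; apply: perm_uniq; rewrite perm_cat2r.
  by rewrite perm_catC catA.
apply: subseq_uniq u; apply: cat_subseq => //; apply: cat_subseq => //.
by apply: cat_subseq => //; exact: filter_subseq.
Qed.

End Wf.

Section Sem.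
Context (S : strict_rigid) (sym : forall U V : ob S, brai V U ∘ brai U V = idm (U ⊠ V)).
Context (O : nat -> ob S) (G : nat -> ar S) (sg : nat -> seq nat * seq nat).
Context (hG : forall g, G g ∈ TO O (sg g).1 ⟶ TO O (sg g).2).
Implicit Types (s o l r : seq wire) (w : wire) (b : box) (bs : seq box).

Local Notation TW := (TW O).
Local Notation wf := (wf sg).

Fixpoint sem s bs o : ar S :=
  if bs is b :: bs' then
    sem (step s b) bs' o ∘ ((G b.1 ⊗ idm (TW (minus s (ins b)))) ∘
                              perm O s (ins b ++ minus s (ins b)))
  else perm O s o.

Lemma hom_box s b : ok_box sg s b -> G b.1 ∈ TW (ins b) ⟶ TW (outs b).
Proof.
case/and4P => /eqP e1 /eqP e2 _ _; rewrite !TWE e1 e2; exact: hG.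
Qed.

Lemma hom_sem s bs o : wf s bs o -> sem s bs o ∈ TW s ⟶ TW o.
Proof.
elim: bs s => [|b bs IH] s /=; first by case/andP => _; exact: hom_perm.
move=> h; have [h1 h2] := wf_step h.
have hs := IH _ h2; have hb := hom_box h1.
have hp := hom_perm O (ok_split (wf_uniq h) h1).
rewrite /step in hs *; rewrite !TW_cat in hs hp; hm.
Qed.

(** The permutations between consecutive states compose, by [perm_comp]. *)
Lemma sem_perm s s' bs o : perm_eq s s' -> wf s bs o ->
  sem s' bs o ∘ perm O s s' = sem s bs o.
Proof.
elim: bs s s' => [|b bs IH] s s' ss /=.
  by case/andP => _ /= so; rewrite perm_comp // -(permPl ss).
move=> h; have [h1 h2] := wf_step h.
have h' : wf s' (b :: bs) o by rewrite -(wf_perm _ _ _ ss).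
have [h1' h2'] := wf_step h'.
have sp := ok_split (wf_uniq h) h1; have sp' := ok_split (wf_uniq h') h1'.
have hn := step_perm b ss; have hd := minus_perm (ins b) ss.
rewrite -(IH _ _ hn h2).
have hb := hom_box h1.
have e := hom_sem h2'; have e1 := hom_perm O sp; have e1' := hom_perm O sp'.
have e2 := hom_perm O hd; have e3 := hom_perm O ss.
rewrite /step in e *; rewrite !TW_cat in e e1 e1'.
rewrite (perm_catl _ _ hd) -comp_assoc; try hm.
rewrite -[RHS]comp_assoc; try hm; congr (_ ∘ _).
rewrite -comp_assoc; try hm.
rewrite [RHS]comp_assoc; try hm.
rewrite -(exch hb e2) perm_comp //.
have -> : perm O s (ins b ++ minus s' (ins b)) =
  perm O (ins b ++ minus s (ins b)) (ins b ++ minus s' (ins b)) ∘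
    perm O s (ins b ++ minus s (ins b)).
  by rewrite perm_comp // perm_cat2l.
rewrite perm_catl // comp_assoc //; hm.
Qed.

Lemma sem_cat s bs cs m o : wf s bs m -> wf m cs o ->
  sem s (bs ++ cs) o = sem m cs o ∘ sem s bs m.
Proof.
move=> h1 h2; elim: bs s h1 => [|b bs IH] s /=.
  move=> /andP [_ /= h]; rewrite sem_perm // (wf_perm _ _ _ h) //.
move=> h; have [h3 h4] := wf_step h; rewrite (IH _ h4).
have e2 := hom_sem h2; have e4 := hom_sem h4; have hb := hom_box h3.
have hp := hom_perm O (ok_split (wf_uniq h) h3).
rewrite /step in e4 *; rewrite !TW_cat in hp e4.
by rewrite [RHS]comp_assoc; try hm.
Qed.

Lemma sem_frame s r bs o : uniq ((s ++ r) ++ all_outs bs) -> wf s bs o ->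
  sem (s ++ r) bs (o ++ r) = sem s bs o ⊗ idm (TW r).
Proof.
elim: bs s => [|b bs IH] s.
  by move=> u /andP [_ /= so]; rewrite perm_catr.
move=> u h; have hf := wf_frame u h; have [_ hf2] := wf_step hf.
have [h1 h2] := wf_step h => /=.
have usr := wf_uniq hf.
have en : step (s ++ r) b = step s b ++ r.
  by rewrite /step (minus_catr (ok_in h1)) // catA.
have un : uniq ((step s b ++ r) ++ all_outs bs) by rewrite -en; case/andP: hf2.
rewrite en (IH _ un h2) (minus_catr (ok_in h1)) // catA.
have sp := ok_split (wf_uniq h) h1.
rewrite perm_catr //.
have e2 := hom_sem h2; have hb := hom_box h1; have hp := hom_perm O sp.
rewrite /step in e2 *; rewrite !TW_cat in e2 hp *.
rewrite !comp_tens_id; try hm.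
by rewrite -tens_assoc tens_id.
Qed.

Lemma minus_self l : minus l l = [::].
Proof. by apply/eqP; rewrite -size_eq0 size_filter -leqn0 leqNgt -has_count; apply/hasPn =>
  w /= ->. Qed.

(** Deduced from [sem_frame] by naturality of the braiding of the spectator
    wires past the diagram. *)
Lemma sem_framel s r bs o : uniq ((s ++ r) ++ all_outs bs) -> wf s bs o ->
  sem (r ++ s) bs (r ++ o) = idm (TW r) ⊗ sem s bs o.
Proof.
move=> u h; have hf := wf_frame u h.
have us := wf_uniq hf.
have us' : uniq (r ++ s) by rewrite uniq_catC.
have uo := wf_uniqo hf.
have e1 : perm_eq (r ++ s) (s ++ r) by rewrite perm_catC.
have e2 : perm_eq (o ++ r) (r ++ o) by rewrite perm_catC.
have hfo : wf (s ++ r) bs (r ++ o) by rewrite -(wf_perm_out _ _ _ e2).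
have -> : sem (r ++ s) bs (r ++ o) = perm O (o ++ r) (r ++ o) ∘ sem (s ++ r) bs (o ++ r) ∘
  perm O (r ++ s) (s ++ r).
  rewrite -(sem_perm e1); last by rewrite (wf_perm _ _ _ e1).
  congr (_ ∘ _).
  have hn : wf (o ++ r) [::] (r ++ o) by rewrite wfE /= cats0 uo.
  by rewrite -(sem_cat hf hn) cats0.
rewrite sem_frame // !perm_swap //.
have e := hom_sem h.
rewrite -comp_assoc; try hm.
rewrite -(brai_natH (hom_id _) e).
by rewrite comp_assoc; try hm; rewrite sym (idlm (U := TW r ⊠ TW s)) //; hm.
Qed.

Lemma minus_comm s l r : minus (minus s l) r = minus (minus s r) l.
Proof. by rewrite /minus -!filter_predI; apply: eq_filter => w /=; rewrite andbC. Qed.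

Lemma minus_step s a b : ~~ has (mem (outs a)) (ins b) ->
  minus (step s a) (ins b) = outs a ++ minus (minus s (ins a)) (ins b).
Proof.
move=> /hasPn nb; rewrite /step /minus filter_cat; congr (_ ++ _).
by apply/all_filterP/allP => w wa; apply/negP => /nb; rewrite /= wa.
Qed.

Lemma step_step s a b : ~~ has (mem (outs a)) (ins b) ->
  step (step s a) b = outs b ++ outs a ++ minus (minus s (ins a)) (ins b).
Proof. by move=> nb; rewrite {1}/step minus_step. Qed.

Lemma swap_oks s a b bs o : wf s (a :: b :: bs) o ->
  ~~ has (mem (outs a)) (ins b) ->
  [/\ ok_box sg s b, ok_box sg (step s b) a, ~~ has (mem (outs b)) (ins a) &
    ok_box sg (minus s (ins a)) b].
Proof.
move=> h /hasPn nb; have [h1 h2] := wf_step h; have [h3 h4] := wf_step h2.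
have bs_ w : w \in ins b -> w \in minus s (ins a).
  move=> wb; move: (allP (ok_in h3) _ wb) (nb _ wb); rewrite /= /step mem_cat.
  by case: (w \in outs a).
have h5 : ok_box sg (minus s (ins a)) b.
  case/and4P: h3 => k1 k2 k3 _; apply/and4P; split => //.
  by apply/allP => w /bs_.
split => //.
- by apply: ok_box_sub h5 => w; rewrite mem_filter => /andP [].
- case/and4P: h1 => k1 k2 k3 k4; apply/and4P; split => //.
  apply/allP => w wa; have ws : w \in s by exact: (allP k4 _ wa).
  rewrite /= /step mem_cat mem_filter ws andbT.
  case wb: (w \in ins b); rewrite ?orbT //.
  by move: (bs_ _ wb); rewrite mem_filter wa.
apply/hasPn => w wa /=; apply/negP => wb.
have ws := allP (ok_in h1) _ wa.
case/andP: h; rewrite cat_uniq => /and3P [_ /hasPn /(_ w) H _] _.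
by move: H; rewrite /all_outs /= !mem_cat wb orbT => /(_ isT) /negP; apply.
Qed.

Lemma wf_swap s a b bs o : wf s (a :: b :: bs) o ->
  ~~ has (mem (outs a)) (ins b) -> wf s (b :: a :: bs) o.
Proof.
move=> h nb; have [h5 h6 na _] := swap_oks h nb.
have u : uniq (s ++ all_outs (b :: a :: bs)).
  case/andP: h => u _; rewrite -(perm_uniq (s1 := s ++ all_outs (a :: b :: bs))) //.
  by rewrite perm_cat2l /all_outs /= perm_catCA.
rewrite wfE u /= h5 h6 /=.
have [_ h2] := wf_step h; have [_] := wf_step h2; case/andP => _.
have pp : perm_eq (step (step s a) b) (step (step s b) a).
  by rewrite !step_step // minus_comm perm_catCA.
by rewrite (wf0_perm _ _ _ pp).
Qed.

(** For boxes that no wire connects, a form in which both are run side by side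
    on disjoint sets of wires. *)
Lemma sem_swap0 s a b bs o : wf s (a :: b :: bs) o ->
  ~~ has (mem (outs a)) (ins b) ->
  let R := minus (minus s (ins a)) (ins b) in
  sem s (a :: b :: bs) o =
  sem (outs a ++ outs b ++ R) bs o ∘ (G a.1 ⊗ G b.1 ⊗ idm (TW R)) ∘
    perm O s (ins a ++ ins b ++ R).
Proof.
move=> h nb R; have [h1 h2] := wf_step h; have [h3 h4] := wf_step h2.
have [h5 _ na h6] := swap_oks h nb.
have us := wf_uniq h.
have p1 := ok_split us h1.
have p2 := ok_split (filter_uniq _ us : uniq (minus s (ins a))) h6; rewrite -/R in p2.
have us2 := wf_uniq h2.
have d2 := ok_split us2 h3; rewrite minus_step // -/R in d2.
have uab : uniq (outs a ++ ins b).
  by move: (us2); rewrite (perm_uniq d2) catA cat_uniq uniq_catC => /andP [].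
have pb : perm_eq ((outs a ++ ins b) ++ R) ((ins b ++ outs a) ++ R).
  by rewrite perm_cat2r perm_catC.
have pa : perm_eq (outs a ++ minus s (ins a)) (outs a ++ ins b ++ R).
  by rewrite perm_cat2l.
have hA := hom_box h1; have hB := hom_box h3.
have u3 := wf_uniq h4; rewrite step_step // -/R in u3.
have po : perm_eq (outs a ++ outs b ++ R) (outs b ++ outs a ++ R) by rewrite perm_catCA.
have h4' : wf (outs a ++ outs b ++ R) bs o.
  by rewrite (wf_perm _ _ _ po) -step_step.
have uo : uniq (outs a ++ outs b).
  by move: u3; rewrite catA cat_uniq uniq_catC => /andP [].
rewrite /= step_step // minus_step // -/R.
have -> : perm O (step s a) (ins b ++ outs a ++ R) =
  (brai (TW (outs a)) (TW (ins b)) ⊗ idm (TW R)) ∘ (idm (TW (outs a)) ⊗ perm O (minus s (ins a))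
    (ins b ++ R)).
  rewrite -perm_catl // -perm_swap // -perm_catr; last by rewrite perm_catC.
  by rewrite -!catA perm_comp // !catA.
have -> : sem (outs a ++ outs b ++ R) bs o =
   sem (outs b ++ outs a ++ R) bs o ∘ (brai (TW (outs a)) (TW (outs b)) ⊗ idm (TW R)).
  rewrite -perm_swap // -perm_catr; last by rewrite perm_catC.
  by rewrite -!catA sem_perm.
have -> : perm O s (ins a ++ ins b ++ R) =
   (idm (TW (ins a)) ⊗ perm O (minus s (ins a)) (ins b ++ R)) ∘ perm O s (ins a ++ minus s (ins a)).
  by rewrite -perm_catl // perm_comp // perm_cat2l.
rewrite [TW (outs a ++ R)]TW_cat.
have q1 := hom_perm O p1; have q2 := hom_perm O p2; rewrite !TW_cat in q1 q2.
have q4 := hom_sem h4; rewrite step_step // -/R !TW_cat in q4.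
rewrite [RHS]comp_assoc; try hm.
rewrite [LHS]comp_assoc; try hm.
congr (_ ∘ _).
rewrite -!comp_assoc; try hm; congr (_ ∘ _).
set P := perm O (minus s (ins a)) _ in q2 *.
have -> : (idm (TW (outs a)) ⊗ P) ∘ (G a.1 ⊗ idm (TW (minus s (ins a)))) =
          (G a.1 ⊗ idm (TW (ins b) ⊠ TW R)) ∘ (idm (TW (ins a)) ⊗ P).
  by rewrite (exch hA q2).
have -> : G a.1 ⊗ G b.1 ⊗ idm (TW R) =
   (idm (TW (outs a)) ⊗ G b.1 ⊗ idm (TW R)) ∘ (G a.1 ⊗ idm (TW (ins b) ⊠ TW R)).
  by rewrite (interr hA (hom_tens hB (hom_id (TW R)))).
rewrite !comp_assoc; try hm.
congr (_ ∘ _ ∘ _).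
rewrite -tens_id !tens_assoc.
rewrite -!comp_tens_id; try hm.
by rewrite (brai_natH (hom_id _) hB).
Qed.

(** The interchange law: in the form given by [sem_swap0] the two orders differ
    by a braiding before and after, which cancel by naturality. *)
Lemma sem_swap s a b bs o : wf s (a :: b :: bs) o ->
  ~~ has (mem (outs a)) (ins b) ->
  sem s (a :: b :: bs) o = sem s (b :: a :: bs) o.
Proof.
move=> h nb; have [h1 h2] := wf_step h; have [h3 h4] := wf_step h2.
have [h5 h6 na h7] := swap_oks h nb.
have h' := wf_swap h nb; have us := wf_uniq h.
rewrite (sem_swap0 h nb) (sem_swap0 h' na) [minus (minus s (ins b)) _]minus_comm.
set R := minus _ _.
have p1 := ok_split us h1.
have p2 := ok_split (filter_uniq _ us : uniq (minus s (ins a))) h7; rewrite -/R in p2.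
have p3 : perm_eq s (ins a ++ ins b ++ R).
  by apply: (perm_trans p1); rewrite perm_cat2l.
have ui : uniq (ins a ++ ins b).
  by move: us; rewrite (perm_uniq p3) catA cat_uniq => /andP [].
have u3 := wf_uniq h4; rewrite step_step // -/R in u3.
have uo : uniq (outs a ++ outs b).
  by move: u3; rewrite catA cat_uniq uniq_catC => /andP [].
have po : perm_eq (outs a ++ outs b ++ R) (outs b ++ outs a ++ R) by rewrite perm_catCA.
have h4' : wf (outs b ++ outs a ++ R) bs o by rewrite -step_step.
have -> : perm O s (ins b ++ ins a ++ R) =
  (brai (TW (ins a)) (TW (ins b)) ⊗ idm (TW R)) ∘ perm O s (ins a ++ ins b ++ R).
  rewrite -perm_swap // -perm_catr; last by rewrite perm_catC.
  by rewrite -!catA perm_comp // perm_catCA.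
have -> : sem (outs a ++ outs b ++ R) bs o =
   sem (outs b ++ outs a ++ R) bs o ∘ (brai (TW (outs a)) (TW (outs b)) ⊗ idm (TW R)).
  rewrite -perm_swap // -perm_catr; last by rewrite perm_catC.
  by rewrite -!catA sem_perm // (wf_perm _ _ _ po).
have hA := hom_box h1; have hB := hom_box h3.
have q3 := hom_perm O p3; rewrite !TW_cat in q3.
have q4 := hom_sem h4'; rewrite !TW_cat in q4.
rewrite [RHS]comp_assoc; try hm.
congr (_ ∘ _); rewrite -!comp_assoc; try hm; congr (_ ∘ _).
by rewrite !tens_assoc -!comp_tens_id; try hm; rewrite (brai_natH hA hB).
Qed.

(** Iterated interchange: only the wires between boxes restrict their order. *)
Lemma bubble s cs b bs o : wf s (cs ++ b :: bs) o ->
  ~~ has (mem (all_outs cs)) (ins b) ->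
  wf s (b :: cs ++ bs) o /\ sem s (cs ++ b :: bs) o = sem s (b :: cs ++ bs) o.
Proof.
elim: cs s => [//|a cs IH] s h nb.
have [na nc] : ~~ has (mem (outs a)) (ins b) /\ ~~ has (mem (all_outs cs)) (ins b).
  split; apply: contra nb => /hasP [w w1 w2]; apply/hasP; exists w => //;
  change (is_true (w \in outs a ++ all_outs cs)); rewrite mem_cat.
    by change (is_true (w \in outs a)) in w2; rewrite w2.
  by change (is_true (w \in all_outs cs)) in w2; rewrite w2 orbT.
have [h1 h2] := wf_step h; have [h3 e] := IH _ h2 nc.
have h4 : wf s (a :: b :: cs ++ bs) o.
  case/andP: h3 => _ h3; rewrite wfE -[wf0 _ _ _ _]/(_ && wf0 sg (step s a) (b ::
    cs ++ bs) o) h3 h1 !andbT.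
  case/andP: h => u _; rewrite -(perm_uniq (s1 := s ++ all_outs ((a :: cs) ++ b :: bs))) //.
  rewrite perm_cat2l; apply: perm_flatten; apply: perm_map.
  by rewrite /= perm_cons -cat1s perm_catCA.
split; first exact: wf_swap.
by rewrite -sem_swap // cat_cons [LHS]/= e.
Qed.

End Sem.

(** * Equality of string diagrams *)

Definition update (m : wire -> wire) (ks vs : seq wire) (w : wire) : wire :=
  if w \in ks then nth w vs (index w ks) else m w.

(** Here and below, conditionals rather than Boolean connectives guard the
    recursive calls: [vm_compute] evaluates both arguments of a connective,
    which would explore every branch of the search. *)
Fixpoint some_split (P : seq box -> box -> seq box -> bool) (pre post : seq box) : bool :=
  if post is t :: post' then
    if P pre t post' then true else some_split P (rcons pre t) post'
  else false.

Lemma some_splitP P pre post : some_split P pre post ->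
  exists pre' t post', pre ++ post = pre' ++ t :: post' /\ P pre' t post'.
Proof.
elim: post pre => [//|t post IH] pre /=; case: ifP => [h _|_].
  by exists pre, t, post.
by case/IH => pre' [t'] [post'] [e ?]; exists pre', t', post'; rewrite -e cat_rcons.
Qed.

(** Isomorphism of diagrams whose inputs correspond under [m]: the boxes of the
    first diagram are located one by one in the second, among those that can be
    run first; [m] accumulates the renaming of wires. *)
Fixpoint iso (m : wire -> wire) (b1 : seq box) (o1 : seq wire)
    (b2 : seq box) (o2 : seq wire) {struct b1} : bool :=
  if b1 is p :: b1' then
    some_split (fun pre t post =>
      if p.1 == t.1 then if map m (ins p) == ins t then
      if has (mem (all_outs pre)) (ins t) then false
      else iso (update m (outs p) (outs t)) b1' o1 (pre ++ post) o2
      else false else false) [::] b2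
  else (b2 == [::]) && (map m o1 == o2).

Lemma uniq_map_inj (m : wire -> wire) s : uniq (map m s) -> {in s &, injective m}.
Proof.
elim: s => // x s IH /= /andP [xs us] a b; rewrite !inE.
case/orP => [/eqP -> | ha] /orP [/eqP -> | hb] // e.
- by case/negP: xs; rewrite e map_f.
- by case/negP: xs; rewrite -e map_f.
- by apply: IH.
Qed.

Lemma map_update m ks vs : uniq ks -> size ks = size vs -> map (update m ks vs) ks = vs.
Proof.
move=> u e; apply: (@eq_from_nth _ (0, 0)); rewrite size_map // => i hi.
rewrite (nth_map (0, 0)) // /update mem_nth // index_uniq //.
by apply: set_nth_default; rewrite -e.
Qed.

Section Iso.
Context (S : strict_rigid) (sym : forall U V : ob S, brai V U ∘ brai U V = idm (U ⊠ V)).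
Context (O : nat -> ob S) (G : nat -> ar S) (sg : nat -> seq nat * seq nat).
Context (hG : forall g, G g ∈ TO O (sg g).1 ⟶ TO O (sg g).2).
Local Notation wf := (wf sg).
Local Notation sem := (sem O G).

Lemma iso_sound m s1 b1 o1 s2 b2 o2 :
  wf s1 b1 o1 -> wf s2 b2 o2 -> s2 = map m s1 ->
  (forall w, w \in s1 -> (m w).2 = w.2) -> iso m b1 o1 b2 o2 ->
  sem s1 b1 o1 = sem s2 b2 o2.
Proof.
elim: b1 m s1 s2 b2 => [|p b1 IH] m s1 s2 b2 h1 h2 e2 tm.
  move=> /= /andP [/eqP e /eqP eo]; move: h2; rewrite {}e {b2} => h2 /=.
  have inj : {in s1 &, injective m} by apply: uniq_map_inj; rewrite -e2 (wf_uniq h2).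
  by rewrite e2 -eo perm_rename //; case/andP: h1.
case/some_splitP => pre [t] [post] [/= e].
case: eqP => // ep; case: eqP => // ei; case: ifP => // /negbT nh hi.
move: h2; rewrite {}e => h2.
have [h3 ->] := bubble sym hG h2 nh.
have inj : {in s1 &, injective m} by apply: uniq_map_inj; rewrite -e2 (wf_uniq h2).
have [k1 k2] := wf_step h1; have [k3 k4] := wf_step h3.
case/and4P: (k1) => /eqP t1 /eqP t2 t3 t4; case/and4P: (k3) => _ /eqP t2' _ _.
have eo : map snd (outs p) = map snd (outs t) by rewrite t2 t2' ep.
have so : size (outs p) = size (outs t) by rewrite -(size_map snd) eo size_map.
have uo : uniq (outs p) by move: (wf_uniq k2); rewrite cat_uniq => /andP [].
set m' := update m (outs p) (outs t) in hi.
have em : {in minus s1 (ins p), m' =1 m}.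
  move=> w wd; rewrite /m' /update; case: ifP => // wo.
  by move: (wf_uniq k2); rewrite cat_uniq => /and3P [_ /hasPn /(_ _ wd)]; rewrite /= wo.
have edm : map m' (minus s1 (ins p)) = map m (minus s1 (ins p)) by apply/eq_in_map.
have ed : minus s2 (ins t) = map m' (minus s1 (ins p)).
  rewrite edm e2 -ei /minus filter_map; congr map; apply: eq_in_filter => w ws /=.
  congr (~~ _).
  apply/mapP/idP => [[v vi /inj ->] //|wi]; last by exists w.
  exact: (allP t4).
have hn : step s2 t = map m' (step s1 p).
  by rewrite /step map_cat ed /m' map_update.
have tn w : w \in step s1 p -> (m' w).2 = w.2.
  rewrite mem_cat => /orP [wo|wd]; last first.
    by rewrite em // tm //; move: wd; rewrite mem_filter => /andP [].
  rewrite /m' /update wo -(nth_map _ 0 snd) -?so ?index_mem // -eo.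
  by rewrite (nth_map w) ?index_mem // nth_index.
rewrite /= (IH _ _ _ _ k2 k4 hn tn hi) ep ed.
congr (_ ∘ ((_ ⊗ idm _) ∘ _)).
  rewrite TW_map // => w wd; apply: tn; by rewrite mem_cat wd orbT.
rewrite edm -ei -map_cat e2 perm_rename //; exact: ok_split (wf_uniq h1) k1.
Qed.

(** Isolates the arrow of a part [L] of a diagram, all other wires alive being
    spectators. This is where an equation satisfied by that arrow can be used. *)
Lemma block_sem s A L B o ls lo mid rest :
  wf s (A ++ L ++ B) o -> mid = after s A -> perm_eq mid (ls ++ rest) ->
  wf ls L lo -> uniq ((ls ++ rest) ++ all_outs L) -> wf (lo ++ rest) B o ->
  sem s (A ++ L ++ B) o =
  sem (lo ++ rest) B o ∘ (sem ls L lo ⊗ idm (TW O rest)) ∘ perm O mid (ls ++ rest)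
    ∘ sem s A mid.
Proof.
move=> h em pm hl u hb; have [hA hLB] := wf_cat_inv h; rewrite -em in hA hLB.
rewrite (sem_cat sym hG hA hLB) -(sem_perm sym hG pm hLB).
by rewrite (sem_cat sym hG (wf_frame u hl) hb) (sem_frame hG u hl).
Qed.

End Iso.

(** * Diagrams of expressions *)

Inductive ob_expr := OOne | OAt of nat | OTens of ob_expr & ob_expr.
Inductive ar_expr := XId of ob_expr | XBrai of ob_expr & ob_expr | XGen of nat
  | XComp of ar_expr & ar_expr | XTens of ar_expr & ar_expr.

Fixpoint flat (x : ob_expr) : seq nat :=
  match x with OOne => [::] | OAt k => [:: k] | OTens x y => flat x ++ flat y end.

Section Compile.
Context (sg : nat -> seq nat * seq nat).

Fixpoint typ (e : ar_expr) : seq nat * seq nat :=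
  match e with
  | XId x => (flat x, flat x)
  | XBrai x y => (flat x ++ flat y, flat y ++ flat x)
  | XGen g => sg g
  | XComp g f => ((typ f).1, (typ g).2)
  | XTens f g => ((typ f).1 ++ (typ g).1, (typ f).2 ++ (typ g).2)
  end.

Fixpoint well_typed (e : ar_expr) : bool :=
  match e with
  | XComp g f => [&& well_typed g, well_typed f & (typ g).1 == (typ f).2]
  | XTens f g => well_typed f && well_typed g
  | _ => true
  end.

(** Identities and braidings yield no boxes, they only rearrange the wires:
    this is how coherence becomes trivial. The counter [n] supplies names. *)
Fixpoint compile (e : ar_expr) (s : seq wire) (n : nat) : seq box * seq wire * nat :=
  match e with
  | XId _ => ([::], s, n)
  | XBrai x y => let k := size (flat x) in ([::], drop k s ++ take k s, n)
  | XGen g => let l := (sg g).2 in let o := zip (iota n (size l)) l in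
      ([:: (g, (s, o))], o, n + size l)
  | XComp g f =>
      let: (b1, m, n1) := compile f s n in
      let: (b2, o, n2) := compile g m n1 in (b1 ++ b2, o, n2)
  | XTens f g =>
      let k := size (typ f).1 in
      let: (b1, o1, n1) := compile f (take k s) n in
      let: (b2, o2, n2) := compile g (drop k s) n1 in (b1 ++ b2, o1 ++ o2, n2)
  end.
End Compile.

Section CompileSound.
Context (S : strict_rigid) (sym : forall U V : ob S, brai V U ∘ brai U V = idm (U ⊠ V)).
Context (O : nat -> ob S) (G : nat -> ar S) (sg : nat -> seq nat * seq nat).
Context (hG : forall g, G g ∈ TO O (sg g).1 ⟶ TO O (sg g).2).
Local Notation wf := (wf sg).
Local Notation sem := (sem O G).

Fixpoint denO (x : ob_expr) : ob S :=
  match x with OOne => one | OAt k => O k | OTens x y => denO x ⊠ denO y end.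
Fixpoint den (e : ar_expr) : ar S :=
  match e with
  | XId x => idm (denO x)
  | XBrai x y => brai (denO x) (denO y)
  | XGen g => G g
  | XComp g f => den g ∘ den f
  | XTens f g => den f ⊗ den g
  end.

Lemma TO_flat x : TO O (flat x) = denO x.
Proof. by elim: x => [|k|x IHx y IHy] /=; rewrite ?otens_1r // TO_cat IHx IHy. Qed.

(** The counter bounds all names in use, whence new names are fresh. *)
Definition below n (s : seq wire) := all (fun w => w.1 < n) s.
Definition within n n' (s : seq wire) := all (fun w => n <= w.1 < n') s.

Lemma below_le n n' s : n <= n' -> below n s -> below n' s.
Proof. by move=> h; apply: sub_all => w /= k; apply: leq_trans k h. Qed.

Lemma below_cat n (s t : seq wire) : below n (s ++ t) = below n s && below n t.
Proof. exact: all_cat. Qed.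

Lemma within_below n n' s : within n n' s -> below n' s.
Proof. by apply: sub_all => w /andP []. Qed.

Lemma within_uniq n n' s t : below n s -> within n n' t -> uniq s -> uniq t -> uniq (s ++ t).
Proof.
move=> /allP bs /allP well_typed us ut; rewrite cat_uniq us ut andbT /=.
apply/hasPn => w /well_typed /andP [h _]; apply/negP => /bs /=; by rewrite ltnNge h.
Qed.

Lemma compile_sound e s n : well_typed sg e -> map snd s = (typ sg e).1 -> uniq s -> below n s ->
  let: (bs, o, n') := compile sg e s n in
  [/\ [/\ wf s bs o & sem s bs o = den e], map snd o = (typ sg e).2,
      below n' o, n <= n' & within n n' (all_outs bs)].
Proof.
elim: e s n => [x|x y|g|g IHg f IHf|f IHf g IHg] s n.
- move=> _ es us bs /=; split=> //; split.
    by rewrite wfE /= cats0 us perm_refl.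
  by rewrite perm_id /TW es /= TO_flat.
- move=> _ es us bs /=; set k := size (flat x).
  have e1 : map snd (take k s) = flat x by rewrite map_take es /= take_size_cat.
  have e2 : map snd (drop k s) = flat y by rewrite map_drop es /= drop_size_cat.
  have ts := cat_take_drop k s.
  have pe : perm_eq s (drop k s ++ take k s) by rewrite -{1}ts perm_catC.
  split=> //; last 1 first.
  + by rewrite /below -(perm_all _ pe).
  + split; first by rewrite wfE /= cats0 us.
    by rewrite -{1}ts perm_swap ?ts // /TW e1 e2 !TO_flat.
  + by rewrite map_cat e1 e2.
- move=> _ /= es us bs; set l := (sg g).2; set o := zip _ _.
  have eo : map snd o = l by rewrite -/(unzip2 o) unzip2_zip // size_iota.
  have ef : map fst o = iota n (size l) by rewrite -/(unzip1 o) unzip1_zip // size_iota.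
  have wo : within n (n + size l) o.
    apply/allP => w wo; have : w.1 \in map fst o by apply: map_f.
    by rewrite ef mem_iota.
  have uo : uniq o by apply: (@map_uniq _ _ fst); rewrite ef iota_uniq.
  have u : uniq (s ++ o) by apply: within_uniq wo us uo.
  have k : ok_box sg s (g, (s, o)).
    by apply/and4P; rewrite /= es eo us !eqxx; split => //; apply/allP.
  have en : step s (g, (s, o)) = o by rewrite /step /= minus_self cats0.
  split => //; rewrite ?leq_addr ?/all_outs /= ?cats0 //.
  + split; first by rewrite wfE /all_outs /= k en perm_refl !cats0 u.
    rewrite en perm_id minus_self cats0 perm_id tens_1r.
    rewrite /TW eo es; have h := hG g.
    by rewrite (idrm h) (idlm h).
  + by apply: sub_all wo => w /andP [].
- move=> /= /and3P [wg wf_ /eqP et] es us bs.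
  have := IHf s n wf_ es us bs; case: (compile sg f s n) => [[b1 m] n1].
  case=> -[h1 e1] t1 l1 n1n w1.
  have um := wf_uniqo h1.
  have := IHg m n1 wg _ um l1; rewrite t1 et => /(_ erefl).
  case: (compile sg g m n1) => [[b2 o] n2] [[h2 e2] t2 l2 n2n w2].
  have u : uniq (s ++ all_outs (b1 ++ b2)).
    rewrite /all_outs map_cat flatten_cat catA; apply: (@within_uniq n1 n2) => //.
    + by rewrite below_cat (below_le n1n bs) (within_below w1).
    + by case/andP: h1.
    + by case/andP: h2 => + _; rewrite cat_uniq => /and3P [].
  split => //; last 1 first.
  + rewrite /all_outs map_cat flatten_cat /within all_cat; apply/andP; split.
      by apply: sub_all w1 => w /andP [-> h]; rewrite (leq_trans h).
    by apply: sub_all w2 => w /andP [h ->]; rewrite (leq_trans n1n).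
  + split; first exact: wf_cat h1 h2 u.
    by rewrite (sem_cat sym hG h1 h2) e1 e2.
  + by rewrite (leq_trans n1n).
- move=> /= /andP [wf_ wg] es us bs; set k := size _.
  have es1 : map snd (take k s) = (typ sg f).1 by rewrite map_take es take_size_cat.
  have es2 : map snd (drop k s) = (typ sg g).1 by rewrite map_drop es drop_size_cat.
  move: (take k s) (drop k s) (cat_take_drop k s) es1 es2 => s1 s2 ss es1 es2.
  move: us bs; rewrite -{}ss {s es} => us; rewrite below_cat => /andP [bs1 bs2].
  have [us1 us2] : uniq s1 /\ uniq s2 by move: us; rewrite cat_uniq => /and3P [].
  have := IHf s1 n wf_ es1 us1 bs1; case: (compile sg f s1 n) => [[b1 o1] n1].
  case=> -[h1 e1] t1 l1 n1n w1.
  have bs2' := below_le n1n bs2.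
  have := IHg s2 n1 wg es2 us2 bs2'; case: (compile sg g s2 n1) => [[b2 o2] n2].
  case=> -[h2 e2] t2 l2 n2n w2.
  have ub1 : uniq (all_outs b1) by case/andP: h1 => + _; rewrite cat_uniq => /and3P [].
  have ub2 : uniq (all_outs b2) by case/andP: h2 => + _; rewrite cat_uniq => /and3P [].
  have u1 : uniq ((s1 ++ s2) ++ all_outs b1).
    by apply: within_uniq w1 us ub1; rewrite below_cat bs1.
  have f1 := wf_frame u1 h1.
  have uo1 := wf_uniqo f1.
  have u2 : uniq ((s2 ++ o1) ++ all_outs b2).
    apply: within_uniq w2 _ ub2; first by rewrite below_cat bs2'.
    by rewrite uniq_catC.
  have f2 : wf (o1 ++ s2) b2 (o1 ++ o2).
    have := wf_frame u2 h2; rewrite (wf_perm _ _ _ (s' := o1 ++ s2)); last by rewrite perm_catC.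
    by rewrite (wf_perm_out _ _ _ (o' := o1 ++ o2)) // perm_catC.
  have u : uniq ((s1 ++ s2) ++ all_outs (b1 ++ b2)).
    rewrite /all_outs map_cat flatten_cat catA; apply: (@within_uniq n1 n2) => //.
    rewrite !below_cat (below_le n1n bs1) bs2' /=.
    exact: within_below w1.
  split => //; rewrite ?map_cat ?t1 ?t2 //.
  + split; first exact: wf_cat f1 f2 u.
    rewrite (sem_cat sym hG f1 f2) (sem_frame hG u1 h1) (sem_framel sym hG u2 h2) -e1 -e2.
    exact: interr (hom_sem hG h1) (hom_sem hG h2).
  + by rewrite below_cat l2 andbT; apply: below_le l1.
  + by rewrite (leq_trans n1n).
  + rewrite /all_outs map_cat flatten_cat /within all_cat; apply/andP; split.
      by apply: sub_all w1 => w /andP [-> h]; rewrite (leq_trans h).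
    by apply: sub_all w2 => w /andP [h ->]; rewrite (leq_trans n1n).
Qed.

End CompileSound.

(** * Rewriting string diagrams *)

(** Input wires, boxes, output wires. *)
Definition net : Type := (seq wire * (seq box * seq wire))%type.

Fixpoint lookup (m : seq (wire * wire)) (w : wire) : wire :=
  if m is kv :: m' then if kv.1 == w then kv.2 else lookup m' w else w.

Fixpoint extend_match (ks vs : seq wire) (m : seq (wire * wire)) : option (seq (wire * wire)) :=
  match ks, vs with
  | k :: ks', v :: vs' =>
      if k \in map fst m then
        if lookup m k == v then extend_match ks' vs' m else None
      else if v \in map snd m then None else extend_match ks' vs' ((k, v) :: m)
  | [::], [::] => Some m
  | _, _ => None
  end.

(** Each match is a renaming of the wires of the pattern, with the positions of
    the boxes that were matched. *)
Fixpoint matches (pat : seq box) (tgt : seq (nat * box)) (m : seq (wire * wire))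
    (used : seq nat) : seq (seq (wire * wire) * seq nat) :=
  if pat is p :: pat' then
    flatten [seq if (it.1 \in used) || (it.2.1 != p.1) then [::] else
               if extend_match (ins p ++ outs p) (ins it.2 ++ outs it.2) m is Some m'
               then matches pat' tgt m' (it.1 :: used) else [::]
            | it <- tgt]
  else [:: (m, used)].

(** Divides the other boxes into those that can be run before the match and
    those that have to wait for it; the wires in [hot] depend on the match. *)
Fixpoint cut_match (used : seq nat) (hot : seq wire) (ibs : seq (nat * box)) : seq box * seq box :=
  if ibs is it :: ibs' then
    if it.1 \in used then cut_match used (outs it.2 ++ hot) ibs'
    else if has (mem hot) (ins it.2) then
      let: (A, B) := cut_match used (outs it.2 ++ hot) ibs' in (A, it.2 :: B)
    else let: (A, B) := cut_match used hot ibs' in (it.2 :: A, B)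
  else ([::], [::]).

Definition rename_box (f : wire -> wire) (b : box) : box := (b.1, (map f (ins b), map f (outs b))).

Definition same_ty (f : wire -> wire) (s : seq wire) := all (fun w => (f w).2 == w.2) s.

Section Rewrite.
Context (sg : nat -> seq nat * seq nat).

(** One step with the rule from [ls, lb, lo] to [ls, rb, ro] at a given match.
    The result is tested rather than the search proved correct: the conditions
    are those from which [rewrite_at_sound] derives that the step preserves the
    arrow of the diagram. *)
Definition rewrite_at (N : net) (ls : seq wire) (lb : seq box) (lo : seq wire)
    (rb : seq box) (ro : seq wire) (mu : seq (wire * wire) * seq nat) : option net :=
  let: (s, (bs, o)) := N in
  let m := lookup mu.1 in
  let: (A, B) := cut_match mu.2 [::] (zip (iota 0 (size bs)) bs) in
  let L := map (rename_box m) lb in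
  (* Internal wires of the right hand side are renamed beyond all names in use. *)
  let F := (foldr maxn 0 (map fst (s ++ all_outs bs))).+1 in
  let r2 := fun w : wire => if w \in ls then m w else (w.1 + F, w.2) in
  let R := map (rename_box r2) rb in
  let ls' := map m ls in let lo' := map m lo in let ro' := map r2 ro in
  let rho := update id lo' ro' in
  let B' := map (rename_box rho) B in let o' := map rho o in
  let mid := after s A in
  let rest := minus mid ls' in
  if [&& [&& wf sg s (A ++ L ++ B) o, iso id bs o (A ++ L ++ B) o,
         same_ty m ls, wf sg ls' L lo' & iso m lb lo L lo'],
      [&& map m ls == map r2 ls, wf sg ls' R ro', iso r2 rb ro R ro',
          wf sg s (A ++ R ++ B') o' & perm_eq mid (ls' ++ rest)],
      [&& uniq ((ls' ++ rest) ++ all_outs L), uniq ((ls' ++ rest) ++ all_outs R),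
          wf sg (lo' ++ rest) B o, wf sg (ro' ++ rest) B' o' &
          map rho (lo' ++ rest) == ro' ++ rest],
      same_ty rho (lo' ++ rest) & iso rho B o B' o']
  then Some (s, (A ++ R ++ B', o')) else None.

Definition inputs (e : ar_expr) : seq wire :=
  let t := (typ sg e).1 in zip (iota 0 (size t)) t.
Definition netof (e : ar_expr) : net :=
  let s := inputs e in
  let: (bs, o, _) := compile sg e s (size s) in (s, (bs, o)).

Definition isoN (N M : net) : bool :=
  if N.1 == M.1 then iso id N.2.1 N.2.2 M.2.1 M.2.2 else false.

Fixpoint lazy_has (T : Type) (P : T -> bool) (s : seq T) : bool :=
  if s is x :: s' then if P x then true else lazy_has P s' else false.

(** The search is depth first over the matches of every rule, since only the
    final comparison tells whether the intended match was chosen. *)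
Fixpoint solve (rules : seq (ar_expr * ar_expr)) (N M : net) : bool :=
  if rules is (l, r) :: rules' then
    if [&& well_typed sg l, well_typed sg r & typ sg l == typ sg r] then
      let ls := inputs l in
      let: (_, (lb, lo)) := netof l in
      let: (_, (rb, ro)) := netof r in
      lazy_has (fun mu =>
          if rewrite_at N ls lb lo rb ro mu is Some N' then solve rules' N' M else false)
        (matches lb (zip (iota 0 (size N.2.1)) N.2.1) [::] [::])
    else false
  else isoN N M.

Definition check (rules : seq (ar_expr * ar_expr)) (e1 e2 : ar_expr) : bool :=
  if [&& well_typed sg e1, well_typed sg e2 & typ sg e1 == typ sg e2] then
    solve rules (netof e1) (netof e2) else false.

End Rewrite.

Section RewriteSound.
Context (S : strict_rigid) (sym : forall U V : ob S, brai V U ∘ brai U V = idm (U ⊠ V)).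
Context (O : nat -> ob S) (G : nat -> ar S) (sg : nat -> seq nat * seq nat).
Context (hG : forall g, G g ∈ TO O (sg g).1 ⟶ TO O (sg g).2).
Local Notation wf := (wf sg).
Local Notation sem := (sem O G).

Definition wfN (N : net) := wf N.1 N.2.1 N.2.2.
Definition semN (N : net) := sem N.1 N.2.1 N.2.2.

Lemma same_tyP f s : same_ty f s -> forall w, w \in s -> (f w).2 = w.2.
Proof. by move=> /allP h w /h /eqP. Qed.

Lemma rewrite_at_sound N ls lb lo rb ro mu N' :
  wfN N -> wf ls lb lo -> wf ls rb ro -> sem ls lb lo = sem ls rb ro ->
  rewrite_at sg N ls lb lo rb ro mu = Some N' -> wfN N' /\ semN N = semN N'.
Proof.
case: N => s [bs o]; rewrite /wfN /semN /=; set m := lookup mu.1.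
case: (cut_match _ _ _) => A B.
set L := map (rename_box m) lb; set F := (foldr maxn 0 _).+1.
set r2 := (fun w : wire => if w \in ls then m w else (w.1 + F, w.2));
  set R := map (rename_box r2) rb; set ls' := map m ls.
set lo' := map m lo; set ro' := map r2 ro; set rho := update id lo' ro'.
set B' := map _ B; set o' := map rho o; set mid := after s A; set rest := minus mid ls'.
move=> h hl hr e; case: ifP => //.
case/and5P => /and5P [a1 a2 /same_tyP a3 a4 a5] /and5P [/eqP b1 b2 b3 b4 b5]
  /and5P [c1 c2 c3 c4 /eqP c5] /same_tyP d1 d2 [<-] /=.
split => //.
rewrite (iso_sound sym hG h a1 _ _ a2) ?map_id //.
rewrite (block_sem sym hG a1 erefl b5 a4 c1 c3).
rewrite (block_sem sym hG b4 erefl b5 b2 c2 c4).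
have <- : sem (lo' ++ rest) B o = sem (ro' ++ rest) B' o'.
  by apply: (iso_sound sym hG c3 c4 (esym c5)).
have <- : sem ls lb lo = sem ls' L lo' by apply: (iso_sound sym hG hl a4 (m := m)).
have <- : sem ls rb ro = sem ls' R ro'.
  apply: (iso_sound sym hG hr b2 b1 _ b3) => w wl.
  by rewrite /r2 wl a3.
by rewrite e.
Qed.

Lemma inputs_ok e : [/\ map snd (inputs sg e) = (typ sg e).1, uniq (inputs sg e) &
  below (size (inputs sg e)) (inputs sg e)].
Proof.
rewrite /inputs; set t := (typ sg e).1.
have e1 : map fst (zip (iota 0 (size t)) t) = iota 0 (size t).
  by rewrite -/(unzip1 _) unzip1_zip // size_iota.
split; first by rewrite -/(unzip2 _) unzip2_zip // size_iota.
  by apply: (@map_uniq _ _ fst); rewrite e1 iota_uniq.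
rewrite size_zip size_iota minnn; apply/allP => w hw.
have : w.1 \in map fst (zip (iota 0 (size t)) t) by apply: map_f.
by rewrite e1 mem_iota.
Qed.

Lemma netof_ok e : well_typed sg e -> wfN (netof sg e) /\ semN (netof sg e) = den O G e.
Proof.
move=> h; have [t u b] := inputs_ok e; have := compile_sound sym hG h t u b.
by rewrite /netof; case: (compile _ _ _ _) => [[bs o] n] [[? ?] _ _ _ _].
Qed.

Lemma netof_in e : (netof sg e).1 = inputs sg e.
Proof. by rewrite /netof; case: (compile _ _ _ _) => [[]]. Qed.

Fixpoint holds (rules : seq (ar_expr * ar_expr)) : Prop :=
  if rules is lr :: rules' then den O G lr.1 = den O G lr.2 /\ holds rules' else True.

Lemma lazy_hasP (T : Type) (P : T -> bool) q : lazy_has P q -> exists x, P x.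
Proof. by elim: q => //= x q IH; case: ifP => // h _; exists x. Qed.

Lemma solve_sound rules N M : wfN N -> wfN M -> holds rules ->
  solve sg rules N M -> semN N = semN M.
Proof.
elim: rules N => [|[l r] rules IH] N hN hM /=.
  by rewrite /isoN; case: eqP => // e _; apply: iso_sound => //; rewrite map_id.
case=> e hr; case: ifP => // /and3P [wl wr /eqP et].
have [hl el] := netof_ok wl; have [hr' er] := netof_ok wr.
have ei : inputs sg r = inputs sg l by rewrite /inputs et.
have il := netof_in l; have ir := netof_in r; rewrite {}ei in ir.
move: hl el hr' er il ir; case: (netof sg l) => i1 [lb lo]; case: (netof sg r) => i2 [rb ro].
rewrite /wfN /semN /= => h1 e1 h2 e2 i1E i2E; subst i1 i2.
case/lazy_hasP => mu; case E: (rewrite_at _ _ _ _ _ _ _ _) => [N'|] // hs.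
have [|h e3] := rewrite_at_sound hN h1 h2 _ E; first by rewrite e1 e2.
by rewrite -/(semN N) -/(semN M) e3; exact: IH.
Qed.

Lemma check_sound rules e1 e2 : holds rules -> check sg rules e1 e2 ->
  den O G e1 = den O G e2.
Proof.
rewrite /check => hr; case: ifP => // /and3P [w1 w2 _] hs.
have [h1 <-] := netof_ok w1; have [h2 <-] := netof_ok w2.
exact: solve_sound hs.
Qed.

End RewriteSound.

Section Env.
Context (S : strict_rigid) (sym : forall U V : ob S, brai V U ∘ brai U V = idm (U ⊠ V)).

Definition objs (os : seq (ob S)) (k : nat) : ob S := nth one os k.
Definition gens (gs : seq (ar S)) (g : nat) : ar S := nth (idm one) gs g.
Definition sigs (ts : seq (ob_expr * ob_expr)) (g : nat) : seq nat * seq nat :=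
  let t := nth (OOne, OOne) ts g in (flat t.1, flat t.2).

Fixpoint typed (os : seq (ob S)) (gs : seq (ar S)) (ts : seq (ob_expr * ob_expr)) : Prop :=
  match gs, ts with
  | g :: gs', t :: ts' =>
      g ∈ denO (objs os) t.1 ⟶ denO (objs os) t.2 /\ typed os gs' ts'
  | [::], [::] => True
  | _, _ => False
  end.

Lemma typedP os gs ts : typed os gs ts ->
  forall g, gens gs g ∈ TO (objs os) (sigs ts g).1 ⟶ TO (objs os) (sigs ts g).2.
Proof.
elim: gs ts => [|f gs IH] [|t ts] //=.
  by move=> _ g; rewrite /gens /sigs !nth_nil /=; exact: hom_id.
by case=> hf /IH h [|g]; [rewrite /sigs /= !TO_flat | exact: h].
Qed.

Theorem net_sound os gs ts rules e1 e2 : typed os gs ts ->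
  holds (objs os) (gens gs) rules -> check (sigs ts) rules e1 e2 ->
  den (objs os) (gens gs) e1 = den (objs os) (gens gs) e2.
Proof. by move=> /typedP h; apply: check_sound. Qed.

End Env.

(** * Reification *)

(** Objects and arrows are numbered by their position in a list, compared
    syntactically. *)
Ltac nidx x l := lazymatch l with
  | cons x _ => constr:(O)
  | cons _ ?t => let n := nidx x t in constr:(S n)
  end.
Ltac nadd x l := lazymatch l with
  | nil => constr:(cons x nil)
  | cons x _ => l
  | cons ?y ?t => let t' := nadd x t in constr:(cons y t')
  end.
Ltac addO U os := lazymatch U with
  | one => os
  | otens ?A ?B => let os1 := addO A os in addO B os1
  | _ => nadd U os
  end.
Ltac rO U os := lazymatch U with
  | one => constr:(OOne)
  | otens ?A ?B => let a := rO A os in let b := rO B os in constr:(OTens a b)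
  | _ => let n := nidx U os in constr:(OAt n)
  end.
Ltac scan e st := lazymatch st with (?os, ?gs) => lazymatch e with
  | comp ?g ?f => let st1 := scan g st in scan f st1
  | tens ?f ?g => let st1 := scan f st in scan g st1
  | idm ?U => let os1 := addO U os in constr:((os1, gs))
  | brai ?U ?V => let os1 := addO U os in let os2 := addO V os1 in constr:((os2, gs))
  | _ => let gs1 := nadd e gs in constr:((os, gs1))
  end end.
Ltac rE e os gs := lazymatch e with
  | comp ?g ?f => let a := rE g os gs in let b := rE f os gs in constr:(XComp a b)
  | tens ?f ?g => let a := rE f os gs in let b := rE g os gs in constr:(XTens a b)
  | idm ?U => let a := rO U os in constr:(XId a)
  | brai ?U ?V => let a := rO U os in let b := rO V os in constr:(XBrai a b)
  | _ => let n := nidx e gs in constr:(XGen n)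
  end.
Ltac scan_rules r st := lazymatch r with
  | (?a, ?b) => let st1 := scan_rules a st in scan_rules b st1
  | tt => st
  | _ => let T := type of r in lazymatch T with
         | ?lhs = ?rhs => let st1 := scan lhs st in scan rhs st1 end
  end.

(** The reified rules, added to [acc], and the proof that they hold. *)
Ltac r_rules r os gs acc pf := lazymatch r with
  | (?a, ?b) => lazymatch r_rules b os gs acc pf with
      (?acc1, ?pf1) => r_rules a os gs acc1 pf1 end
  | tt => constr:((acc, pf))
  | _ => let T := type of r in lazymatch T with
         | ?lhs = ?rhs => let a := rE lhs os gs in let b := rE rhs os gs in
             constr:((cons (a, b) acc, conj r pf)) end
  end.
Ltac typing f := match goal with
  | _ => constr:(ltac:(solve [eassumption | eauto 4 with homdb]) : hom _ _ f)
  | _ => fail 1 "no source and target known for" f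
  end.
Ltac gen_types gs := lazymatch gs with
  | nil => constr:(I)
  | cons ?f ?t => let p := gen_types t in let h := typing f in constr:(conj h p)
  end.
Ltac types_obs p os := lazymatch p with
  | I => os
  | conj ?h ?q => lazymatch type of h with hom ?U ?V _ =>
      let os1 := addO U os in let os2 := addO V os1 in types_obs q os2 end
  end.
Ltac r_types p os := lazymatch p with
  | I => constr:(@nil (ob_expr * ob_expr))
  | conj ?h ?q => lazymatch type of h with hom ?U ?V _ =>
      let a := rO U os in let b := rO V os in let t := r_types q os in
      constr:(cons (a, b) t) end
  end.

Ltac net_with r k :=
  lazymatch goal with
  | |- @eq (ar ?S) ?e1 ?e2 =>
    let st0 := constr:((@nil (ob S), @nil (ar S))) in
    let st1 := scan e1 st0 in let st2 := scan e2 st1 in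
    lazymatch scan_rules r st2 with
    | (?os0, ?gs) =>
      let p := gen_types gs in
      let os := types_obs p os0 in
      let ts := r_types p os in
      let x1 := rE e1 os gs in let x2 := rE e2 os gs in
      lazymatch r_rules r os gs (@nil (ar_expr * ar_expr)) I with
      | (?rs, ?pf) => k os gs ts p rs pf x1 x2
      end
    end
  end.

Ltac net_run r :=
  net_with r ltac:(fun os gs ts p rs pf x1 x2 =>
    lazymatch goal with hs : symmetric _ |- _ =>
    let b := eval vm_compute in (check (sigs ts) rs x1 x2) in
    lazymatch b with
    | true => refine (@net_sound _ hs os gs ts rs x1 x2 p pf _);
              vm_cast_no_check (@erefl bool true)
    | false => fail "the rewritten diagrams do not agree"
    end end).

(** [net (e1, ..., en)] proves an equation between arrows of the base category.
    The string diagram of its left hand side is rewritten with the equations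
    e1, ..., en, each used once, from left to right and in this order; the result
    is compared with the right hand side as a diagram, hence up to the axioms of
    a symmetric monoidal category. Sources and targets of the arrows other than
    identities and braidings are taken from the context or from [homdb]. *)
Tactic Notation "net" := net_run tt.
Tactic Notation "net" constr(r) := net_run r.

(** * Duals and the pivotal structure of the base category *)

#[export] Hint Resolve mul_hom uni_hom comul_hom counit_hom antip_hom antipV_hom : homdb.

Section Base.
Context (S : ribbon) (S_sym : symmetric S).

(** Evaluation is a nondegenerate pairing: composing with the coevaluation
    recovers [f], by the zigzag identity. *)
Lemma ev_inj A U (f f' : ar S) : f ∈ A ⟶ U^∨ -> f' ∈ A ⟶ U^∨ ->
  ev U ∘ (f ⊗ idm U) = ev U ∘ (f' ⊗ idm U) -> f = f'.
Proof.
move=> hf hf' e.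
have z := zigzag_dual U.
transitivity (((ev U ∘ (f ⊗ idm U)) ⊗ idm U^∨) ∘ (idm A ⊗ coev U)).
  symmetry; net z.
by rewrite e; net z.
Qed.

Lemma ev_transp A U (e : ar S) : e ∈ A ⊠ U ⟶ one ->
  ev U ∘ (transp A U e ⊗ idm U) = e.
Proof. exact: transp1K. Qed.

Lemma hom_transp A U (e : ar S) : e ∈ A ⊠ U ⟶ one -> transp A U e ∈ A ⟶ U^∨.
Proof. by move/transp_hom; rewrite otens_1l. Qed.

Lemma base_inv_id (U : ob S) : @inv (base_data S) U U (idm U) = idm U.
Proof.
have h : @is_inverse (base_data S) U U (idm U) (idm U).
  by split; rewrite //= ?comp_id //; exact: hom_id.
have [h1 h2 h3] := epsilon_spec (inhabits (idm U)) _ (ex_intro _ _ h).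
by move: h2; rewrite -/(@inv (base_data S) U U (idm U)) /= in h1 *; rewrite (idrm h1).
Qed.

Lemma dualmE U V (f : ar S) : f ∈ U ⟶ V ->
  dualm f = transp V^∨ U (ev V ∘ (idm V^∨ ⊗ f)).
Proof.
move=> hf; case: (hf) => e1 e2; rewrite /dualm e1 e2 /dual_arr /=.
rewrite otens_1r base_inv_id /transp; net.
Qed.

Lemma dualm_hom U V (f : ar S) : f ∈ U ⟶ V -> dualm f ∈ V^∨ ⟶ U^∨.
Proof. by move=> hf; rewrite (dualmE hf); apply: hom_transp; hm. Qed.

Lemma ev_dualm U V (f : ar S) : f ∈ U ⟶ V ->
  ev U ∘ (dualm f ⊗ idm U) = ev V ∘ (idm V^∨ ⊗ f).
Proof. by move=> hf; rewrite (dualmE hf) ev_transp //; hm. Qed.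

Context (S_twist : trivial_twist S).

(** The Drinfeld isomorphism is the adjunct of evaluation after a braiding, and
    the twist is trivial. *)
Lemma pivE U : piv U = transp U U^∨ (ev U ∘ brai U U^∨) :> ar S.
Proof.
rewrite piv_twist S_twist /transp; net.
Qed.

Lemma piv_hom U : piv U ∈ U ⟶ (U^∨^∨ : ob S).
Proof. by rewrite pivE; apply: hom_transp; hm. Qed.

Lemma ev_piv U : ev U^∨ ∘ (piv U ⊗ idm U^∨) = ev U ∘ brai U U^∨ :> ar S.
Proof. by rewrite pivE ev_transp //; hm. Qed.

(** The inverse Drinfeld isomorphism. *)
Definition pivV (U : ob S) : ar S :=
  (ev U^∨ ⊗ idm U) ∘ (idm U^∨^∨ ⊗ (brai U U^∨ ∘ coev U)).

Lemma pivV_hom U : pivV U ∈ U^∨^∨ ⟶ U.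
Proof. rewrite /pivV; hm. Qed.

Lemma pivK U : pivV U ∘ piv U = idm U.
Proof.
have h := piv_hom U; rewrite /pivV.
have e := ev_piv U; net (e, zigzag U).
Qed.

Lemma pivVK U : piv U ∘ pivV U = idm U^∨^∨.
Proof.
have h := piv_hom U; rewrite /pivV.
apply: (@ev_inj U^∨^∨ U^∨); [hm|hm|].
have e := ev_piv U; net (e, zigzag_dual U).
Qed.

Lemma piv_nat U V (f : ar S) : f ∈ U ⟶ V ->
  piv V ∘ f = dualm (dualm f) ∘ piv U.
Proof.
move=> hf; have h1 := dualm_hom hf; have h2 := dualm_hom h1.
have hU := piv_hom U; have hV := piv_hom V.
apply: (@ev_inj U V^∨); [hm|hm|].
have e1 := ev_piv U; have e2 := ev_piv V; have e3 := ev_dualm hf; have e4 := ev_dualm h1.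
transitivity (ev V ∘ (idm V^∨ ⊗ f) ∘ brai U V^∨); first by net e2.
symmetry; net (e4, e1, e3).
Qed.

End Base.

(** * Antipodes *)

Section Conv.
Context (S : ribbon) (S_sym : symmetric S).

(** Inverses in a monoid are unique; here the monoid is that of the arrows
    [C -> A] under convolution. *)
Lemma conv_uniq (C A : ob S) (d e m u f g h : ar S) :
  d ∈ C ⟶ C ⊠ C -> e ∈ C ⟶ one -> m ∈ A ⊠ A ⟶ A -> u ∈ one ⟶ A ->
  f ∈ C ⟶ A -> g ∈ C ⟶ A -> h ∈ C ⟶ A ->
  (d ⊗ idm C) ∘ d = (idm C ⊗ d) ∘ d ->
  (e ⊗ idm C) ∘ d = idm C -> (idm C ⊗ e) ∘ d = idm C ->
  m ∘ (m ⊗ idm A) = m ∘ (idm A ⊗ m) ->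
  m ∘ (u ⊗ idm A) = idm A -> m ∘ (idm A ⊗ u) = idm A ->
  m ∘ (g ⊗ f) ∘ d = u ∘ e -> m ∘ (f ⊗ h) ∘ d = u ∘ e -> g = h.
Proof.
move=> hd he hm_ hu hf hg hh dd ed de mm um mu gf fh.
transitivity (m ∘ (g ⊗ (m ∘ (f ⊗ h) ∘ d)) ∘ d); first by symmetry; net (fh, mu, de).
net (esym mm, esym dd, gf, um, ed).
Qed.

Context (H : hopf_alg S).
Local Notation μ := (mul H).
Local Notation Δ := (comul H).
Local Notation η := (uni H).
Local Notation ε := (counit H).
Local Notation s := (antip H).
Local Notation sV := (antipV H).
Local Notation ι := (idm H).
Local Notation τ := (brai H H).

(** Both sides are convolution inverse to the multiplication, on H ⊗ H. *)
Lemma antip_mul : s ∘ μ = μ ∘ (s ⊗ s) ∘ τ.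
Proof.
apply: (@conv_uniq (H ⊠ H) H ((ι ⊗ τ ⊗ ι) ∘ (Δ ⊗ Δ)) (ε ⊗ ε) μ η μ); try hm.
- net (comul_assoc H, comul_assoc H).
- net (comul_1l H, comul_1l H).
- net (comul_1r H, comul_1r H).
- exact: mul_assoc.
- exact: mul_1l.
- exact: mul_1r.
- net (esym (comul_mul H), antip_l H, counit_mul H).
- net (mul_assoc H, esym (mul_assoc H), antip_r H, mul_1l H, antip_r H).
Qed.

(** Both sides are convolution inverse to the comultiplication, with values in
    H ⊗ H. *)
Lemma antip_comul : Δ ∘ s = (s ⊗ s) ∘ τ ∘ Δ.
Proof.
apply: (@conv_uniq H (H ⊠ H) Δ ε ((μ ⊗ μ) ∘ (ι ⊗ τ ⊗ ι)) (η ⊗ η) Δ); try hm.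
- exact: comul_assoc.
- exact: comul_1l.
- exact: comul_1r.
- net (mul_assoc H, mul_assoc H).
- net (mul_1l H, mul_1l H).
- net (mul_1r H, mul_1r H).
- net (esym (comul_mul H), antip_l H, comul_uni H).
- net (comul_assoc H, esym (comul_assoc H), antip_r H, comul_1l H, antip_r H).
Qed.

Lemma antip_uni : s ∘ η = η.
Proof.
transitivity (μ ∘ (s ⊗ ι) ∘ Δ ∘ η); first by symmetry; net (comul_uni H, mul_1r H).
net (antip_l H, counit_uni H).
Qed.

Lemma counit_antip : ε ∘ s = ε.
Proof.
transitivity (ε ∘ μ ∘ (s ⊗ ι) ∘ Δ).
  symmetry; net (counit_mul H, comul_1r H).
net (antip_l H, counit_uni H).
Qed.

Lemma antip_inj A (f f' : ar S) : f ∈ A ⟶ H -> f' ∈ A ⟶ H -> s ∘ f = s ∘ f' -> f = f'.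
Proof.
move=> hf hf' e; transitivity (sV ∘ (s ∘ f)); first by symmetry; net (antipK H).
by rewrite e; net (antipK H).
Qed.

Lemma antipV_mul : sV ∘ μ = μ ∘ (sV ⊗ sV) ∘ τ.
Proof.
apply: (@antip_inj (H ⊠ H)); [hm|hm|].
transitivity (mul H); first by net (antipVK H).
symmetry; net (antip_mul, antipVK H, antipVK H).
Qed.

(** S^-1(h_2) h_1 = ε(h) and, in the next lemma, h_2 S^-1(h_1) = ε(h): apply S
    to both sides. *)
Lemma antipV_l : μ ∘ (sV ⊗ ι) ∘ τ ∘ Δ = η ∘ ε.
Proof.
apply: (@antip_inj H); [hm|hm|].
transitivity (η ∘ ε); last by symmetry; net antip_uni.
net (antip_mul, antipVK H, antip_l H).
Qed.

Lemma antipV_r : μ ∘ (ι ⊗ sV) ∘ τ ∘ Δ = η ∘ ε.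
Proof.
apply: (@antip_inj H); [hm|hm|].
transitivity (η ∘ ε); last by symmetry; net antip_uni.
net (antip_mul, antipVK H, antip_r H).
Qed.

Lemma counit_antipV : ε ∘ sV = ε.
Proof.
transitivity (ε ∘ s ∘ sV); first by net (esym counit_antip).
net (antipVK H).
Qed.

End Conv.

(** * The copairing of a braiding datum *)

Section Datum.
Context (S : ribbon) (S_sym : symmetric S) (S_twist : trivial_twist S).
Context (om : involution S) (H : hopf_alg S) (D : braiding_datum om H).
Local Notation μ := (mul H).
Local Notation Δ := (comul H).
Local Notation η := (uni H).
Local Notation ε := (counit H).
Local Notation s := (antip H).
Local Notation sV := (antipV H).
Local Notation ι := (idm H).
Local Notation τ := (brai H H).
Local Notation σ := (sig D).
Local Notation σV := (sigV D).
Local Notation g := (gel D).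
Local Notation gV := (gelV D).
Local Notation λ := (lam D).
Local Notation Γ := (Gam D).
Local Notation ΓV := (GamV D).

Lemma sig_hom : σ ∈ one ⟶ H. Proof. by case: (sigVP D). Qed.
Lemma sigV_hom : σV ∈ one ⟶ H. Proof. by case: (sigVP D). Qed.
Lemma gel_hom : g ∈ one ⟶ H. Proof. by case: (gelVP D). Qed.
Lemma gelV_hom : gV ∈ one ⟶ H. Proof. by case: (gelVP D). Qed.
Lemma GamV_hom : ΓV ∈ H ⟶ H^∨. Proof. by case: (GamVP D). Qed.
Hint Resolve sig_hom sigV_hom gel_hom gelV_hom GamV_hom lam_hom Gam_hom : homdb.

Lemma sigK : μ ∘ (σ ⊗ σV) = η. Proof. by case: (sigVP D). Qed.
Lemma sigVK : μ ∘ (σV ⊗ σ) = η. Proof. by case: (sigVP D). Qed.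
Lemma gelK : μ ∘ (g ⊗ gV) = η. Proof. by case: (gelVP D). Qed.
Lemma gelVK : μ ∘ (gV ⊗ g) = η. Proof. by case: (gelVP D). Qed.
Lemma GamVK : Γ ∘ ΓV = ι. Proof. by case: (GamVP D). Qed.

Lemma lmul_hom x : x ∈ one ⟶ H -> lmul H x ∈ H ⟶ H.
Proof. by move=> hx; rewrite /lmul; hm. Qed.
Lemma rmul_hom x : x ∈ one ⟶ H -> rmul H x ∈ H ⟶ H.
Proof. by move=> hx; rewrite /rmul; hm. Qed.
Hint Resolve lmul_hom rmul_hom : homdb.
Lemma Adj_hom x y : x ∈ one ⟶ H -> y ∈ one ⟶ H -> Adj H x y ∈ H ⟶ H.
Proof. by move=> hx hy; rewrite /Adj; hm. Qed.
Hint Resolve Adj_hom : homdb.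

(** Writing this copairing as G_1 ⊗ G_2, the hypothesis that Γ is a map of Hopf
    algebras takes a form suited for computation: comultiplying one leg is
    multiplying the other legs of two copies. *)
Definition cop : ar S := (ι ⊗ Γ) ∘ coev H.
Local Notation G := cop.

Lemma cop_hom : G ∈ one ⟶ H ⊠ H.
Proof. rewrite /cop; hm. Qed.
Hint Resolve cop_hom : homdb.

Lemma cop_comul_l :
  (Δ ⊗ ι) ∘ G = (ι ⊗ ι ⊗ μ) ∘ (ι ⊗ brai H (H ⊠ H)) ∘ (G ⊗ G).
Proof.
have := hopf_iso_mul (datum1 D); rewrite /= /transp => e.
symmetry; rewrite /cop; net (esym e, zigzag H, zigzag H).
Qed.

Lemma cop_comul_r :
  (ι ⊗ Δ) ∘ G = (μ ⊗ ι ⊗ ι) ∘ (brai (H ⊠ H) H ⊗ ι) ∘ (G ⊗ G).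
Proof.
have := hopf_iso_comul (datum1 D); rewrite /= /transp => e.
rewrite /cop; net (e, zigzag H).
Qed.

Lemma cop_counit_l : (ε ⊗ ι) ∘ G = η.
Proof.
have := hopf_iso_uni (datum1 D).
rewrite /= (dualmE S_sym (counit_hom H)) /transp => e.
rewrite -e /cop; symmetry; net (zigzag (@one S)).
Qed.

Lemma cop_counit_r : (ι ⊗ ε) ∘ G = η.
Proof.
have := hopf_iso_counit (datum1 D).
rewrite /= (dualmE S_sym (uni_hom H)) /transp => e.
rewrite /cop; net (e, zigzag (@one S), zigzag H).
Qed.

Lemma cop_antip : (s ⊗ ι) ∘ G = (ι ⊗ s) ∘ G.
Proof.
have := hopf_iso_antip (datum1 D).
rewrite /= (dualmE S_sym (antip_hom H)) /transp => e.
rewrite /cop; symmetry; net (e, zigzag H).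
Qed.

Lemma cop_antipV : (sV ⊗ ι) ∘ G = (ι ⊗ sV) ∘ G.
Proof.
transitivity ((sV ⊗ (sV ∘ s)) ∘ G); first by symmetry; net (antipK H).
net (esym cop_antip, antipK H).
Qed.

(** The copairing is nondegenerate since Γ is invertible. *)
Lemma cop_inj X Y (f f' : ar S) : f ∈ H ⊠ X ⟶ Y -> f' ∈ H ⊠ X ⟶ Y ->
  (ι ⊗ f) ∘ (G ⊗ idm X) = (ι ⊗ f') ∘ (G ⊗ idm X) -> f = f'.
Proof.
move=> hf hf' e.
have zd := zigzag_dual H.
transitivity ((ev H ⊗ idm Y) ∘ (idm H^∨ ⊗ ((ι ⊗ f) ∘ (G ⊗ idm X))) ∘ (ΓV ⊗ idm X)).
  symmetry; rewrite /cop; net (zd, GamVK).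
rewrite e /cop; net (zd, GamVK).
Qed.

(** * Symmetry of the copairing, and the square of the antipode *)

Section Symmetric.
Context (Ad_sig_invol : Adj H σ σV ∘ Adj H σ σV = ι).
Local Notation Ad := (Adj H σ σV).

Lemma Ad_sigV : Ad ∘ σV = σV.
Proof. rewrite /Adj /lmul /rmul; net (esym (mul_assoc H), sigK, mul_1l H). Qed.

Lemma rmul_Ad : rmul H σ ∘ Ad = lmul H σ.
Proof. rewrite /Adj /lmul /rmul; net (mul_assoc H, mul_assoc H, sigVK, mul_1r H). Qed.

Lemma Ad_rmul : Ad ∘ rmul H σ = lmul H σ.
Proof. rewrite /Adj /lmul /rmul; net (mul_assoc H, sigK, mul_1r H). Qed.

Lemma Ad_lmul : Ad ∘ lmul H σ = rmul H σ.
Proof. net (esym Ad_rmul, Ad_sig_invol). Qed.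

Lemma lmul_Ad : lmul H σ ∘ Ad = Ad ∘ lmul H σ.
Proof. rewrite /Adj /lmul /rmul; net (esym (mul_assoc H)). Qed.

(** This is where the hypothesis on Ad_σ enters. Conjugation by σ fixes σ^-1 and
    reverses the comultiplication, so that Δ(σ^-1) is Ad_σ applied to both legs
    of its own flip. Moving Ad_σ through the multiplications by σ in the
    definition of the copairing exchanges left and right multiplication, in one
    leg outright and in the other because Ad_σ is an involution. *)
Lemma cop_sym : τ ∘ G = G.
Proof.
have e := GamE D; rewrite -/cop in e; rewrite {1}e.
symmetry; rewrite e.
net (esym Ad_sigV, datum5_comul D, rmul_Ad, lmul_Ad, Ad_lmul).
Qed.

(** The dual of Γ is the other adjunct of the copairing, and the copairing is
    symmetric. *)
Lemma dualm_Gam : dualm Γ = piv H ∘ Γ.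
Proof.
have hp := piv_hom S_sym S_twist H; have hd := dualm_hom S_sym (Gam_hom D).
have e1 := ev_dualm S_sym (Gam_hom D); have e2 := ev_piv S_sym S_twist H.
have zd := zigzag_dual H.
apply: (@ev_inj S S_sym H^∨ H^∨); [hm|hm|].
transitivity ((ev H ⊗ ev H) ∘ (idm H^∨ ⊗ brai H^∨ H ⊗ ι) ∘ (idm (H^∨ ⊠ H^∨) ⊗ (τ ∘ G))).
  rewrite /cop; symmetry; net (zd, esym e1).
rewrite cop_sym /cop; net (zd, esym e2).
Qed.

(** Compare [dualm_Gam] with the condition on Γ^∨ in the datum and cancel the
    isomorphisms j and Γ: conjugation by g is S^2. *)
Lemma antip2 : s ∘ s ∘ Adj H gV g = ι.
Proof.
have hp := piv_hom S_sym S_twist H; have hv := pivV_hom H.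
transitivity (pivV H ∘ (piv H ∘ (s ∘ s) ∘ Adj H gV g ∘ Γ) ∘ ΓV).
  symmetry; net (pivK S_sym S_twist H, GamVK).
rewrite -(datum3 D) dualm_Gam; net (pivK S_sym S_twist H, GamVK).
Qed.
End Symmetric.

(** * Integrals *)

Local Notation Λ := (elt_Lambda D).

Lemma Lambda_hom : Λ ∈ one ⟶ H.
Proof. rewrite /elt_Lambda; hm. Qed.
Hint Resolve Lambda_hom : homdb.

Lemma LambdaE : Λ = (λ ⊗ ι) ∘ G.
Proof. rewrite /elt_Lambda /cop; net. Qed.

Lemma lam_Lambda : λ ∘ Λ = idm one.
Proof. rewrite -(datum2_norm D) /elt_Lambda; net. Qed.

(** Multiplication in the second leg of the copairing is comultiplication in
    the first, by [cop_comul_l]; this turns the cointegral λ into an integral. *)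
Lemma Lambda_int : μ ∘ (ι ⊗ Λ) = ε ⊗ Λ.
Proof.
apply: (@cop_inj one H); [hm|hm|].
transitivity ((((λ ⊗ ι) ∘ Δ) ⊗ ι) ∘ G).
  symmetry; rewrite LambdaE; net (cop_comul_l).
rewrite LambdaE (datum2_cointegral D); symmetry; net cop_counit_r.
Qed.

(** Coassociativity: both sides are λ applied to the last leg of the iterated
    coproduct of Λ. *)
Lemma gel_comul : Δ ∘ g = g ⊗ g.
Proof.
transitivity (Δ ∘ (ι ⊗ λ) ∘ Δ ∘ Λ); first by symmetry; net (datum2_g D, lam_Lambda).
net (comul_assoc H, datum2_g D, datum2_g D, lam_Lambda).
Qed.

Lemma gel_counit : ε ∘ g = idm one.
Proof.
transitivity (ε ∘ (ι ⊗ λ) ∘ Δ ∘ Λ); first by symmetry; net (datum2_g D, lam_Lambda).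
net (comul_1l H, lam_Lambda).
Qed.

Lemma antip_gel : s ∘ g = gV.
Proof.
transitivity (μ ∘ ((s ∘ g) ⊗ (μ ∘ (g ⊗ gV)))); first by symmetry; net (gelK, mul_1r H).
net (esym (mul_assoc H), esym gel_comul, antip_l H, gel_counit, mul_1l H).
Qed.

Lemma antip_gelV : s ∘ gV = g.
Proof.
transitivity (μ ∘ ((s ∘ gV) ⊗ (μ ∘ (gV ⊗ g)))); first by symmetry; net (gelVK, mul_1r H).
net (esym (mul_assoc H), esym antip_gel, esym (antip_mul S_sym H), gelK, antip_uni S_sym H,
  mul_1l H).
Qed.

(** Λ_1 ⊗ k Λ_2 = S(k) Λ_1 ⊗ Λ_2: insert S(k_1) k_2 = ε(k) in front of Λ_1 on
    the left; then k_2 and k_3 form Δ(k Λ), and S(k_1) is left over. *)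
Lemma Lambda_slide :
  (ι ⊗ μ) ∘ (τ ⊗ ι) ∘ (ι ⊗ (Δ ∘ Λ)) = (μ ⊗ ι) ∘ (s ⊗ (Δ ∘ Λ)).
Proof.
transitivity ((μ ⊗ ι) ∘ (s ⊗ (Δ ∘ μ)) ∘ (Δ ⊗ Λ)).
  symmetry; net (comul_mul H, esym (comul_assoc H), esym (mul_assoc H), antip_l H, mul_1l H,
    comul_1l H).
net (Lambda_int, comul_1r H).
Qed.

(** λ(S(k) Λ_1) Λ_2 = k: apply λ to the first leg of [Lambda_slide], where it
    becomes λ(Λ) = 1 by the cointegral property. *)
Lemma lam_slide : ((λ ∘ μ) ⊗ ι) ∘ (s ⊗ (Δ ∘ Λ)) = ι.
Proof.
transitivity ((λ ⊗ ι) ∘ ((μ ⊗ ι) ∘ (s ⊗ (Δ ∘ Λ)))); first by net.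
rewrite -Lambda_slide; net (datum2_cointegral D, mul_1r H, lam_Lambda).
Qed.

(** Apply λ to [lam_slide]; by definition of g, Λ_1 λ(Λ_2) = g. *)
Lemma lam_antip_gel : λ ∘ rmul H g ∘ s = λ.
Proof.
transitivity (λ ∘ (((λ ∘ μ) ⊗ ι) ∘ (s ⊗ (Δ ∘ Λ)))).
  rewrite /rmul; symmetry; net (datum2_g D, lam_Lambda).
by rewrite lam_slide; net.
Qed.

Lemma lam_antip : λ ∘ s = λ ∘ lmul H g.
Proof.
(* λ(S(g h) g) = λ(S(h)) because S(g) = g^-1 *)
transitivity (λ ∘ rmul H g ∘ s ∘ lmul H g); last by net lam_antip_gel.
rewrite /rmul /lmul; symmetry.
net (antip_mul S_sym H, antip_gel, mul_assoc H, gelVK, mul_1r H).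
Qed.

Lemma lam_antip_Lambda : λ ∘ s ∘ Λ = idm one.
Proof.
rewrite lam_antip /lmul; net (Lambda_int, gel_counit, lam_Lambda).
Qed.

(** * The Fourier transform *)

Local Notation φ := (map_phi D).

Lemma phiE : φ = (ι ⊗ (λ ∘ μ)) ∘ (G ⊗ ι).
Proof. by []. Qed.

Lemma phi_hom : φ ∈ H ⟶ H.
Proof. rewrite phiE; hm. Qed.
Hint Resolve phi_hom : homdb.

Lemma phi_Lambda : φ ∘ Λ = η.
Proof. rewrite phiE; net (Lambda_int, cop_counit_r, lam_Lambda). Qed.

Lemma antip_Lambda_int : μ ∘ ((s ∘ Λ) ⊗ ι) = (s ∘ Λ) ⊗ ε.
Proof.
transitivity (μ ∘ ((s ∘ Λ) ⊗ (s ∘ sV))); first by symmetry; net (antipVK H).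
net (esym (antip_mul S_sym H), Lambda_int, counit_antipV S_sym H).
Qed.

Lemma kappa_phi : λ ∘ s ∘ φ = ε.
Proof.
rewrite phiE; net (cop_antip, esym LambdaE, antip_Lambda_int, lam_antip_Lambda).
Qed.

(** λ(h_1 k) h_2 = λ(h k_1) S(k_2): this is the cointegral property for the
    product h k_1, multiplied by S(k_2). *)
Lemma lam_swap :
  ((λ ∘ μ) ⊗ ι) ∘ (ι ⊗ τ) ∘ (Δ ⊗ ι) = ((λ ∘ μ) ⊗ s) ∘ (ι ⊗ Δ).
Proof.
transitivity ((λ ⊗ μ) ∘ ((Δ ∘ μ) ⊗ s) ∘ (ι ⊗ Δ)).
  symmetry; net (comul_mul H, mul_assoc H, comul_assoc H, antip_r H, mul_1r H, comul_1r H).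
net (datum2_cointegral D, mul_1l H).
Qed.

Lemma phi_comul : (φ ⊗ s) ∘ Δ = (μ ⊗ ι) ∘ (ι ⊗ τ) ∘ (G ⊗ φ).
Proof. rewrite phiE; net (esym lam_swap, cop_comul_r). Qed.

(** The transform sends h to G_1 λ(G_2 h), its inverse to λ(S(G_1 h)) S^-1(G_2). *)
Definition phiV : ar S := ((λ ∘ s ∘ μ) ⊗ sV) ∘ (ι ⊗ τ) ∘ (G ⊗ ι).

Lemma phiV_hom : phiV ∈ H ⟶ H.
Proof. rewrite /phiV; hm. Qed.

Lemma phiK : phiV ∘ φ = ι.
Proof.
rewrite /phiV; net (esym phi_comul, kappa_phi, antipK H, comul_1l H).
Qed.

Lemma LambdaE' : Adj H σ σV ∘ Adj H σ σV = ι -> Λ = (ι ⊗ λ) ∘ G.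
Proof. by move=> hAd; rewrite LambdaE -{1}(cop_sym hAd); net. Qed.

(** The symmetry of the copairing enters through the formula Λ = G_1 λ(G_2). *)
Lemma phiVK : Adj H σ σV ∘ Adj H σ σV = ι -> φ ∘ phiV = ι.
Proof.
move=> /LambdaE' eL; rewrite /phiV phiE.
net (esym cop_antipV, esym cop_comul_l, esym eL, antip_mul S_sym H, antipVK H, lam_slide).
Qed.

Lemma kappa_phiV : Adj H σ σV ∘ Adj H σ σV = ι -> ε ∘ phiV = λ ∘ s.
Proof.
move=> hAd; have h := phiV_hom; have e := phiVK hAd.
net (esym kappa_phi, e).
Qed.

(** * The elements of the associativity isomorphisms *)

Local Notation γ := (elt_gamma D).
Local Notation δ := (elt_delta D).

Lemma gammaE : γ = (sV ⊗ ι) ∘ G.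
Proof. rewrite /elt_gamma /cop; net. Qed.
Lemma deltaE : δ = (s ⊗ rmul H g) ∘ G.
Proof. rewrite /elt_delta /cop; net. Qed.
Definition deltaV : ar S := (ι ⊗ lmul H gV) ∘ G.

Lemma gamma_hom : γ ∈ one ⟶ H ⊠ H. Proof. rewrite gammaE; hm. Qed.
Lemma delta_hom : δ ∈ one ⟶ H ⊠ H. Proof. rewrite deltaE; hm. Qed.
Lemma deltaV_hom : deltaV ∈ one ⟶ H ⊠ H. Proof. rewrite /deltaV; hm. Qed.

Lemma delta_counit : (ε ⊗ ι) ∘ δ = g.
Proof. rewrite deltaE /rmul; net (counit_antip S_sym H, cop_counit_l, mul_1l H). Qed.

(** Products of the second legs of two copairings come from a single one whose
    first leg is comultiplied; then the axioms of the antipode apply. *)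
Lemma gammaK : (μ ⊗ μ) ∘ (ι ⊗ τ ⊗ ι) ∘ (γ ⊗ G) = η ⊗ η.
Proof. rewrite gammaE; net (esym cop_comul_l, antipV_l S_sym H, cop_counit_l). Qed.
Lemma gammaVK : (μ ⊗ μ) ∘ (ι ⊗ τ ⊗ ι) ∘ (G ⊗ γ) = η ⊗ η.
Proof. rewrite gammaE; net (esym cop_comul_l, antipV_r S_sym H, cop_counit_l). Qed.
(** Inverses in the tensor product of H with its opposite algebra. *)
Lemma deltaK : (μ ⊗ (μ ∘ τ)) ∘ (ι ⊗ τ ⊗ ι) ∘ (δ ⊗ deltaV) = η ⊗ η.
Proof.
rewrite deltaE /deltaV /rmul /lmul.
net (esym (mul_assoc H), mul_assoc H, esym cop_comul_l, antip_l H, cop_counit_l, mul_1r H, gelVK).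
Qed.
Lemma deltaVK : (μ ⊗ (μ ∘ τ)) ∘ (ι ⊗ τ ⊗ ι) ∘ (deltaV ⊗ δ) = η ⊗ η.
Proof.
rewrite deltaE /deltaV /rmul /lmul.
net (mul_assoc H, esym (mul_assoc H), gelK, mul_1l H, esym cop_comul_l, antip_r H, cop_counit_l).
Qed.

(** * The Frobenius pairing *)

Definition fpair : ar S := λ ∘ μ ∘ (s ⊗ ι).

Lemma fpair_hom : fpair ∈ H ⊠ H ⟶ one.
Proof. rewrite /fpair; hm. Qed.

(** The copairing Δ(Λ) is dual to this pairing. *)
Lemma fpairK : (fpair ⊗ ι) ∘ (ι ⊗ (Δ ∘ Λ)) = ι.
Proof. rewrite /fpair; net lam_slide. Qed.

Lemma fpairVK : (ι ⊗ fpair) ∘ ((Δ ∘ Λ) ⊗ ι) = ι.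
Proof.
(* with k = S^-1(h), Λ_1 λ(S(Λ_2) h) = Λ_1 λ(S(k Λ_2)); then k slides over to Λ_1 *)
transitivity ((ι ⊗ (λ ∘ s)) ∘ ((ι ⊗ μ) ∘ (τ ⊗ ι) ∘ (ι ⊗ (Δ ∘ Λ))) ∘ sV).
  by rewrite /fpair; symmetry; net (antip_mul S_sym H, antipVK H).
rewrite Lambda_slide lam_antip /lmul.
net (antipVK H, Lambda_slide, antip_gel, datum2_g D, gelVK, mul_1r H, lam_Lambda).
Qed.

(** S^2(k) g = g k, a form of [antip2]. *)
Lemma antip2_gel : Adj H σ σV ∘ Adj H σ σV = ι -> rmul H g ∘ (s ∘ s) = lmul H g.
Proof.
move=> /antip2 e.
transitivity (s ∘ s ∘ rmul H g).
  rewrite /rmul; symmetry.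
  net (antip_mul S_sym H, antip_mul S_sym H, antip_gel, antip_gelV).
transitivity (s ∘ s ∘ Adj H gV g ∘ lmul H g); last by net e.
rewrite /Adj /lmul /rmul; symmetry; net (mul_assoc H, esym (mul_assoc H), gelVK, mul_1l H).
Qed.

(** λ(S(k) g h) = λ(S(h) k): by [lam_antip_gel] the left hand side equals
    λ(S(S(k) g h) g) = λ(S(h) g^-1 S^2(k) g), and S^2(k) g = g k. This is what
    makes δ monoidal on two objects of degree one. *)
Lemma fpair_gel : Adj H σ σV ∘ Adj H σ σV = ι -> fpair ∘ (ι ⊗ lmul H g) = fpair ∘ τ.
Proof.
move=> /antip2_gel; rewrite /rmul /lmul => e.
symmetry; have e2 := lam_antip_gel; rewrite /rmul in e2.
rewrite /fpair; net (esym e2, antip_mul S_sym H, mul_assoc H, e).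
Qed.

End Datum.

#[export] Hint Resolve sig_hom sigV_hom gel_hom gelV_hom GamV_hom lam_hom Gam_hom
  lmul_hom rmul_hom Adj_hom cop_hom Lambda_hom phi_hom phiV_hom
  gamma_hom delta_hom deltaV_hom fpair_hom : homdb.

(** * Pairings and modules *)

Section BaseMore.
Context (S : ribbon) (S_sym : symmetric S).

(** For a copairing [q] that satisfies the zigzag identities with a pairing
    [p], this inverts the adjunct of [p]. *)
Definition copair (W Z : ob S) (q : ar S) : ar S := (ev Z ⊗ idm W) ∘ (idm Z^∨ ⊗ q).

Lemma copair_hom (W Z : ob S) q : q ∈ one ⟶ Z ⊠ W -> copair W Z q ∈ Z^∨ ⟶ W.
Proof. by move=> hq; rewrite /copair; hm. Qed.

Lemma transp_copair (W Z : ob S) p q : p ∈ W ⊠ Z ⟶ one -> q ∈ one ⟶ Z ⊠ W ->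
  (idm Z ⊗ p) ∘ (q ⊗ idm Z) = idm Z -> transp W Z p ∘ copair W Z q = idm Z^∨.
Proof.
move=> hp hq e; have zd := zigzag_dual Z; rewrite /transp /copair; net (e, zd).
Qed.

Lemma copair_transp (W Z : ob S) p q : p ∈ W ⊠ Z ⟶ one -> q ∈ one ⟶ Z ⊠ W ->
  (p ⊗ idm W) ∘ (idm W ⊗ q) = idm W -> copair W Z q ∘ transp W Z p = idm W.
Proof.
move=> hp hq e; have z := zigzag Z; rewrite /transp /copair; net (z, e).
Qed.

Lemma dualm_comp U V W (f g : ar S) : f ∈ U ⟶ V -> g ∈ V ⟶ W ->
  dualm (g ∘ f) = dualm f ∘ dualm g.
Proof.
move=> hf hg; have hgf : g ∘ f ∈ U ⟶ W by hm.
rewrite (dualmE S_sym hf) (dualmE S_sym hg) (dualmE S_sym hgf) /transp.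
have z := zigzag V; symmetry; net z.
Qed.

Lemma dualm_id (U : ob S) : dualm (idm U) = idm U^∨.
Proof.
rewrite (dualmE S_sym (hom_id U)) /transp; have z := zigzag_dual U; net z.
Qed.

End BaseMore.

(** Simplification would unfold the actions of these modules along with their
    carriers. *)
Ltac mcars :=
  repeat match goal with
  | |- context [mcar (mod_dual ?H ?M)] => change (mcar (mod_dual H M)) with (dual (mcar M))
  | |- context [mcar (mod_tens ?H ?M ?N)] =>
      change (mcar (mod_tens H M N)) with (otens (mcar M) (mcar N))
  | |- context [mcar (@mod_free ?S ?H ?U)] =>
      change (mcar (@mod_free S H U)) with (otens (carrier (hopf H)) U)
  | |- context [mcar (@mod_unit ?S ?H)] => change (mcar (@mod_unit S H)) with (@one S)
  end.
Ltac mcars_in h :=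
  repeat match type of h with
  | context [mcar (mod_dual ?H ?M)] => change (mcar (mod_dual H M)) with (dual (mcar M)) in h
  | context [mcar (mod_tens ?H ?M ?N)] =>
      change (mcar (mod_tens H M N)) with (otens (mcar M) (mcar N)) in h
  | context [mcar (@mod_free ?S ?H ?U)] =>
      change (mcar (@mod_free S H U)) with (otens (carrier (hopf H)) U) in h
  | context [mcar (@mod_unit ?S ?H)] => change (mcar (@mod_unit S H)) with (@one S) in h
  end.
Ltac mcars_all := repeat match goal with
  | h : context [mcar (_ _)] |- _ => progress mcars_in h end; mcars.

Section Modules.
Context (S : ribbon) (S_sym : symmetric S) (H : hopf_alg S).
Local Notation μ := (mul H).
Local Notation Δ := (comul H).
Local Notation η := (uni H).
Local Notation ε := (counit H).
Local Notation s := (antip H).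
Local Notation ι := (idm H).
Implicit Types M N : module_data S.

Lemma mod_dual_hom M : act M ∈ H ⊠ M ⟶ M -> act (mod_dual H M) ∈ H ⊠ M^∨ ⟶ M^∨.
Proof. by move=> hM; rewrite /mod_dual /=; apply: hom_transp; hm. Qed.

Lemma mod_dual_ok M : is_module H M -> is_module H (mod_dual H M).
Proof.
move=> hM; have e := ev_mod_dual hM; case: hM => hM mM uM.
have hd := mod_dual_hom hM.
split => //; rewrite -[mcar (mod_dual H M)]/(M^∨).
- apply: (@ev_inj S S_sym (H ⊠ H ⊠ M^∨) M); [hm|hm|].
  transitivity (ev M ∘ (idm M^∨ ⊗ act M) ∘ (brai (H ⊠ M) M^∨) ∘
       (((μ ∘ (s ⊗ s) ∘ brai H H) ⊗ brai M^∨ M))).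
    symmetry; net (esym (antip_mul S_sym H), esym e).
  symmetry; net (e, e, esym mM).
- apply: (@ev_inj S S_sym M^∨ M); [hm|hm|].
  net (e, antip_uni S_sym H, uM).
Qed.

Lemma mod_tens_ok M N : is_module H M -> is_module H N -> is_module H (mod_tens H M N).
Proof.
case=> hM mM uM [hN mN uN]; split; rewrite /= /act2.
- hm.
- net (comul_mul H, mM, mN).
- net (comul_uni H, uM, uN).
Qed.

Lemma mod_free_ok (U : ob S) : is_module H (mod_free H U).
Proof.
split; rewrite /=.
- hm.
- net (mul_assoc H).
- net (mul_1l H).
Qed.

Lemma mod_unit_ok : is_module H (mod_unit H).
Proof.
split; rewrite /=.
- by rewrite otens_1r; exact: counit_hom.
- net (counit_mul H).
- net (counit_uni H).
Qed.

Lemma mod_hom_inv M N f g : act M ∈ H ⊠ M ⟶ M -> act N ∈ H ⊠ N ⟶ N ->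
  module_hom H M N f -> g ∈ N ⟶ M ->
  g ∘ f = idm M -> f ∘ g = idm N -> module_hom H N M g.
Proof.
move=> hM hN [hf ef] hg gf fg; split => //.
transitivity (g ∘ (act N ∘ (ι ⊗ f)) ∘ (ι ⊗ g)); first by symmetry; net fg.
by rewrite -ef; net gf.
Qed.

Lemma dualm_mod M N f : is_module H M -> is_module H N ->
  module_hom H M N f -> module_hom H (mod_dual H N) (mod_dual H M) (dualm f).
Proof.
move=> hM hN [hf ef].
have eM := ev_mod_dual hM; have eN := ev_mod_dual hN.
have [hdM _ _] := mod_dual_ok hM; have [hdN _ _] := mod_dual_ok hN.
case: hM => hM mM uM; case: hN => hN mN uN.
have hd := dualm_hom S_sym hf; have e := ev_dualm S_sym hf.
split => //.
change (mcar (mod_dual H M)) with (M^∨ : ob S) in *; change (mcar (mod_dual H N)) with (N^∨ :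
  ob S) in *.
apply: (@ev_inj S S_sym (H ⊠ N^∨) M); [hm|hm|].
transitivity (ev N ∘ (idm N^∨ ⊗ (f ∘ act M)) ∘ ((brai H N^∨ ∘ (s ⊗ idm N^∨)) ⊗ idm M)).
  rewrite ef; net (e, eN).
symmetry; net (eM, e).
Qed.

End Modules.

(** * Tensor products of duals as duals of tensor products *)

Section Pairings.
Context (S : ribbon) (S_sym : symmetric S) (S_twist : trivial_twist S).
Context (om : involution S) (H : hopf_alg S) (D : braiding_datum om H).
Context (Ad_sig_invol : Adj H (sig D) (sigV D) ∘ Adj H (sig D) (sigV D) = idm H).
Local Notation μ := (mul H).
Local Notation Δ := (comul H).
Local Notation η := (uni H).
Local Notation ε := (counit H).
Local Notation s := (antip H).
Local Notation sV := (antipV H).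
Local Notation ι := (idm H).
Local Notation τ := (brai H H).
Local Notation σ := (sig D).
Local Notation g := (gel D).
Local Notation gV := (gelV D).
Local Notation λ := (lam D).
Local Notation Λ := (elt_Lambda D).
Implicit Types (M N : module_data S) (U V X Y : ob S).

Definition actby M (x : ar S) : ar S := act M ∘ (x ⊗ idm M).
Lemma actby_hom M x : act M ∈ H ⊠ M ⟶ M -> x ∈ one ⟶ H -> actby M x ∈ M ⟶ M.
Proof. by move=> hM hx; rewrite /actby; hm. Qed.

Lemma actby_mul M x y z : is_module H M -> x ∈ one ⟶ H -> y ∈ one ⟶ H ->
  μ ∘ (x ⊗ y) = z -> actby M x ∘ actby M y = actby M z.
Proof.
move=> [hM mM uM] hx hy e; have hz : z ∈ one ⟶ H by rewrite -e; hm.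
rewrite /actby; net (esym mM, e).
Qed.

Lemma actby_uni M : is_module H M -> actby M η = idm M.
Proof. by case. Qed.

Lemma actby_gK M : is_module H M -> actby M g ∘ actby M gV = idm M.
Proof.
move=> hM; rewrite -(actby_uni hM); apply: actby_mul => //; try hm.
exact: gelK.
Qed.
Lemma actby_gVK M : is_module H M -> actby M gV ∘ actby M g = idm M.
Proof.
move=> hM; rewrite -(actby_uni hM); apply: actby_mul => //; try hm.
exact: gelVK.
Qed.

Definition evP U V : ar S := ev V ∘ (idm V^∨ ⊗ ev U ⊗ idm V).
Definition coevP U V : ar S := (idm U ⊗ coev V ⊗ idm U^∨) ∘ coev U.
Lemma evP_hom U V : evP U V ∈ (V^∨ ⊠ U^∨) ⊠ (U ⊠ V) ⟶ one.
Proof. rewrite /evP; hm. Qed.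
Lemma coevP_hom U V : coevP U V ∈ one ⟶ (U ⊠ V) ⊠ (V^∨ ⊠ U^∨).
Proof. rewrite /coevP; hm. Qed.

(** The duality of C pairs B^∨ ⊗ A^∨ with A ⊗ B in a way that depends on the
    degrees. If B has degree 0 this is the nested evaluation [evP]; if only B
    has degree 1, the associativity isomorphism adds an action of g on A
    ([p01]); if both have degree 1, the two factors H are paired by [fpair]
    ([p11]). The copairings [q01] and [q11] show that these are nondegenerate. *)
Definition p01 M X : ar S := evP M X ∘ (idm (X^∨ ⊠ M^∨) ⊗ actby M g ⊗ idm X).
Definition q01 M X : ar S := (actby M gV ⊗ idm (X ⊠ X^∨ ⊠ M^∨)) ∘ coevP M X.
Definition p11 X Y : ar S :=
  (fpair D ⊗ evP X Y) ∘ (ι ⊗ brai (Y^∨ ⊠ X^∨) H ⊗ idm (X ⊠ Y)).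
Definition q11 X Y : ar S :=
  (ι ⊗ brai H (X ⊠ Y) ⊗ idm (Y^∨ ⊠ X^∨)) ∘ ((Δ ∘ Λ) ⊗ coevP X Y).

Lemma evP_coevP U V : (evP U V ⊗ idm (V^∨ ⊠ U^∨)) ∘ (idm (V^∨ ⊠ U^∨) ⊗ coevP U V) =
   idm (V^∨ ⊠ U^∨).
Proof.
have z := zigzag_dual U; have z' := zigzag_dual V.
rewrite /evP /coevP; net (z, z').
Qed.
Lemma coevP_evP U V : (idm (U ⊠ V) ⊗ evP U V) ∘ (coevP U V ⊗ idm (U ⊠ V)) =
   idm (U ⊠ V).
Proof.
have z := zigzag U; have z' := zigzag V.
rewrite /evP /coevP; net (z, z').
Qed.

Section M01.
Context (M : module_data S) (hM : is_module H M) (X : ob S).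
Lemma p01_hom : p01 M X ∈ (X^∨ ⊠ M^∨) ⊠ (M ⊠ X) ⟶ one.
Proof. have [hM' _ _] := hM; have h := actby_hom hM' (gel_hom D); have := evP_hom M X;
  rewrite /p01 => e; hm. Qed.
Lemma q01_hom : q01 M X ∈ one ⟶ (M ⊠ X) ⊠ (X^∨ ⊠ M^∨).
Proof. have [hM' _ _] := hM; have h := actby_hom hM' (gelV_hom D); have := coevP_hom M X;
  rewrite /q01 => e; hm. Qed.
Lemma p01_q01 : (p01 M X ⊗ idm (X^∨ ⊠ M^∨)) ∘ (idm (X^∨ ⊠ M^∨) ⊗ q01 M X) = idm (X^∨ ⊠ M^∨).
Proof.
have [hM' _ _] := hM; have h1 := actby_hom hM' (gelV_hom D).
have h2 := actby_hom hM' (gel_hom D).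
have z := zigzag_dual M; have z' := zigzag_dual X; have e := actby_gK hM.
rewrite /p01 /q01 /evP /coevP; net (e, z, z').
Qed.
Lemma q01_p01 : (idm (M ⊠ X) ⊗ p01 M X) ∘ (q01 M X ⊗ idm (M ⊠ X)) = idm (M ⊠ X).
Proof.
have [hM' _ _] := hM; have h1 := actby_hom hM' (gelV_hom D).
have h2 := actby_hom hM' (gel_hom D).
have z := zigzag M; have z' := zigzag X; have e := actby_gVK hM.
rewrite /p01 /q01 /evP /coevP; net (z, z', e).
Qed.
End M01.

Section M11.
Context (X Y : ob S).
Lemma p11_hom : p11 X Y ∈ (H ⊠ Y^∨ ⊠ X^∨) ⊠ (H ⊠ X ⊠ Y) ⟶ one.
Proof. have h1 := fpair_hom D; have := evP_hom X Y; rewrite /p11 => e; hm. Qed.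
Lemma q11_hom : q11 X Y ∈ one ⟶ (H ⊠ X ⊠ Y) ⊠ (H ⊠ Y^∨ ⊠ X^∨).
Proof. have h1 := Lambda_hom D; have := coevP_hom X Y; rewrite /q11 => e; hm. Qed.
Lemma p11_q11 : (p11 X Y ⊗ idm (H ⊠ Y^∨ ⊠ X^∨)) ∘ (idm (H ⊠ Y^∨ ⊠ X^∨) ⊗ q11 X Y) =
  idm (H ⊠ Y^∨ ⊠ X^∨).
Proof.
have z := zigzag_dual X; have z' := zigzag_dual Y; have e := fpairK S_sym D.
rewrite /p11 /q11 /evP /coevP; net (z, z', e).
Qed.
Lemma q11_p11 : (idm (H ⊠ X ⊠ Y) ⊗ p11 X Y) ∘ (q11 X Y ⊗ idm (H ⊠ X ⊠ Y)) =
  idm (H ⊠ X ⊠ Y).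
Proof.
have z := zigzag X; have z' := zigzag Y; have e := fpairVK S_sym D.
rewrite /p11 /q11 /evP /coevP; net (z, z', e).
Qed.
End M11.

(** * Linearity of the pairings *)

Lemma act_tensE M N : act (mod_tens H M N) = act2 H M N ∘ (Δ ⊗ idm (M ⊠ N)).
Proof. by []. Qed.

(** S reverses the order of the tensor factors, and so does duality. *)
Lemma evP_mod M N : is_module H M -> is_module H N ->
  module_hom H (mod_tens H (mod_dual H N) (mod_dual H M)) (mod_dual H (mod_tens H M N))
    (transp (N^∨ ⊠ M^∨) (M ⊠ N) (evP M N)).
Proof.
move=> hM hN; have hMN := mod_tens_ok S_sym hM hN.
have eM := ev_mod_dual hM; have eN := ev_mod_dual hN; have e := ev_mod_dual hMN.
have [hdM _ _] := mod_dual_ok S_sym hM; have [hdN _ _] := mod_dual_ok S_sym hN.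
have [hd _ _] := mod_dual_ok S_sym hMN.
case: hM => hM _ _; case: hN => hN _ _; case: hMN => hMN _ _.
have hp := evP_hom M N; have ht := hom_transp hp; have ep := ev_transp hp.
mcars_all; split; first exact: ht.
set t := transp _ _ _ in ht ep *.
rewrite !act_tensE /act2 in e *; mcars_all.
apply: (@ev_inj S S_sym (H ⊠ N^∨ ⊠ M^∨) (M ⊠ N)); [hm|hm|].
rewrite /evP in ep; net (ep, eN, eM, esym (antip_comul S_sym H), esym ep, esym e).
Qed.

(** λ(S(x k) h) = λ(S(k) S(x) h). *)
Lemma p11_mod X Y :
  module_hom H (mod_free H (Y^∨ ⊠ X^∨)) (mod_dual H (mod_free H (X ⊠ Y)))
    (transp (H ⊠ Y^∨ ⊠ X^∨) (H ⊠ X ⊠ Y) (p11 X Y)).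
Proof.
have hF := mod_free_ok S_sym H (X ⊠ Y); have e := ev_mod_dual hF.
have [hd _ _] := mod_dual_ok S_sym hF.
have hp := p11_hom X Y; have ht := hom_transp hp; have ep := ev_transp hp.
split; first exact: ht.
set t := transp _ _ _ in ht ep *.
set ad := act (mod_dual H _) in hd e *.
rewrite /= in hd e ht *.
apply: (@ev_inj S S_sym (H ⊠ H ⊠ Y^∨ ⊠ X^∨) (H ⊠ X ⊠ Y)); [hm|hm|].
rewrite /p11 /fpair /evP in ep.
net (ep, antip_mul S_sym H, mul_assoc H, esym ep, esym e).
Qed.

(** * The pairings and the pivotal structure *)

(** In each of the four cases, [ev_piv] makes an evaluation on a double dual an
    evaluation with exchanged arguments, so that only the actions of g have to
    agree. In degrees (0, 0) they do since g is group-like. *)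
Lemma pair_piv00 M N : is_module H M -> is_module H N ->
  evP N^∨ M^∨ ∘ (((piv M ∘ actby M g) ⊗ (piv N ∘ actby N g)) ⊗ idm (N^∨ ⊠ M^∨)) =
  evP M N ∘ (idm (N^∨ ⊠ M^∨) ⊗ actby (mod_tens H M N) g) ∘ brai (M ⊠ N) (N^∨ ⊠ M^∨).
Proof.
move=> [hM _ _] [hN _ _].
have eM := ev_piv S_sym S_twist M; have eN := ev_piv S_sym S_twist N.
have hpM := piv_hom S_sym S_twist M; have hpN := piv_hom S_sym S_twist N.
rewrite /actby act_tensE /act2 /evP /=.
have e := gel_comul S_sym D.
symmetry; net (e, esym eM, esym eN).
Qed.

(** The action of g in δ is the one in the pairing. *)
Lemma pair_piv01 M X : is_module H M ->
  evP X^∨ M^∨ ∘ (((piv M ∘ actby M g) ⊗ piv X) ⊗ idm (X^∨ ⊠ M^∨)) =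
  p01 M X ∘ brai (M ⊠ X) (X^∨ ⊠ M^∨).
Proof.
move=> [hM _ _].
have eM := ev_piv S_sym S_twist M; have eX := ev_piv S_sym S_twist X.
have hpM := piv_hom S_sym S_twist M; have hpX := piv_hom S_sym S_twist X.
rewrite /p01 /evP /actby; symmetry; net (esym eM, esym eX).
Qed.

(** The pairing acts by g on the dual of M, that is by S(g) = g^-1 on M, which
    cancels the action of g in δ. *)
Lemma pair_piv10 X M : is_module H M ->
  p01 (mod_dual H M) X^∨ ∘ ((piv X ⊗ (piv M ∘ actby M g)) ⊗ idm (M^∨ ⊠ X^∨)) =
  evP X M ∘ brai (X ⊠ M) (M^∨ ⊠ X^∨).
Proof.
move=> hM; have e := ev_mod_dual hM; have [hd _ _] := mod_dual_ok S_sym hM.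
have [hM' _ _] := hM; have hg := actby_hom hM' (gel_hom D).
have hgV := actby_hom hM' (gelV_hom D).
have eM := ev_piv S_sym S_twist M; have eX := ev_piv S_sym S_twist X.
have hpM := piv_hom S_sym S_twist M; have hpX := piv_hom S_sym S_twist X.
have k := actby_gVK hM; have sg := antip_gel S_sym D.
rewrite /p01 /evP [actby (mod_dual H M) g]/actby.
set ad := act (mod_dual H M) in hd e *.
mcars_all.
have eg : ev M ∘ ((ad ∘ (g ⊗ idm M^∨)) ⊗ idm M) = ev M ∘ (idm M^∨ ⊗ actby M gV).
  rewrite /actby; net (e, sg).
net (eM, eX, eg, k).
Qed.

(** By [fpair_gel]. *)
Lemma pair_piv11 X Y :
  p11 Y^∨ X^∨ ∘ ((ι ⊗ piv X ⊗ piv Y) ⊗ idm (H ⊠ Y^∨ ⊠ X^∨)) =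
  p11 X Y ∘ (idm (H ⊠ Y^∨ ⊠ X^∨) ⊗ actby (mod_free H (X ⊠ Y)) g)
    ∘ brai (H ⊠ X ⊠ Y) (H ⊠ Y^∨ ⊠ X^∨).
Proof.
have eX := ev_piv S_sym S_twist X; have eY := ev_piv S_sym S_twist Y.
have hpX := piv_hom S_sym S_twist X; have hpY := piv_hom S_sym S_twist Y.
have e := fpair_gel S_sym S_twist Ad_sig_invol; have hf := fpair_hom D.
rewrite /lmul in e.
rewrite /p11 /evP /actby /=; net (eX, eY, esym e).
Qed.

(** H acts on the double dual through S^2, and S^2(k) g = g k. *)
Lemma delta_mod M : is_module H M ->
  module_hom H M (mod_dual H (mod_dual H M)) (piv M ∘ actby M g).
Proof.
move=> hM; have hd := mod_dual_ok S_sym hM; have hdd := mod_dual_ok S_sym hd.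
have e := ev_mod_dual hM; have e2 := ev_mod_dual hd.
case: (hM) => hM' mM uM; case: hd => hd _ _; case: hdd => hdd _ _.
have hg := actby_hom hM' (gel_hom D); have hp := piv_hom S_sym S_twist M.
have ep := ev_piv S_sym S_twist M.
split; first by rewrite /=; hm.
set ad := act (mod_dual H M) in hd e e2 *.
set add := act (mod_dual H (mod_dual H M)) in hdd e2 *.
mcars_all.
apply: (@ev_inj S S_sym (H ⊠ M) M^∨); [hm|hm|].
have es := antip2_gel S_sym S_twist Ad_sig_invol; rewrite /rmul /lmul in es.
rewrite /actby in hg *.
net (ep, esym mM, esym es, mM, esym e, esym ep, esym e2).
Qed.

End Pairings.

(** * Inverses of the associativity isomorphisms *)

(** Inverses are chosen by [epsilon]; they are known once they are unique. *)
Lemma inv_eq (C : rigid_data) (A B : Ob C) (f g : Ar C) :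
  is_inverse A B f g ->
  (forall h, is_inverse A B f h -> h = g) -> inv A B f = g.
Proof. by move=> hg; apply; apply: epsilon_spec; exists g. Qed.

Section Assoc.
Context (S : ribbon) (S_sym : symmetric S) (S_twist : trivial_twist S).
Context (om : involution S) (H : hopf_alg S) (D : braiding_datum om H).
Context (Ad_sig_invol : Adj H (sig D) (sigV D) ∘ Adj H (sig D) (sigV D) = idm H).
Local Notation μ := (mul H).
Local Notation Δ := (comul H).
Local Notation η := (uni H).
Local Notation ε := (counit H).
Local Notation s := (antip H).
Local Notation sV := (antipV H).
Local Notation ι := (idm H).
Local Notation τ := (brai H H).
Local Notation CD := (C_data D).
Implicit Types (M N : module_data S) (U V X Y : ob S).

(** What is left of being a morphism when the actions of H are forgotten; it is
    enough for inverses to be unique. *)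
Definition typedC (A B : C_ob S) (f : C_ar S) : Prop :=
  match A, B, f with
  | Ob0 M, Ob0 N, Ar0 f => f ∈ M ⟶ N
  | Ob1 X, Ob1 Y, Ar1 f => f ∈ X ⟶ Y
  | _, _, _ => False
  end.

Lemma homC_typed A B f : @isHom CD A B f -> typedC A B f.
Proof. by case: A; case: B; case: f => //= ? ? ? []. Qed.

Lemma two_inv U V (f g h : ar S) : f ∈ U ⟶ V -> g ∈ V ⟶ U -> h ∈ V ⟶ U ->
  h ∘ f = idm U -> f ∘ g = idm V -> h = g.
Proof.
move=> hf hg hh e1 e2; transitivity (h ∘ (f ∘ g)); first by rewrite e2; symmetry; net.
by rewrite comp_assoc; try hm; rewrite e1; net.
Qed.

Lemma C_inv_eq A B f g : typedC A B f -> @is_inverse CD A B f g -> inv (C := CD) A B f = g.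
Proof.
move=> hf hg; apply: inv_eq => // h [hh h1 _]; case: hg => hg _ h2.
have := homC_typed hg; have := homC_typed hh.
case: A B f g h hf hg hh h1 h2 => [M|X] [N|Y] [f|f] // [g|g] // [h|h] //=.
  move=> hf _ _ [h1] [h2] hh hg; congr Ar0; exact: two_inv hf hg hh h1 h2.
move=> hf _ _ [h1] [h2] hh hg; congr Ar1; exact: two_inv hf hg hh h1 h2.
Qed.

(** The inverses of the associativity isomorphisms: γ is replaced by the
    copairing, δ and φ by their inverses; in degrees (0, 1, 1) the antipode
    disappears, in degrees (1, 1, 0) it appears. *)
Definition C_assocV (A B C : C_ob S) : C_ar S :=
  match A, B, C with
  | Ob0 A, Ob0 B, Ob0 C => Ar0 (idm (A ⊠ B ⊠ C))
  | Ob0 A, Ob0 B, Ob1 C => Ar1 (idm (A ⊠ B ⊠ C))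
  | Ob1 A, Ob0 B, Ob0 C => Ar1 (idm (A ⊠ B ⊠ C))
  | Ob0 A, Ob1 B, Ob0 C =>
      Ar1 ((idm A ⊗ brai C B)
             ∘ ((act2 H A C ∘ (cop D ⊗ idm (A ⊠ C))) ⊗ idm B)
             ∘ (idm A ⊗ brai B C))
  | Ob0 A, Ob1 B, Ob1 C =>
      Ar0 (((act A ⊗ ι) ∘ (ι ⊗ brai H A) ∘ (Δ ⊗ idm A)) ⊗ idm (B ⊠ C))
  | Ob1 A, Ob0 B, Ob1 C =>
      Ar0 (((μ ⊗ idm A ⊗ act B)
              ∘ (idm (H ⊠ H) ⊗ brai H A ⊗ idm B)
              ∘ (idm H ⊗ deltaV D ⊗ idm (A ⊠ B))) ⊗ idm C)
  | Ob1 A, Ob1 B, Ob0 C =>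
      Ar0 ((idm (H ⊠ A ⊠ B) ⊗ act C)
             ∘ (idm H ⊗ brai H (A ⊠ B) ⊗ idm C)
             ∘ (((ι ⊗ s) ∘ Δ) ⊗ idm (A ⊠ B ⊠ C)))
  | Ob1 A, Ob1 B, Ob1 C =>
      Ar1 ((brai H A ∘ (phiV D ⊗ idm A)) ⊗ idm (B ⊠ C))
  end.

Lemma C_assoc_typed (A B C : C_ob S) : C_isOb H A -> C_isOb H B -> C_isOb H C ->
  typedC (C_tensO H A (C_tensO H B C)) (C_tensO H (C_tensO H A B) C) (C_assoc D A B C).
Proof.
have h1 := gamma_hom S_sym D; have h2 := delta_hom S_sym D; have h3 := phi_hom D.
case: A B C => [A|A] [B|B] [C|C] /= hA hB hC; rewrite /act2 ?(braiVE S_sym);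
  try (have [hA' _ _] := hA); try (have [hB' _ _] := hB); try (have [hC' _ _] := hC); hm.
Qed.

Lemma C_assocV_typed (A B C : C_ob S) : C_isOb H A -> C_isOb H B -> C_isOb H C ->
  typedC (C_tensO H (C_tensO H A B) C) (C_tensO H A (C_tensO H B C)) (C_assocV A B C).
Proof.
have h1 := cop_hom D; have h2 := deltaV_hom D; have h3 := phiV_hom D.
case: A B C => [A|A] [B|B] [C|C] /= hA hB hC; rewrite /act2;
  try (have [hA' _ _] := hA); try (have [hB' _ _] := hB); try (have [hC' _ _] := hC); hm.
Qed.

Lemma C_assocK (A B C : C_ob S) : C_isOb H A -> C_isOb H B -> C_isOb H C ->
  C_comp (C_assocV A B C) (C_assoc D A B C) = C_id (C_tensO H A (C_tensO H B C)).
Proof.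
have h1 := gamma_hom S_sym D; have h2 := delta_hom S_sym D; have h3 := phi_hom D.
have h4 := cop_hom D; have h5 := deltaV_hom D; have h6 := phiV_hom D.
case: A B C => [A|A] [B|B] [C|C] /= hA hB hC; congr (_ _); rewrite /act2 ?(braiVE S_sym);
  try (have [hA' mA uA] := hA); try (have [hB' mB uB] := hB); try (have [hC' mC uC] := hC).
- net.
- net.
- net (esym mA, esym mC, gammaVK S_sym D, uA, uC).
- net (esym mA, esym (comul_assoc H), antipV_r S_sym H, uA, comul_1l H).
- net.
- net (mul_assoc H, esym mB, deltaK S_sym D, mul_1r H, uB).
- net (comul_assoc H, esym mC, antip_l H, comul_1r H, uC).
- net (phiK S_sym D).
Qed.

Lemma C_assocVK (A B C : C_ob S) : C_isOb H A -> C_isOb H B -> C_isOb H C ->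
  C_comp (C_assoc D A B C) (C_assocV A B C) = C_id (C_tensO H (C_tensO H A B) C).
Proof.
have h1 := gamma_hom S_sym D; have h2 := delta_hom S_sym D; have h3 := phi_hom D.
have h4 := cop_hom D; have h5 := deltaV_hom D; have h6 := phiV_hom D.
case: A B C => [A|A] [B|B] [C|C] /= hA hB hC; congr (_ _); rewrite /act2 ?(braiVE S_sym);
  try (have [hA' mA uA] := hA); try (have [hB' mB uB] := hB); try (have [hC' mC uC] := hC).
- net.
- net.
- net (esym mA, esym mC, gammaK S_sym D, uA, uC).
- net (esym mA, esym (comul_assoc H), antipV_l S_sym H, uA, comul_1l H).
- net.
- net (mul_assoc H, esym mB, deltaVK S_sym D, mul_1r H, uB).
- net (comul_assoc H, esym mC, antip_r H, comul_1r H, uC).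
- net (phiVK S_sym Ad_sig_invol).
Qed.

Lemma C_tens_ok (A B : C_ob S) : C_isOb H A -> C_isOb H B -> C_isOb H (C_tensO H A B).
Proof.
case: A B => [A|A] [B|B] //= hA hB; [exact: mod_tens_ok | exact: mod_free_ok].
Qed.

Lemma C_dual_ok (A : C_ob S) : C_isOb H A -> C_isOb H (C_dual H A).
Proof. by case: A => //= M; exact: mod_dual_ok. Qed.

Lemma C_assoc_hom (A B C : C_ob S) : C_isOb H A -> C_isOb H B -> C_isOb H C ->
  @isHom CD (C_tensO H A (C_tensO H B C)) (C_tensO H (C_tensO H A B) C) (C_assoc D A B C).
Proof.
move=> hA hB hC; have := C_assoc_typed hA hB hC; move: hA hB hC.
case: A B C => [A|A] [B|B] [C|C] //= hA hB hC h; split=> //; move: h => _;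
  rewrite ?act_tensE /act2 ?(braiVE S_sym) /= /act2;
  have h1 := gamma_hom S_sym D; have h2 := delta_hom S_sym D; have h3 := phi_hom D;
  try (have [hA' mA uA] := hA); try (have [hB' mB uB] := hB); try (have [hC' mC uC] := hC).
- net (esym (comul_assoc H)).
- net (esym mA, comul_mul H, antipV_mul S_sym H, mul_assoc H, esym (comul_assoc H),
       antipV_l S_sym H, mul_1r H, comul_1l H).
- net (mul_assoc H).
- net (comul_mul H, mC).
Qed.

Lemma C_assoc_inv (A B C : C_ob S) : C_isOb H A -> C_isOb H B -> C_isOb H C ->
  @is_inverse CD (C_tensO H A (C_tensO H B C)) (C_tensO H (C_tensO H A B) C)
    (C_assoc D A B C) (C_assocV A B C).
Proof.
move=> hA hB hC; split; [|exact: C_assocK|exact: C_assocVK].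
have := C_assoc_hom hA hB hC; have := C_assocV_typed hA hB hC.
have := C_assocK hA hB hC; have := C_assocVK hA hB hC.
have := C_tens_ok hA (C_tens_ok hB hC); have := C_tens_ok (C_tens_ok hA hB) hC.
move: (C_tensO H A _) (C_tensO H _ C) (C_assoc D A B C) (C_assocV A B C).
case=> [M|X] [N|Y] [f|f] // [g|g] //= [hN _ _] [hM _ _] [fg] [gf] hg hf.
exact: mod_hom_inv hf hg gf fg.
Qed.

Lemma C_assoc_invE (A B C : C_ob S) : C_isOb H A -> C_isOb H B -> C_isOb H C ->
  inv (C := CD) (C_tensO H A (C_tensO H B C)) (C_tensO H (C_tensO H A B) C)
    (C_assoc D A B C) = C_assocV A B C.
Proof.
move=> hA hB hC; apply: C_inv_eq; [exact: C_assoc_typed | exact: C_assoc_inv].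
Qed.

End Assoc.

(** * Duals and adjuncts in the disjoint union *)

(** The adjunct of a pairing of W and Z. The canonical map from B^∨ ⊗ A^∨ to
    the dual of A ⊗ B is one, for the pairing [ev_tens]. *)
Definition curry (C : rigid_data) (W Z : Ob C) (e : Ar C) : Ar C :=
  compA (compA (compA (compA (lunitA (dualO Z)) (tensA e (idA (dualO Z))))
    (assocA W Z (dualO Z))) (tensA (idA W) (coevA Z)))
    (inv (tensO W (unitO C)) W (runitA W)).

(** The actions of the modules stay folded. *)
Ltac unC := cbv [compA tensA runitA lunitA dualO idA evA coevA assocA tensO unitO isHom
  C_data C_comp C_tensA C_id C_ev C_coev C_assoc C_assocV C_dual C_tensO under]; mcars.

Section Pivotal.
Context (S : ribbon) (S_sym : symmetric S) (S_twist : trivial_twist S).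
Context (om : involution S) (H : hopf_alg S) (D : braiding_datum om H).
Context (Ad_sig_invol : Adj H (sig D) (sigV D) ∘ Adj H (sig D) (sigV D) = idm H).
Local Notation μ := (mul H).
Local Notation Δ := (comul H).
Local Notation η := (uni H).
Local Notation ε := (counit H).
Local Notation s := (antip H).
Local Notation ι := (idm H).
Local Notation CD := (C_data D).
Implicit Types (M N : module_data S) (U V X Y : ob S) (A B : C_ob S).

Definition uob A : ob S := match A with Ob0 M => mcar M | Ob1 X => X end.
Definition mkA A (f : ar S) : C_ar S := match A with Ob0 _ => Ar0 f | Ob1 _ => Ar1 f end.

Ltac unU := cbv [uob C_tensO C_dual]; mcars.

Lemma unit_ok : C_isOb H (Ob0 (mod_unit H)). Proof. exact: mod_unit_ok. Qed.

Lemma C_runit_inv A : C_isOb H A ->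
  @is_inverse CD (C_tensO H A (Ob0 (mod_unit H))) A (C_id A) (C_id A).
Proof.
move=> hA; case: A hA => [M|X] /= hA; split=> /=.
- split; first by mcars; hm.
  have [hM _ _] := hA; rewrite act_tensE /act2 /=; mcars; symmetry; net (comul_1r H).
- by mcars; congr Ar0; net.
- by congr Ar0; net.
- by mcars; hm.
- by congr Ar1; net.
- by congr Ar1; net.
Qed.

Lemma C_runit_invE A : C_isOb H A ->
  inv (C := CD) (C_tensO H A (Ob0 (mod_unit H))) A (C_id A) = C_id A.
Proof.
move=> hA; apply: C_inv_eq => //; last exact: C_runit_inv.
by case: A hA => [M|X] /= hA; mcars; hm.
Qed.

Lemma C_curry0 M N (e : ar S) : is_module H M -> e ∈ M ⊠ N ⟶ one ->
  curry (C := CD) (Ob0 M) (Ob0 N) (Ar0 e) = Ar0 (transp M N e).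
Proof.
move=> hM he; rewrite /curry [X in compA _ X](C_runit_invE (A := Ob0 M)) //=.
by congr Ar0; mcars; rewrite /transp; net.
Qed.

(** In degree one the adjunct involves an associativity isomorphism, which
    contributes φ, and a coevaluation, which contributes Λ; and φ(Λ) = 1. *)
Lemma C_curry1 X Y (e : ar S) : e ∈ H ⊠ X ⊠ Y ⟶ one ->
  curry (C := CD) (Ob1 X) (Ob1 Y) (Ar0 e) =
  Ar1 (transp X Y (e ∘ (η ⊗ idm (X ⊠ Y)))).
Proof.
move=> he; rewrite /curry [X in compA _ X](C_runit_invE (A := Ob1 X)) //=.
have hL := Lambda_hom D; have h := phi_hom D.
congr Ar1; rewrite /transp (braiVE S_sym); symmetry; net (esym (phi_Lambda S_sym D)).
Qed.

(** In degree one, φ(Λ) = 1 once more. *)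
Lemma C_dual_arrE A B f : C_isOb H A -> C_isOb H B -> @isHom CD A B f ->
  dual_arr (C := CD) A B f = mkA A (dualm (under f)).
Proof.
move=> hA hB; rewrite /dual_arr.
rewrite [X in compA _ X](C_runit_invE (C_dual_ok S_sym hB)).
case: A B f hA hB => [M|X] [N|Y] [f|f] //= hA hB hf.
  case: hf => hf _; congr Ar0; mcars; rewrite (dualmE S_sym hf) /transp; net.
congr Ar1; rewrite (dualmE S_sym hf) /transp (braiVE S_sym).
have hL := Lambda_hom D; have h := phi_hom D.
net (phi_Lambda S_sym D, counit_uni H).
Qed.

(** * Duals of tensor products in the disjoint union *)

(** See [p01] for the four cases. *)
Definition pairT A B : ar S :=
  match A, B with
  | Ob0 M, Ob0 N => evP M N
  | Ob0 M, Ob1 X => p01 D M X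
  | Ob1 X, Ob0 M => evP X M
  | Ob1 X, Ob1 Y => p11 D X Y
  end.
Definition copairT A B : ar S :=
  match A, B with
  | Ob0 M, Ob0 N => coevP M N
  | Ob0 M, Ob1 X => q01 D M X
  | Ob1 X, Ob0 M => coevP X M
  | Ob1 X, Ob1 Y => q11 D X Y
  end.
Local Notation W A B := (C_tensO H (C_dual H B) (C_dual H A)).
Local Notation Z A B := (C_tensO H A B).

Lemma pairT_hom A B : C_isOb H A -> C_isOb H B ->
  pairT A B ∈ uob (W A B) ⊠ uob (Z A B) ⟶ one.
Proof.
case: A B => [A|A] [B|B] /= hA hB; [exact: evP_hom|exact: p01_hom|exact: evP_hom|exact: p11_hom].
Qed.
Lemma copairT_hom A B : C_isOb H A -> C_isOb H B ->
  copairT A B ∈ one ⟶ uob (Z A B) ⊠ uob (W A B).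
Proof.
case: A B => [A|A] [B|B] /= hA hB;
  [exact: coevP_hom|exact: q01_hom|exact: coevP_hom|exact: q11_hom].
Qed.
Lemma pairTK A B : C_isOb H A -> C_isOb H B ->
  (pairT A B ⊗ idm (uob (W A B))) ∘ (idm (uob (W A B)) ⊗ copairT A B) = idm (uob (W A B)).
Proof.
case: A B => [A|A] [B|B] /= hA hB;
  [exact: evP_coevP|exact: p01_q01|exact: evP_coevP|exact: p11_q11].
Qed.
Lemma pairTVK A B : C_isOb H A -> C_isOb H B ->
  (idm (uob (Z A B)) ⊗ pairT A B) ∘ (copairT A B ⊗ idm (uob (Z A B))) = idm (uob (Z A B)).
Proof.
case: A B => [A|A] [B|B] /= hA hB;
  [exact: coevP_evP|exact: q01_p01|exact: coevP_evP|exact: q11_p11].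
Qed.

Definition dtens A B : ar S := transp (uob (W A B)) (uob (Z A B)) (pairT A B).
Definition dtensV A B : ar S := copair (uob (W A B)) (uob (Z A B)) (copairT A B).

Lemma dtens_hom A B : C_isOb H A -> C_isOb H B ->
  dtens A B ∈ uob (W A B) ⟶ (uob (Z A B))^∨.
Proof. by move=> hA hB; apply: hom_transp (pairT_hom hA hB). Qed.
Lemma dtensV_hom A B : C_isOb H A -> C_isOb H B ->
  dtensV A B ∈ (uob (Z A B))^∨ ⟶ uob (W A B).
Proof. by move=> hA hB; apply: copair_hom (copairT_hom hA hB). Qed.
Lemma dtensK A B : C_isOb H A -> C_isOb H B -> dtensV A B ∘ dtens A B = idm (uob (W A B)).
Proof.
move=> hA hB; apply: copair_transp (pairT_hom hA hB) (copairT_hom hA hB) (pairTK hA hB) => //.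
Qed.
Lemma dtensVK A B : C_isOb H A -> C_isOb H B -> dtens A B ∘ dtensV A B = idm (uob (Z A B))^∨.
Proof.
move=> hA hB; apply: transp_copair (pairT_hom hA hB) (copairT_hom hA hB) (pairTVK hA hB) => //.
Qed.

Lemma dtens_homC A B : C_isOb H A -> C_isOb H B ->
  @isHom CD (W A B) (C_dual H (Z A B)) (mkA (Z A B) (dtens A B)).
Proof.
move=> hA hB; have := dtens_hom hA hB; move: hA hB.
case: A B => [A|A] [B|B] //= hA hB _; [exact: evP_mod|exact: p11_mod].
Qed.

Lemma dtensV_homC A B : C_isOb H A -> C_isOb H B ->
  @isHom CD (C_dual H (Z A B)) (W A B) (mkA (Z A B) (dtensV A B)).
Proof.
move=> hA hB; have := dtens_homC hA hB; have := dtensV_hom hA hB.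
have := dtensK hA hB; have := dtensVK hA hB.
have := C_dual_ok S_sym (C_tens_ok S_sym hA hB).
have := C_tens_ok S_sym (C_dual_ok S_sym hB) (C_dual_ok S_sym hA).
case: A B hA hB => [A|A] [B|B] //= hA hB [h1 _ _] [h2 _ _] e1 e2 h3 h4;
  exact: mod_hom_inv h4 h3 e2 e1.
Qed.

Definition same_deg A B : bool :=
  match A, B with Ob0 _, Ob0 _ | Ob1 _, Ob1 _ => true | _, _ => false end.

(** The associativity isomorphisms in [ev_tens] are followed by a counit or by
    an evaluation of modules. In degrees (0, 1), ε applied to one leg of δ
    leaves g; in degrees (1, 0) the actions on B and on its dual cancel by the
    axiom of the antipode; in degrees (1, 1), ε ∘ φ^-1 = λ ∘ S. *)
Lemma ev_tensE A B : C_isOb H A -> C_isOb H B ->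
  ev_tens (C := CD) A B = Ar0 (if same_deg A B then pairT A B else ε ⊗ pairT A B).
Proof.
move=> hA hB; rewrite /ev_tens.
rewrite [inv _ _ _](C_assoc_invE S_sym Ad_sig_invol (C_dual_ok S_sym hB) (C_dual_ok S_sym hA) hA).
have hA' := C_dual_ok S_sym hA; have hB' := C_dual_ok S_sym hB.
have hd := delta_hom S_sym D; have hp := phiV_hom D.
case: A B hA hB hA' hB' => [A|A] [B|B] hA hB hA' hB'; unC; congr Ar0; rewrite /pairT.
- rewrite /evP; net.
- have [hA0 _ _] := hA; rewrite /p01 /evP /actby.
  net (counit_mul H, delta_counit S_sym D).
- have [hB0 mB uB] := hB; have e := ev_mod_dual hB; have [hB1 _ _] := hB'.
  set ad := act (mod_dual H B) in e hB1 *; mcars_all; rewrite /evP.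
  net (comul_1r H, e, esym mB, antip_l H, uB).
- rewrite /= ?(braiVE S_sym) /p11 /evP /fpair.
  net (kappa_phiV S_sym Ad_sig_invol, antip_mul S_sym H, antipVK H, comul_1r H).
Qed.

Lemma dual_tensE A B : C_isOb H A -> C_isOb H B ->
  dual_tens (C := CD) A B = mkA (Z A B) (dtens A B).
Proof.
move=> hA hB; rewrite -[LHS]/(curry (C := CD) (W A B) (Z A B) (ev_tens (C := CD) A B)).
rewrite ev_tensE //; have hp := pairT_hom hA hB.
have hW := C_tens_ok S_sym (C_dual_ok S_sym hB) (C_dual_ok S_sym hA).
rewrite /dtens; move: hp hW; case: A B hA hB => [A|A] [B|B] hA hB hp hW.
- rewrite [LHS]C_curry0 //.
- rewrite [LHS]C_curry1 //; last by rewrite /= in hp *; mcars_all; hm.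
  rewrite /= in hp *; mcars_all; congr (Ar1 (transp _ _ _)); net (counit_uni H).
- rewrite [LHS]C_curry1 //; last by rewrite /= in hp *; mcars_all; hm.
  rewrite /= in hp *; mcars_all; congr (Ar1 (transp _ _ _)); net (counit_uni H).
- rewrite [LHS]C_curry0 //.
Qed.

(** * The pivotal structure on the disjoint union *)

Definition udelta A : ar S := under (C_delta D A).

Lemma deltaE_C A : C_delta D A = mkA A (udelta A). Proof. by case: A. Qed.

Lemma delta_hom_C A : C_isOb H A -> @isHom CD A (C_dual H (C_dual H A)) (C_delta D A).
Proof.
case: A => [M|X] hA; last exact: piv_hom.
have := delta_mod S_sym S_twist Ad_sig_invol hA; rewrite /C_delta /= /actby.
have [hM _ _] := hA; have hp := piv_hom S_sym S_twist M.
by rewrite comp_assoc //; hm.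
Qed.

Definition udeltaV A : ar S :=
  match A with Ob0 M => actby M (gelV D) ∘ pivV M | Ob1 X => pivV X end.

Lemma udelta0 M : is_module H M -> udelta (Ob0 M) = piv M ∘ actby M (gel D).
Proof.
move=> [hM _ _]; rewrite /udelta /= -comp_assoc //; have hp := piv_hom S_sym S_twist M; hm.
Qed.

Lemma delta_iso A : C_isOb H A ->
  @is_iso CD A (C_dual H (C_dual H A)) (C_delta D A).
Proof.
move=> hA; have hd := delta_hom_C hA; split => //.
exists (mkA A (udeltaV A)).
case: A hA hd => [M|X] hA hd; last first.
  split; [exact: pivV_hom | by congr Ar1; exact: pivK | by congr Ar1; exact: pivVK].
have hp := piv_hom S_sym S_twist M; have hv := pivV_hom M.
have k := pivK S_sym S_twist M; have k' := pivVK S_sym S_twist M.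
have [hM _ _] := hA; have h1 := actby_hom hM (gel_hom D); have h2 := actby_hom hM (gelV_hom D).
have g1 := actby_gVK S_sym D hA; have g2 := actby_gK S_sym D hA.
have e1 : udeltaV (Ob0 M) ∘ udelta (Ob0 M) = idm M.
  by rewrite (udelta0 hA) /udeltaV; net (k, g1).
have e2 : udelta (Ob0 M) ∘ udeltaV (Ob0 M) = idm M^∨^∨.
  by rewrite (udelta0 hA) /udeltaV; net (g2, k').
have hdd := C_dual_ok S_sym (C_dual_ok S_sym hA).
split; [|by congr Ar0; exact: e1|by congr Ar0; exact: e2].
have [hdd' _ _] := hdd.
by apply: mod_hom_inv hd _ e1 e2 => //; rewrite /udeltaV; mcars; hm.
Qed.

(** Both sides of the conclusion are adjuncts of the same pairing. *)
Lemma dualm_transp_piv U V V' (p p' z d : ar S) :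
  p ∈ U ⊠ V ⟶ one -> p' ∈ V' ⊠ U ⟶ one -> z ∈ V ⟶ V -> d ∈ V ⟶ V' ->
  p' ∘ (d ⊗ idm U) = p ∘ (idm U ⊗ z) ∘ brai V U ->
  dualm (transp U V p) ∘ (piv V ∘ z) = transp V' U p' ∘ d.
Proof.
move=> hp hp' hz hd e.
have ht := hom_transp hp; have et := ev_transp hp.
have ht' := hom_transp hp'; have et' := ev_transp hp'.
have hD := dualm_hom S_sym ht; have eD := ev_dualm S_sym ht.
have hv := piv_hom S_sym S_twist V; have ev_ := ev_piv S_sym S_twist V.
apply: (@ev_inj S S_sym V U); [hm|hm|].
net (eD, ev_, et, esym e, esym et').
Qed.

(** Monoidality of δ, up to inverting canonical maps: an identity between
    adjuncts of pairings, one of the [pair_piv] lemmas in each case. *)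
Lemma dtens_delta A B : C_isOb H A -> C_isOb H B ->
  dualm (dtens A B) ∘ udelta (Z A B) =
  dtens (C_dual H B) (C_dual H A) ∘ under (C_tensA H (C_delta D A) (C_delta D B)).
Proof.
move=> hA hB; have hp := pairT_hom hA hB.
have hp' := pairT_hom (C_dual_ok S_sym hB) (C_dual_ok S_sym hA).
have hd := delta_hom_C hA; have hd' := delta_hom_C hB.
have hZ := C_tens_ok S_sym hA hB.
case: A B hA hB hp hp' hd hd' hZ => [A|A] [B|B] hA hB hp hp' hd hd' hZ.
- have hZg : actby (mod_tens H A B) (gel D) ∈ (A ⊠ B) ⟶ (A ⊠ B).
    by case: hZ => hZ _ _; exact: actby_hom (gel_hom D).
  have -> : under (C_tensA H (C_delta D (Ob0 A))
    (C_delta D (Ob0 B))) = udelta (Ob0 A) ⊗ udelta (Ob0 B) by [].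
  rewrite [udelta (Z _ _)](udelta0 hZ) !udelta0 //.
  apply: dualm_transp_piv => //; last exact: pair_piv00.
  have [hA' _ _] := hA; have [hB' _ _] := hB.
  have h1 := actby_hom hA' (gel_hom D); have h2 := actby_hom hB' (gel_hom D).
  have h3 := piv_hom S_sym S_twist A; have h4 := piv_hom S_sym S_twist B.
  by unU; hm.
- have -> : udelta (Z (Ob0 A) (Ob1 B)) = piv (A ⊠ B) by [].
  have -> : under (C_tensA H (C_delta D (Ob0 A)) (C_delta D (Ob1 B))) = udelta (Ob0 A) ⊗ piv B
    by [].
  rewrite !udelta0 //.
  have h3 := piv_hom S_sym S_twist A; have h4 := piv_hom S_sym S_twist B.
  have [hA' _ _] := hA; have h1 := actby_hom hA' (gel_hom D).
  rewrite -[piv (A ⊠ B)](idrm (piv_hom S_sym S_twist (A ⊠ B))).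
  apply: dualm_transp_piv => //.
  + by unU; hm.
  + by unU; hm.
  rewrite -[RHS]/(p01 D A B ∘ _ ∘ _) tens_id; have hpp := p01_hom D hA B.
  by rewrite (idrm hpp); exact: pair_piv01.
- have -> : udelta (Z (Ob1 A) (Ob0 B)) = piv (A ⊠ B) by [].
  have -> : under (C_tensA H (C_delta D (Ob1 A)) (C_delta D (Ob0 B))) = piv A ⊗ udelta (Ob0 B)
    by [].
  rewrite !udelta0 //.
  have h3 := piv_hom S_sym S_twist A; have h4 := piv_hom S_sym S_twist B.
  have [hB' _ _] := hB; have h1 := actby_hom hB' (gel_hom D).
  rewrite -[piv (A ⊠ B)](idrm (piv_hom S_sym S_twist (A ⊠ B))).
  apply: dualm_transp_piv => //.
  + by unU; hm.
  + by unU; hm.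
  rewrite -[RHS]/(evP A B ∘ _ ∘ _) tens_id; have hpp := evP_hom A B.
  by rewrite (idrm hpp); exact: pair_piv10.
have hZg : actby (mod_free H (A ⊠ B)) (gel D) ∈ (H ⊠ A ⊠ B) ⟶ (H ⊠ A ⊠ B).
  by case: hZ => hZ _ _; exact: actby_hom (gel_hom D).
have h3 := piv_hom S_sym S_twist A; have h4 := piv_hom S_sym S_twist B.
have -> : under (C_tensA H (C_delta D (Ob1 A)) (C_delta D (Ob1 B))) = ι ⊗ piv A ⊗ piv B by [].
rewrite [udelta (Z _ _)](udelta0 hZ).
apply: dualm_transp_piv => //; last exact: pair_piv11.
by unU; hm.
Qed.

Lemma udelta_hom A : C_isOb H A -> udelta A ∈ uob A ⟶ (uob A)^∨^∨.
Proof.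
case: A => [M|X] hA; last exact: piv_hom.
by have := delta_hom_C hA; case.
Qed.

Lemma C_dual_dtens A B : C_isOb H A -> C_isOb H B ->
  dual_arr (C := CD) (W A B) (C_dual H (Z A B)) (dual_tens (C := CD) A B) =
  mkA (Z A B) (dualm (dtens A B)).
Proof.
move=> hA hB.
have hA' := C_dual_ok S_sym hA; have hB' := C_dual_ok S_sym hB.
have hW := C_tens_ok S_sym hB' hA'; have hZ := C_dual_ok S_sym (C_tens_ok S_sym hA hB).
rewrite dual_tensE // C_dual_arrE //; last exact: dtens_homC.
by case: A B {hA hB hA' hB' hW hZ} => [A|A] [B|B].
Qed.

Lemma C_dual_dtens_inv A B : C_isOb H A -> C_isOb H B ->
  inv (C := CD) (C_dual H (C_dual H (Z A B))) (C_dual H (W A B))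
    (mkA (Z A B) (dualm (dtens A B))) = mkA (Z A B) (dualm (dtensV A B)).
Proof.
move=> hA hB.
have h1 := dtens_hom hA hB; have h2 := dtensV_hom hA hB.
have e1 : dualm (dtensV A B) ∘ dualm (dtens A B) = idm (uob (Z A B))^∨^∨.
  by rewrite -(dualm_comp S_sym h2 h1) dtensVK // dualm_id.
have e2 : dualm (dtens A B) ∘ dualm (dtensV A B) = idm (uob (W A B))^∨.
  by rewrite -(dualm_comp S_sym h1 h2) dtensK // dualm_id.
have := dtensV_homC hA hB.
have hW := C_tens_ok S_sym (C_dual_ok S_sym hB) (C_dual_ok S_sym hA).
have hZ := C_dual_ok S_sym (C_tens_ok S_sym hA hB).
have d1 := dualm_hom S_sym h1; have d2 := dualm_hom S_sym h2.
move: (dtens A B) (dtensV A B) e1 e2 h1 h2 d1 d2 hW hZ.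
case: A B hA hB => [A|A] [B|B] hA hB t tv e1 e2 h1 h2 d1 d2 hW hZ ht; apply: C_inv_eq => //.
- split; [exact: dualm_mod ht|by congr Ar0|by congr Ar0].
- split; [exact: d2|by congr Ar1|by congr Ar1].
- split; [exact: d2|by congr Ar1|by congr Ar1].
- split; [exact: dualm_mod ht|by congr Ar0|by congr Ar0].
Qed.

Lemma coev_one_hom : coev one ∈ one ⟶ (one^∨ : ob S).
Proof. by apply: hom_cast (hom_coev _) _ _; rewrite ?otens_1l. Qed.
Lemma ev_one_hom : ev one ∈ (one^∨ : ob S) ⟶ one.
Proof. by apply: hom_cast (hom_ev _) _ _; rewrite ?otens_1r. Qed.
Lemma ev_coev_one : ev one ∘ coev one = idm one :> ar S.
Proof. have z := zigzag (@one S); net z. Qed.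
Lemma coev_ev_one : coev one ∘ ev one = idm one^∨ :> ar S.
Proof. have z := zigzag_dual (@one S); net z. Qed.

Lemma act_unitE : act (mod_unit H) = ε. Proof. by []. Qed.

Lemma coev_one_mod : module_hom H (mod_unit H) (mod_dual H (mod_unit H)) (coev one).
Proof.
have e := ev_mod_dual (mod_unit_ok S_sym H);
  have [hd _ _] := mod_dual_ok S_sym (mod_unit_ok S_sym H).
split; first exact: coev_one_hom.
rewrite act_unitE in e *.
set ad := act (mod_dual _ _) in e hd *; mcars_all.
have h := coev_one_hom.
apply: (@ev_inj S S_sym H one); [hm|hm|].
symmetry; net (e, counit_antip S_sym H).
Qed.

Lemma piv_one : dualm (ev one) ∘ coev one = piv one :> ar S.
Proof.
have h := coev_one_hom; have h' := ev_one_hom; have hd := dualm_hom S_sym h'.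
have e := ev_dualm S_sym h'; have hp := piv_hom S_sym S_twist one.
have ep := ev_piv S_sym S_twist one; have k := ev_coev_one.
apply: (@ev_inj S S_sym one one^∨); [hm|hm|].
net (e, k, esym ep).
Qed.

Lemma C_dual_unitE : dual_unit CD = Ar0 (coev one).
Proof. by congr Ar0; rewrite (idlm coev_one_hom). Qed.

Lemma C_ddual_unitE : ddual_unit CD = Ar0 (piv one).
Proof.
have hu := unit_ok; have hu' := C_dual_ok S_sym hu.
have h := coev_one_hom; have h' := ev_one_hom.
have d := dualm_hom S_sym h; have d' := dualm_hom S_sym h'.
have hm1 : @isHom CD (Ob0 (mod_unit H)) (C_dual H (Ob0 (mod_unit H))) (Ar0 (coev one)).
  exact: coev_one_mod.
have [hd _ _] := mod_dual_ok S_sym (mod_unit_ok S_sym H).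
have [hh _ _] := mod_unit_ok S_sym H.
have hm2 : module_hom H (mod_dual H (mod_unit H)) (mod_unit H) (ev one).
  exact: mod_hom_inv hh hd coev_one_mod h' ev_coev_one coev_ev_one.
rewrite /ddual_unit C_dual_unitE (C_dual_arrE hu hu' hm1).
have -> : inv (C := CD) (dualO (dualO (unitO CD))) (dualO (unitO CD))
    (mkA (Ob0 (mod_unit H)) (dualm (under (Ar0 (coev one))))) = Ar0 (dualm (ev one)).
  apply: (C_inv_eq S_sym); first exact: d.
  split; first exact: dualm_mod hu' hu hm2.
    by congr Ar0; rewrite -(dualm_comp S_sym h' h) coev_ev_one dualm_id.
  by congr Ar0; rewrite -(dualm_comp S_sym h h') ev_coev_one dualm_id.
by congr Ar0; exact: piv_one.
Qed.

Lemma udelta_nat A B f : C_isOb H A -> C_isOb H B -> @isHom CD A B f ->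
  udelta B ∘ under f = dualm (dualm (under f)) ∘ udelta A.
Proof.
case: A B f => [A|A] [B|B] [f|f] //= hA hB hf; last exact: piv_nat.
case: hf => hf ef.
have e := piv_nat S_sym S_twist hf; have hd := dualm_hom S_sym (dualm_hom S_sym hf).
have [hA' _ _] := hA; have [hB' _ _] := hB.
have h3 := piv_hom S_sym S_twist A; have h4 := piv_hom S_sym S_twist B.
rewrite /udelta /=; symmetry; net (esym e, ef).
Qed.

Theorem C_pivotal : @is_pivotal CD (C_delta D).
Proof.
split.
- exact: delta_iso.
- move=> A B f hA hB hf; rewrite /ddual_arr.
  have hA' := C_dual_ok S_sym hA; have hB' := C_dual_ok S_sym hB.
  have hf' : @isHom CD (C_dual H B) (C_dual H A) (mkA A (dualm (under f))).
    case: A B f hA hB hf {hA' hB'} => [A|A] [B|B] [f|f] //= hA hB hf; first exact: dualm_mod.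
    exact: dualm_hom.
  rewrite C_dual_arrE // C_dual_arrE //.
  have := udelta_nat hA hB hf.
  by case: A B f hA hB hf hf' {hA' hB'} => [A|A] [B|B] [f|f] //= hA hB hf hf' e; rewrite -e.
- move=> A B hA hB; rewrite /ddual_tens.
  have hA' := C_dual_ok S_sym hA; have hB' := C_dual_ok S_sym hB.
  rewrite [dual_arr _ _ _](C_dual_dtens hA hB) [inv _ _ _](C_dual_dtens_inv hA hB).
  rewrite [dual_tens _ _](dual_tensE hB' hA').
  have e := dtens_delta hA hB.
  have hZ := C_tens_ok S_sym hA hB.
  have h1 := dtens_hom hA hB; have h2 := dtensV_hom hA hB; have h3 := udelta_hom hZ.
  have h4 := dtens_hom hB' hA'.
  have d1 := dualm_hom S_sym h1; have d2 := dualm_hom S_sym h2.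
  have hdA := udelta_hom hA; have hdB := udelta_hom hB.
  have E : dualm (dtensV A B) ∘ (dtens (C_dual H B) (C_dual H A) ∘
     under (C_tensA H (C_delta D A) (C_delta D B))) = udelta (Z A B).
    rewrite -e comp_assoc; try hm.
    rewrite -(dualm_comp S_sym h2 h1) dtensVK // dualm_id //.
    by rewrite (idlm h3).
  have hh : under (C_tensA H (C_delta D A) (C_delta D B)) ∈ uob (Z A B) ⟶ uob (W (C_dual H B)
    (C_dual H A)).
    rewrite (deltaE_C A) (deltaE_C B).
    case: (A) (B) hdA hdB => [?|?] [?|?] /= hdA hdB; mcars; hm.
  rewrite comp_assoc in E; try hm.
  move: E; case: (A) (B) {hA hB hA' hB' e hZ h1 h2 h3 h4 d1 d2 hdA hdB hh} => [?|?] [?|?] E.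
  + by congr Ar0; exact: esym E.
  + by congr Ar1; exact: esym E.
  + by congr Ar1; exact: esym E.
  + by congr Ar0; exact: esym E.
- rewrite [RHS]C_ddual_unitE; congr Ar0.
  have hp := piv_hom S_sym S_twist one.
  rewrite act_unitE; mcars; net (gel_counit S_sym D).
Qed.

End Pivotal.

(** * Additive structure and modules *)

Section Additive.
Context (S : ribbon) (S_sym : symmetric S) (a : additive S).
Implicit Types (U V W X Y : ob S) (f g h : ar S).
Local Notation "f +' g" := (aadd a f g) (at level 50, left associativity).
Local Notation O := (azero a).

Lemma add_hom U V f g : f ∈ U ⟶ V -> g ∈ U ⟶ V -> f +' g ∈ U ⟶ V.
Proof. exact: aadd_hom. Qed.
Lemma zero_hom U V : O U V ∈ U ⟶ V.
Proof. exact: azero_hom. Qed.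

Lemma hom_par U V f g : f ∈ U ⟶ V -> g ∈ U ⟶ V -> parallel f g.
Proof. by case=> e1 e2 [e3 e4]; split; rewrite ?e1 ?e2 ?e3 ?e4. Qed.

Lemma add_compl U V W f g h : f ∈ U ⟶ V -> g ∈ V ⟶ W -> h ∈ V ⟶ W ->
  (g +' h) ∘ f = (g ∘ f) +' (h ∘ f).
Proof. by move=> hf hg hh; rewrite comp_addl //; [exact: hom_par hg hh | hm]. Qed.
Lemma add_compr U V W f g h : f ∈ V ⟶ W -> g ∈ U ⟶ V -> h ∈ U ⟶ V ->
  f ∘ (g +' h) = (f ∘ g) +' (f ∘ h).
Proof. by move=> hf hg hh; rewrite comp_addr //; [exact: hom_par hg hh | hm]. Qed.
Lemma add_tensr U V f g h : g ∈ U ⟶ V -> h ∈ U ⟶ V -> f ⊗ (g +' h) = (f ⊗ g) +' (f ⊗ h).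
Proof. by move=> hg hh; rewrite tens_addr //; exact: hom_par hg hh. Qed.
Lemma add_tensl U V f g h : g ∈ U ⟶ V -> h ∈ U ⟶ V -> (g +' h) ⊗ f = (g ⊗ f) +' (h ⊗ f).
Proof. by move=> hg hh; rewrite tens_addl //; exact: hom_par hg hh. Qed.

Lemma add0r U V f : f ∈ U ⟶ V -> f +' O U V = f.
Proof. by case=> <- <-; exact: aadd0. Qed.
Lemma add0l U V f : f ∈ U ⟶ V -> O U V +' f = f.
Proof.
move=> hf; rewrite aaddC; first exact: add0r.
exact: hom_par (zero_hom _ _) hf.
Qed.

(** The only idempotent of an abelian group is its neutral element. *)
Lemma idem0 U V f : f ∈ U ⟶ V -> f +' f = f -> f = O U V.
Proof.
move=> hf e; have hN : aopp a f ∈ U ⟶ V := aopp_hom a hf.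
have eN : f +' aopp a f = O U V by rewrite aaddN; case: hf => -> ->.
rewrite -[LHS](add0r hf) -{1}eN aaddA; [by rewrite e|exact (hom_par hf hf)|exact (hom_par hf hN)].
Qed.

Lemma zero_add U V : O U V +' O U V = O U V.
Proof. exact: add0r (zero_hom U V). Qed.

Lemma comp0l U V W f : f ∈ U ⟶ V -> O V W ∘ f = O U W.
Proof.
move=> hf; have hz := zero_hom V W; apply: idem0; first by hm.
by rewrite -(add_compl hf hz hz) zero_add.
Qed.
Lemma comp0r U V W f : f ∈ V ⟶ W -> f ∘ O U V = O U W.
Proof.
move=> hf; have hz := zero_hom U V; apply: idem0; first by hm.
by rewrite -(add_compr hf hz hz) zero_add.
Qed.
Lemma tens0l U V X Y f : f ∈ X ⟶ Y -> O U V ⊗ f = O (U ⊠ X) (V ⊠ Y).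
Proof.
move=> hf; have hz := zero_hom U V; apply: idem0; first by hm.
by rewrite -(add_tensl f hz hz) zero_add.
Qed.
Lemma tens0r U V X Y f : f ∈ X ⟶ Y -> f ⊗ O U V = O (X ⊠ U) (Y ⊠ V).
Proof.
move=> hf; have hz := zero_hom U V; apply: idem0; first by hm.
by rewrite -(add_tensr f hz hz) zero_add.
Qed.

Lemma zob_out U f : f ∈ zob a ⟶ U -> f = O (zob a) U.
Proof. by move=> hf; rewrite -[LHS](idrm hf) zobP (comp0r _ hf). Qed.
Lemma zobr_in U V f : f ∈ U ⟶ V ⊠ zob a -> f = O U (V ⊠ zob a).
Proof.
move=> hf; rewrite -[LHS](idlm hf) -tens_id zobP (tens0r _ _ (hom_id V)).
exact: comp0l hf.
Qed.

Lemma dualm0 U V : dualm (O U V) = O V^∨ U^∨.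
Proof.
rewrite (dualmE S_sym (zero_hom U V)) /transp.
rewrite (tens0r _ _ (hom_id V^∨)) (comp0r _ (hom_ev V)) (tens0l _ _ (hom_id U^∨)).
by rewrite otens_1l; apply: comp0l; hm.
Qed.

Lemma dualm_add U V f g : f ∈ U ⟶ V -> g ∈ U ⟶ V ->
  dualm (f +' g) = dualm f +' dualm g.
Proof.
move=> hf hg; have hfg := add_hom hf hg; have df := dualm_hom S_sym hf;
  have dg := dualm_hom S_sym hg.
apply: (@ev_inj S S_sym V^∨ U); [exact: dualm_hom|exact: add_hom|].
have r h : h ∈ V^∨ ⟶ U^∨ -> h ⊗ idm U ∈ V^∨ ⊠ U ⟶ U^∨ ⊠ U by move=> hh; hm.
rewrite (ev_dualm S_sym hfg) (add_tensl _ df dg) (add_compr (hom_ev U) (r _ df) (r _ dg)).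
rewrite (ev_dualm S_sym hf) (ev_dualm S_sym hg) (add_tensr _ hf hg).
by apply: (add_compr (hom_ev V)); hm.
Qed.

Section Mods.
Context (H : hopf_alg S).
Local Notation ι := (idm H).
Implicit Types M N : module_data S.

Lemma add_mod M N f g : act M ∈ H ⊠ M ⟶ M -> act N ∈ H ⊠ N ⟶ N ->
  module_hom H M N f -> module_hom H M N g -> module_hom H M N (f +' g).
Proof.
move=> hM hN [hf ef] [hg eg]; split; first exact: add_hom.
rewrite (add_compl hM hf hg) (add_tensr ι hf hg) (add_compr (U := H ⊠ M) hN);
  [by rewrite ef eg|hm|hm].
Qed.

Lemma comp_mod M N (P : module_data S) f g : act M ∈ H ⊠ M ⟶ M -> act N ∈ H ⊠ N ⟶ N ->
  act P ∈ H ⊠ P ⟶ P ->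
  module_hom H M N f -> module_hom H N P g -> module_hom H M P (g ∘ f).
Proof.
move=> hM hN hP [hf ef] [hg eg]; split; first by hm.
net (ef, eg).
Qed.

Lemma id_mod M : act M ∈ H ⊠ M ⟶ M -> module_hom H M M (idm M).
Proof. by move=> hM; split; [hm | net]. Qed.

Lemma tens_mod M N M' N' f g : act M ∈ H ⊠ M ⟶ M -> act N ∈ H ⊠ N ⟶ N ->
  act M' ∈ H ⊠ M' ⟶ M' -> act N' ∈ H ⊠ N' ⟶ N' ->
  module_hom H M M' f -> module_hom H N N' g ->
  module_hom H (mod_tens H M N) (mod_tens H M' N') (f ⊗ g).
Proof.
move=> hM hN hM' hN' [hf ef] [hg eg]; split; first by mcars; hm.
rewrite !act_tensE /act2; mcars; net (ef, eg).
Qed.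

Lemma free_mod U V f : f ∈ U ⟶ V -> module_hom H (mod_free H U) (mod_free H V) (ι ⊗ f).
Proof. by move=> hf; split; [mcars; hm | rewrite /=; net]. Qed.

Section Sum.
Context (M N : module_data S).
Hypotheses (hM : act M ∈ H ⊠ M ⟶ M) (hN : act N ∈ H ⊠ N ⟶ N).
Local Notation MN := (mod_sum H a M N).
Local Notation B := (bsum a M N).
Local Notation i1 := (in1 a M N).
Local Notation i2 := (in2 a M N).
Local Notation p1 := (pr1 a M N).
Local Notation p2 := (pr2 a M N).
Let h1 : i1 ∈ M ⟶ B. Proof. exact: in1_hom. Qed.
Let h2 : i2 ∈ N ⟶ B. Proof. exact: in2_hom. Qed.
Let k1 : p1 ∈ B ⟶ M. Proof. exact: pr1_hom. Qed.
Let k2 : p2 ∈ B ⟶ N. Proof. exact: pr2_hom. Qed.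

Lemma sum_act_hom : act MN ∈ H ⊠ MN ⟶ MN.
Proof. by rewrite /=; apply: add_hom; hm. Qed.

Lemma in1_mod : module_hom H M MN i1.
Proof.
split=> //; have z := zero_hom N M; have z' := zero_hom M N.
rewrite [act MN]/(_ +' _) (@add_compl (H ⊠ M) (H ⊠ B) B); [|hm|hm|hm].
have -> : i2 ∘ act N ∘ (ι ⊗ p2) ∘ (ι ⊗ i1) = O (H ⊠ M) B.
  transitivity (i2 ∘ act N ∘ (ι ⊗ (p2 ∘ i1))); first by net.
  rewrite pr2_in1 (tens0r _ _ (hom_id H)); apply: comp0r; hm.
rewrite add0r; last by hm.
have e := pr1_in1 a M N; symmetry; net e.
Qed.

Lemma in2_mod : module_hom H N MN i2.
Proof.
split=> //; have z := zero_hom N M; have z' := zero_hom M N.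
rewrite [act MN]/(_ +' _) (@add_compl (H ⊠ N) (H ⊠ B) B); [|hm|hm|hm].
have -> : i1 ∘ act M ∘ (ι ⊗ p1) ∘ (ι ⊗ i2) = O (H ⊠ N) B.
  transitivity (i1 ∘ act M ∘ (ι ⊗ (p1 ∘ i2))); first by net.
  rewrite pr1_in2 (tens0r _ _ (hom_id H)); apply: comp0r; hm.
rewrite add0l; last by hm.
have e := pr2_in2 a M N; symmetry; net e.
Qed.

Lemma pr1_mod : module_hom H MN M p1.
Proof.
split=> //.
rewrite [act MN]/(_ +' _) (@add_compr (H ⊠ B) B M); [|hm|hm|hm].
have -> : p1 ∘ (i2 ∘ act N ∘ (ι ⊗ p2)) = O (H ⊠ B) M.
  transitivity (p1 ∘ i2 ∘ act N ∘ (ι ⊗ p2)); first by net.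
  rewrite pr1_in2 (comp0l M hN); apply: comp0l; hm.
rewrite add0r; last by hm.
have e := pr1_in1 a M N; net e.
Qed.

Lemma pr2_mod : module_hom H MN N p2.
Proof.
split=> //.
rewrite [act MN]/(_ +' _) (@add_compr (H ⊠ B) B N); [|hm|hm|hm].
have -> : p2 ∘ (i1 ∘ act M ∘ (ι ⊗ p1)) = O (H ⊠ B) N.
  transitivity (p2 ∘ i1 ∘ act M ∘ (ι ⊗ p1)); first by net.
  rewrite pr2_in1 (comp0l N hM); apply: comp0l; hm.
rewrite add0l; last by hm.
have e := pr2_in2 a M N; net e.
Qed.
End Sum.

Lemma bsum_in U V W f g : f ∈ W ⟶ bsum a U V -> g ∈ W ⟶ bsum a U V ->
  pr1 a U V ∘ f = pr1 a U V ∘ g -> pr2 a U V ∘ f = pr2 a U V ∘ g -> f = g.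
Proof.
move=> hf hg e1 e2.
have h1 := in1_hom a U V; have h2 := in2_hom a U V.
have k1 := pr1_hom a U V; have k2 := pr2_hom a U V.
rewrite -[f](idlm hf) -[g](idlm hg) -!bsumP (add_compl (W := bsum a U V) hf); [|hm|hm].
rewrite (add_compl (W := bsum a U V) hg); [|hm|hm].
by rewrite -!comp_assoc; try hm; rewrite e1 e2.
Qed.
Lemma bsum_out U V W f g : f ∈ bsum a U V ⟶ W -> g ∈ bsum a U V ⟶ W ->
  f ∘ in1 a U V = g ∘ in1 a U V -> f ∘ in2 a U V = g ∘ in2 a U V -> f = g.
Proof.
move=> hf hg e1 e2.
have h1 := in1_hom a U V; have h2 := in2_hom a U V.
have k1 := pr1_hom a U V; have k2 := pr2_hom a U V.
rewrite -[f](idrm hf) -[g](idrm hg) -!bsumP (add_compr (U := bsum a U V) hf); [|hm|hm].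
rewrite (add_compr (U := bsum a U V) hg); [|hm|hm].
by rewrite !comp_assoc; try hm; rewrite e1 e2.
Qed.

Lemma mod_sum_ok M N : is_module H M -> is_module H N -> is_module H (mod_sum H a M N).
Proof.
move=> [hM mM uM] [hN mN uN].
have hs := sum_act_hom hM hN.
have [k1 e1] := pr1_mod hM hN; have [k2 e2] := pr2_mod hM hN.
set ad := act _ in hs e1 e2 *; change (mcar (mod_sum H a M N)) with (bsum a M N) in *.
split => //; change (mcar (mod_sum H a M N)) with (bsum a M N); rewrite -/ad.
- apply: (@bsum_in M N (H ⊠ H ⊠ bsum a M N)); [hm|hm| |].
  + net (e1, mM, esym e1, esym e1).
  + net (e2, mN, esym e2, esym e2).
- apply: (@bsum_in M N (bsum a M N)); [hm|hm| |].
  + net (e1, uM).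
  + net (e2, uN).
Qed.

End Mods.
End Additive.

(** * Homogeneous components in the direct sum *)

Section DS.
Context (S : ribbon) (S_sym : symmetric S) (S_twist : trivial_twist S).
Context (om : involution S) (H : hopf_alg S) (D : braiding_datum om H) (a : additive S).
Context (Ad_sig_invol : Adj H (sig D) (sigV D) ∘ Adj H (sig D) (sigV D) = idm H).
Local Notation ι := (idm H).
Local Notation DS := (DS_data D a).
Local Notation CD := (C_data D).
Local Notation "f +' g" := (aadd a f g) (at level 50, left associativity).
Local Notation O := (azero a).
Local Notation "A ⊠s B" := (DS_tensO H a A B) (at level 35, right associativity).
Implicit Types (A B C E : DS_ob S) (F G : DS_ar S) (U V X Y : ob S) (i j k d : bool).

(** Components are treated through their underlying objects and arrows in the
    base category, indicated by the suffix S. This avoids the composition of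
    graded arrows, which is meaningful only in equal degrees. *)
Definition obS A d : ob S := uob (obc A d).
Definition arS F d : ar S := if d then F.2 else F.1.
Definition okDS A : Prop := is_module H A.1.
Definition homDS A B F : Prop := forall d, arS F d ∈ obS A d ⟶ obS B d.

(** The tensor product in C of objects of degrees i and j, and of arrows. *)
Definition otensS i j X Y : ob S := if i && j then H ⊠ X ⊠ Y else X ⊠ Y.
Definition tensS i j (f g : ar S) : ar S := if i && j then ι ⊗ f ⊗ g else f ⊗ g.
Definition inS A B i j : ar S := under (inj H a (carr A) (carr B) i j).
Definition prS A B i j : ar S := under (prj H a (carr A) (carr B) i j).

Lemma obc_ok A d : okDS A -> C_isOb H (obc A d).
Proof. by case: d. Qed.

Lemma tensS_hom i j U V X Y f g : f ∈ U ⟶ V -> g ∈ X ⟶ Y ->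
  tensS i j f g ∈ otensS i j U X ⟶ otensS i j V Y.
Proof. by rewrite /tensS /otensS; case: (i && j) => hf hg; hm. Qed.

Lemma tensS_comp i j U V W X Y Z (f g f' g' : ar S) :
  f ∈ U ⟶ V -> g ∈ V ⟶ W -> f' ∈ X ⟶ Y -> g' ∈ Y ⟶ Z ->
  tensS i j (g ∘ f) (g' ∘ f') = tensS i j g g' ∘ tensS i j f f'.
Proof. by rewrite /tensS; case: (i && j) => hf hg hf' hg'; net. Qed.

Lemma tensS_idl i j U X Y Z (f g : ar S) : f ∈ X ⟶ Y -> g ∈ Y ⟶ Z ->
  tensS i j (idm U) g ∘ tensS i j (idm U) f = tensS i j (idm U) (g ∘ f).
Proof. by move=> hf hg; rewrite -(tensS_comp i j (hom_id U) (hom_id U) hf hg) comp_id. Qed.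
Lemma tensS_idr i j U X Y Z (f g : ar S) : f ∈ X ⟶ Y -> g ∈ Y ⟶ Z ->
  tensS i j g (idm U) ∘ tensS i j f (idm U) = tensS i j (g ∘ f) (idm U).
Proof. by move=> hf hg; rewrite -(tensS_comp i j hf hg (hom_id U) (hom_id U)) comp_id. Qed.

Lemma tensS_id i j U V : tensS i j (idm U) (idm V) = idm (otensS i j U V).
Proof. by rewrite /tensS /otensS; case: (i && j); rewrite ?tens_id. Qed.

Lemma tensS_0r i j U V X Y f : f ∈ U ⟶ V -> tensS i j f (O X Y) = O (otensS i j U X)
  (otensS i j V Y).
Proof.
by rewrite /tensS /otensS => hf; case: (i && j);
  rewrite (tens0r a _ _ hf) ?(tens0r a _ _ (hom_id _)).
Qed.
Lemma tensS_0l i j U V X Y f : f ∈ U ⟶ V -> tensS i j (O X Y) f = O (otensS i j X U)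
  (otensS i j Y V).
Proof.
by rewrite /tensS /otensS => hf; case: (i && j);
  rewrite (tens0l a _ _ hf) ?(tens0r a _ _ (hom_id _)).
Qed.
Lemma tensS_addr i j U V X Y f g h : f ∈ U ⟶ V -> g ∈ X ⟶ Y -> h ∈ X ⟶ Y ->
  tensS i j f (g +' h) = tensS i j f g +' tensS i j f h.
Proof.
rewrite /tensS => hf hg hh; case: (i && j); rewrite (add_tensr a f hg hh) //.
by rewrite (@add_tensr _ a (U ⊠ X) (V ⊠ Y)) //; hm.
Qed.
Lemma tensS_addl i j U V X Y f g h : f ∈ U ⟶ V -> g ∈ X ⟶ Y -> h ∈ X ⟶ Y ->
  tensS i j (g +' h) f = tensS i j g f +' tensS i j h f.
Proof.
rewrite /tensS => hf hg hh; case: (i && j); rewrite (add_tensl a f hg hh) //.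
by rewrite (@add_tensr _ a (X ⊠ U) (Y ⊠ V)) //; hm.
Qed.

Lemma inS_hom A B i j : inS A B i j ∈ otensS i j (obS A i) (obS B j) ⟶ obS (A ⊠s B) (i (+) j).
Proof. by case: i; case: j; rewrite /inS /= ; (exact: in1_hom || exact: in2_hom). Qed.
Lemma prS_hom A B i j : prS A B i j ∈ obS (A ⊠s B) (i (+) j) ⟶ otensS i j (obS A i) (obS B j).
Proof. by case: i; case: j; rewrite /prS /= ; (exact: pr1_hom || exact: pr2_hom). Qed.

Lemma prS_inS A B i j : prS A B i j ∘ inS A B i j = idm (otensS i j (obS A i) (obS B j)).
Proof. by case: i; case: j; (exact: pr1_in1 || exact: pr2_in2). Qed.
(** The two summands of one degree are told apart by the degree of the first
    factor. *)
Lemma prS_inS0 A B i j i' j' : i (+) j = i' (+) j' -> i != i' ->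
  prS A B i j ∘ inS A B i' j' = O (otensS i' j' (obS A i') (obS B j')) (otensS i j (obS A i)
    (obS B j)).
Proof.
by case: i; case: j; case: i'; case: j' => // _ _; (exact: pr1_in2 || exact: pr2_in1).
Qed.

Lemma inS_prS A B d : (inS A B false d ∘ prS A B false d) +' (inS A B true (~~ d) ∘
  prS A B true (~~ d))
  = idm (obS (A ⊠s B) d).
Proof. by case: d; exact: bsumP. Qed.

Lemma inS_epi A B d V f g : f ∈ obS (A ⊠s B) d ⟶ V -> g ∈ obS (A ⊠s B) d ⟶ V ->
  (forall i j, i (+) j = d -> f ∘ inS A B i j = g ∘ inS A B i j) -> f = g.
Proof.
by case: d => hf hg e; apply: (bsum_out hf hg);
  rewrite -?[in1 _ _ _]/(inS A B false _) -?[in2 _ _ _]/(inS A B true _);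
 (exact: (e false false) || exact: (e false true) || exact: (e true false) || exact: (e true true)).
Qed.

Lemma sum_in1 U V W x y : x ∈ U ⟶ W -> y ∈ V ⟶ W ->
  ((x ∘ pr1 a U V) +' (y ∘ pr2 a U V)) ∘ in1 a U V = x.
Proof.
move=> hx hy; have h1 := in1_hom a U V.
have k1 := pr1_hom a U V; have k2 := pr2_hom a U V.
rewrite (add_compl a (W := W) h1); [|hm|hm].
rewrite -!comp_assoc; try hm.
by rewrite pr1_in1 pr2_in1 (idrm hx) (comp0r a U hy) (add0r a hx).
Qed.
Lemma sum_in2 U V W x y : x ∈ U ⟶ W -> y ∈ V ⟶ W ->
  ((x ∘ pr1 a U V) +' (y ∘ pr2 a U V)) ∘ in2 a U V = y.
Proof.
move=> hx hy; have h1 := in2_hom a U V.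
have k1 := pr1_hom a U V; have k2 := pr2_hom a U V.
rewrite (add_compl a (W := W) h1); [|hm|hm].
rewrite -!comp_assoc; try hm.
by rewrite pr2_in2 pr1_in2 (idrm hy) (comp0r a V hx) (add0l a hy).
Qed.

(** * Tensor products of arrows of the direct sum *)

Definition glue A B (x : bool -> bool -> ar S) d : ar S :=
  (x false d ∘ prS A B false d) +' (x true (~~ d) ∘ prS A B true (~~ d)).

Lemma glue_hom A B V x d :
  (forall i j, i (+) j = d -> x i j ∈ otensS i j (obS A i) (obS B j) ⟶ V) ->
  glue A B x d ∈ obS (A ⊠s B) d ⟶ V.
Proof.
move=> hx; have h1 := hx false d erefl; have h2 := hx true (~~ d) (negbK d).
apply: add_hom; [have k := prS_hom A B false d | have k := prS_hom A B true (~~ d)];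
  rewrite /= ?negbK in k; hm.
Qed.

Lemma glue_inS A B V x i j :
  (forall i' j', i' (+) j' = i (+) j -> x i' j' ∈ otensS i' j' (obS A i') (obS B j') ⟶ V) ->
  glue A B x (i (+) j) ∘ inS A B i j = x i j.
Proof.
move=> hx; rewrite /glue.
have h1 := hx false (i (+) j) erefl; have h2 := hx true (~~ (i (+) j)) (negbK _).
move: i j hx h1 h2 => [] [] hx h1 h2; (exact: (sum_in1 h1 h2) || exact: (sum_in2 h1 h2)).
Qed.

Lemma tens_glue A A' B B' F G d : homDS A A' F -> homDS B B' G ->
  arS (DS_tensA H a F G) d = glue A B (fun i j => inS A' B' i j ∘ tensS i j (arS F i) (arS G j)) d.
Proof.
move=> hF hG.
have [f0 f0'] := hF false; have [f1 f1'] := hF true.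
have [g0 g0'] := hG false; have [g1 g1'] := hG true.
rewrite /= in f0 f0' f1 f1' g0 g0' g1 g1'.
have e1 : (dom F.1, dom F.2) = carr A by rewrite f0 f1.
have e2 : (dom G.1, dom G.2) = carr B by rewrite g0 g1.
have e3 : (cod F.1, cod F.2) = carr A' by rewrite f0' f1'.
have e4 : (cod G.1, cod G.2) = carr B' by rewrite g0' g1'.
by case: d; rewrite /DS_tensA e1 e2 e3 e4.
Qed.

Lemma tens_block_hom A A' B B' F G i j : homDS A A' F -> homDS B B' G ->
  inS A' B' i j ∘ tensS i j (arS F i) (arS G j) ∈
    otensS i j (obS A i) (obS B j) ⟶ obS (A' ⊠s B') (i (+) j).
Proof.
move=> hF hG; have h1 := hF i; have h2 := hG j; have h3 := tensS_hom i j h1 h2.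
have h4 := inS_hom A' B' i j; hm.
Qed.

Lemma tens_hom A A' B B' F G : homDS A A' F -> homDS B B' G ->
  homDS (A ⊠s B) (A' ⊠s B') (DS_tensA H a F G).
Proof.
move=> hF hG d; rewrite (tens_glue d hF hG); apply: glue_hom => i j <-.
exact: tens_block_hom.
Qed.

Lemma tens_inS A A' B B' F G i j : homDS A A' F -> homDS B B' G ->
  arS (DS_tensA H a F G) (i (+) j) ∘ inS A B i j =
  inS A' B' i j ∘ tensS i j (arS F i) (arS G j).
Proof.
move=> hF hG; rewrite (tens_glue _ hF hG).
apply: (@glue_inS A B (obS (A' ⊠s B') (i (+) j)) (fun i j => inS A' B' i j ∘ tensS i j (arS F i)
  (arS G j))).
by move=> i' j' <-; exact: tens_block_hom.
Qed.

(** * Associativity in the direct sum *)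

(** The summands of the two threefold tensor products, with their inclusions
    and projections; the suffix r or l tells which factors are bracketed. *)
Definition in3r A B C i j k := inS A (B ⊠s C) i (j (+) k) ∘ tensS i (j (+) k) (idm (obS A i))
  (inS B C j k).
Definition pr3r A B C i j k := tensS i (j (+) k) (idm (obS A i)) (prS B C j k) ∘
  prS A (B ⊠s C) i (j (+) k).
Definition in3l A B C i j k := inS (A ⊠s B) C (i (+) j) k ∘ tensS (i (+) j) k (inS A B i j)
  (idm (obS C k)).
Definition pr3l A B C i j k := tensS (i (+) j) k (prS A B i j) (idm (obS C k)) ∘
  prS (A ⊠s B) C (i (+) j) k.
Definition ot3r A B C i j k := otensS i (j (+) k) (obS A i) (otensS j k (obS B j) (obS C k)).
Definition ot3l A B C i j k := otensS (i (+) j) k (otensS i j (obS A i) (obS B j)) (obS C k).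

Lemma in3r_hom A B C i j k : in3r A B C i j k ∈ ot3r A B C i j k ⟶ obS (A ⊠s B ⊠s C) (i (+)
  (j (+) k)).
Proof.
have h1 := inS_hom B C j k; have h2 := inS_hom A (B ⊠s C) i (j (+) k).
have h3 := tensS_hom i (j (+) k) (hom_id (obS A i)) h1; rewrite /in3r; hm.
Qed.
Lemma pr3r_hom A B C i j k : pr3r A B C i j k ∈ obS (A ⊠s B ⊠s C) (i (+)
  (j (+) k)) ⟶ ot3r A B C i j k.
Proof.
have h1 := prS_hom B C j k; have h2 := prS_hom A (B ⊠s C) i (j (+) k).
have h3 := tensS_hom i (j (+) k) (hom_id (obS A i)) h1; rewrite /pr3r; hm.
Qed.
Lemma in3l_hom A B C i j k : in3l A B C i j k ∈ ot3l A B C i j k ⟶ obS ((A ⊠s B) ⊠s C) ((i (+) j)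
  (+) k).
Proof.
have h1 := inS_hom A B i j; have h2 := inS_hom (A ⊠s B) C (i (+) j) k.
have h3 := tensS_hom (i (+) j) k h1 (hom_id (obS C k)); rewrite /in3l; hm.
Qed.
Lemma pr3l_hom A B C i j k : pr3l A B C i j k ∈ obS ((A ⊠s B) ⊠s C) ((i (+) j)
  (+) k) ⟶ ot3l A B C i j k.
Proof.
have h1 := prS_hom A B i j; have h2 := prS_hom (A ⊠s B) C (i (+) j) k.
have h3 := tensS_hom (i (+) j) k h1 (hom_id (obS C k)); rewrite /pr3l; hm.
Qed.

Lemma pr3r_in3r A B C i j k i' j' k' : i (+) (j (+) k) = i' (+) (j' (+) k') ->
  pr3r A B C i j k ∘ in3r A B C i' j' k' =
  if [&& i == i', j == j' & k == k'] then idm (ot3r A B C i j k)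
  else O (ot3r A B C i' j' k') (ot3r A B C i j k).
Proof.
move=> e; rewrite /pr3r /in3r.
have h1 := inS_hom B C j' k'; have h2 := inS_hom A (B ⊠s C) i' (j' (+) k').
have h3 := tensS_hom i' (j' (+) k') (hom_id (obS A i')) h1.
have k1 := prS_hom B C j k; have k2 := prS_hom A (B ⊠s C) i (j (+) k).
have k3 := tensS_hom i (j (+) k) (hom_id (obS A i)) k1.
rewrite e in k2.
transitivity (tensS i (j (+) k) (idm (obS A i)) (prS B C j k) ∘
  (prS A (B ⊠s C) i (j (+) k) ∘ inS A (B ⊠s C) i' (j' (+) k')) ∘
  tensS i' (j' (+) k') (idm (obS A i')) (inS B C j' k')).
  by rewrite -!comp_assoc //; hm.
case: (i =P i') e k2 => [<-{i' h2 h3}|ii'] e k2; last first.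
  rewrite prS_inS0 //; last by apply/eqP.
  rewrite (comp0r a _ k3); exact: comp0l.
have {}e : j (+) k = j' (+) k' by move/addbI: e.
rewrite -e in h1 *; rewrite prS_inS (idrm k3) (tensS_idl _ _ _ h1 k1).
case: (j =P j') e h1 => [<-|jj'] e h1; last first.
  rewrite prS_inS0 //; last by apply/eqP.
  by rewrite (tensS_0r _ _ _ _ (hom_id _)) /ot3r e.
move/addbI: e h1 => <- _.
by rewrite !eqxx prS_inS tensS_id.
Qed.

Lemma pr3l_in3l A B C i j k i' j' k' : (i (+) j) (+) k = (i' (+) j') (+) k' ->
  pr3l A B C i j k ∘ in3l A B C i' j' k' =
  if [&& i == i', j == j' & k == k'] then idm (ot3l A B C i j k)
  else O (ot3l A B C i' j' k') (ot3l A B C i j k).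
Proof.
move=> e; rewrite /pr3l /in3l.
have h1 := inS_hom A B i' j'; have h2 := inS_hom (A ⊠s B) C (i' (+) j') k'.
have h3 := tensS_hom (i' (+) j') k' h1 (hom_id (obS C k')).
have k1 := prS_hom A B i j; have k2 := prS_hom (A ⊠s B) C (i (+) j) k.
have k3 := tensS_hom (i (+) j) k k1 (hom_id (obS C k)).
rewrite e in k2.
transitivity (tensS (i (+) j) k (prS A B i j) (idm (obS C k)) ∘
  (prS (A ⊠s B) C (i (+) j) k ∘ inS (A ⊠s B) C (i' (+) j') k') ∘
  tensS (i' (+) j') k' (inS A B i' j') (idm (obS C k'))).
  by rewrite -!comp_assoc //; hm.
case: (i (+) j =P i' (+) j') => [eij|ij]; last first.
  rewrite prS_inS0 //; last by apply/eqP.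
  rewrite (comp0r a _ k3) (comp0l a _ h3).
  case: (i =P i') ij => // <-; case: (j =P j') => // <- [] //.
have ek : k = k' by move: e; rewrite eij => /addbI.
subst k'; rewrite -eij in h1 *; rewrite prS_inS (idrm k3) (tensS_idr _ _ _ h1 k1).
case: (i =P i') eij h1 => [<-|ne] eij h1; last first.
  rewrite prS_inS0 //; last by apply/eqP.
  by rewrite (tensS_0l _ _ _ _ (hom_id _)) /ot3l eij.
move/addbI: eij h1 => <- _.
by rewrite !eqxx prS_inS tensS_id.
Qed.

Definition sum3 (x : bool -> bool -> bool -> ar S) d : ar S :=
  if d then
    ((x false false true) +' (x false true false)) +'
    ((x true false false) +' (x true true true))
  else
    ((x false false false) +' (x false true true)) +'
    ((x true false true) +' (x true true false)).

Lemma sum3_hom U V x d : (forall i j k, (i (+) j) (+) k = d -> x i j k ∈ U ⟶ V) ->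
  sum3 x d ∈ U ⟶ V.
Proof. by case: d => h; do !apply: add_hom; apply: h. Qed.

Lemma sum3_sel U V W x f i j k :
  (forall i' j' k', (i' (+) j') (+) k' = (i (+) j) (+) k -> x i' j' k' ∈ U ⟶ V) ->
  f ∈ W ⟶ U ->
  (forall i' j' k', (i' (+) j') (+) k' = (i (+) j) (+) k -> (i', j', k') != (i, j, k) ->
     x i' j' k' ∘ f = O W V) ->
  sum3 x ((i (+) j) (+) k) ∘ f = x i j k ∘ f.
Proof.
move=> hx hf h0.
have cx i' j' k' : (i' (+) j') (+) k' = (i (+) j) (+) k -> x i' j' k' ∘ f ∈ W ⟶ V.
  by move/hx => h; hm.
move: i j k hx h0 cx => [] [] [] hx h0 cx; rewrite /sum3 /=;
  rewrite (add_compl a (V := U) (W := V) hf); try (by apply: add_hom; apply: hx);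
  rewrite !(add_compl a (V := U) (W := V) hf); try (by apply: hx);
  try rewrite (h0 false false false erefl isT); try rewrite (h0 true true false erefl isT);
  try rewrite (h0 true false true erefl isT); try rewrite (h0 false true true erefl isT);
  try rewrite (h0 true true true erefl isT); try rewrite (h0 false false true erefl isT);
  try rewrite (h0 false true false erefl isT); try rewrite (h0 true false false erefl isT);
  rewrite ?(zero_add a) ?(add0r a (U := W) (V := V)) ?(add0l a (U := W) (V := V)) //; by apply: cx.
Qed.

(** The associativity isomorphism and its inverse are sums of blocks; an
    inclusion annihilates all blocks but one. *)
Lemma sum3_block U V (X Y : bool -> bool -> bool -> ob S) l m p n i j k :
  (forall i' j' k', (i' (+) j') (+) k' = (i (+) j) (+) k ->
    [/\ l i' j' k' ∈ Y i' j' k' ⟶ V, m i' j' k' ∈ X i' j' k' ⟶ Y i' j' k',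
        p i' j' k' ∈ U ⟶ X i' j' k' &
        p i' j' k' ∘ n = if [&& i' == i, j' == j & k' == k] then idm (X i' j' k')
                         else O (X i j k) (X i' j' k')]) ->
  n ∈ X i j k ⟶ U ->
  sum3 (fun i j k => l i j k ∘ m i j k ∘ p i j k) ((i (+) j) (+) k) ∘ n = l i j k ∘ m i j k.
Proof.
move=> h hn; have [hl hm_ _ e] := h i j k erefl; rewrite !eqxx in e.
have c i' j' k' : (i' (+) j') (+) k' = (i (+) j) (+) k ->
  (l i' j' k' ∘ m i' j' k' ∘ p i' j' k') ∘ n = (l i' j' k' ∘ m i' j' k') ∘ (p i' j' k' ∘ n).
  by case/h => h1 h2 h3 _; rewrite -comp_assoc //; hm.
rewrite (@sum3_sel U V (X i j k)) //.
- by rewrite c // e (idrm (hom_comp hm_ hl erefl)).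
- by move=> i' j' k' /h [h1 h2 h3 _]; hm.
move=> i' j' k' d ne; rewrite c //; have [h1 h2 _ ->] := h _ _ _ d.
rewrite (_ : [&& i' == i, j' == j & k' == k] = false).
  exact: comp0r (hom_comp h2 h1 erefl).
by apply: negbTE; apply: contra ne => /and3P [/eqP -> /eqP -> /eqP ->].
Qed.

Definition alphaS A B C i j k : ar S := under (C_assoc D (obc A i) (obc B j) (obc C k)).
Definition alphaVS A B C i j k : ar S := under (C_assocV D (obc A i) (obc B j) (obc C k)).

Lemma alphaS_hom A B C i j k : okDS A -> okDS B -> okDS C ->
  alphaS A B C i j k ∈ ot3r A B C i j k ⟶ ot3l A B C i j k.
Proof.
move=> hA hB hC.
have := C_assoc_typed S_sym D (obc_ok i hA) (obc_ok j hB) (obc_ok k hC).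
by case: i; case: j; case: k.
Qed.
Lemma alphaVS_hom A B C i j k : okDS A -> okDS B -> okDS C ->
  alphaVS A B C i j k ∈ ot3l A B C i j k ⟶ ot3r A B C i j k.
Proof.
move=> hA hB hC.
have := C_assocV_typed D (obc_ok i hA) (obc_ok j hB) (obc_ok k hC).
by case: i; case: j; case: k.
Qed.
Lemma alphaSK A B C i j k : okDS A -> okDS B -> okDS C ->
  alphaVS A B C i j k ∘ alphaS A B C i j k = idm (ot3r A B C i j k).
Proof.
move=> hA hB hC.
have := C_assocK S_sym D (obc_ok i hA) (obc_ok j hB) (obc_ok k hC).
by case: i; case: j; case: k => -[].
Qed.
Lemma alphaVSK A B C i j k : okDS A -> okDS B -> okDS C ->
  alphaS A B C i j k ∘ alphaVS A B C i j k = idm (ot3l A B C i j k).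
Proof.
move=> hA hB hC.
have := C_assocVK S_sym Ad_sig_invol (obc_ok i hA) (obc_ok j hB) (obc_ok k hC).
by case: i; case: j; case: k => -[].
Qed.

Definition DS_assocV A B C : DS_ar S :=
  let x i j k := in3r A B C i j k ∘ alphaVS A B C i j k ∘ pr3l A B C i j k in
  (sum3 x false, sum3 x true).

Section Triple.
Context (A B C : DS_ob S) (hA : okDS A) (hB : okDS B) (hC : okDS C).

Lemma assoc_block_hom i j k : in3l A B C i j k ∘ alphaS A B C i j k ∘ pr3r A B C i j k ∈
  obS (A ⊠s B ⊠s C) ((i (+) j) (+) k) ⟶ obS ((A ⊠s B) ⊠s C) ((i (+) j) (+) k).
Proof.
have h1 := in3l_hom A B C i j k; have h2 := alphaS_hom i j k hA hB hC.
have h3 := pr3r_hom A B C i j k; rewrite addbA in h3; hm.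
Qed.
Lemma assocV_block_hom i j k : in3r A B C i j k ∘ alphaVS A B C i j k ∘ pr3l A B C i j k ∈
  obS ((A ⊠s B) ⊠s C) ((i (+) j) (+) k) ⟶ obS (A ⊠s B ⊠s C) ((i (+) j) (+) k).
Proof.
have h1 := in3r_hom A B C i j k; have h2 := alphaVS_hom i j k hA hB hC.
have h3 := pr3l_hom A B C i j k; rewrite addbA in h1; hm.
Qed.

Lemma assocE d : arS (DS_assoc D a A B C) d =
  sum3 (fun i j k => in3l A B C i j k ∘ alphaS A B C i j k ∘ pr3r A B C i j k) d.
Proof.
have e i j k : in3l A B C i j k ∘ alphaS A B C i j k ∘ pr3r A B C i j k =
  inS (A ⊠s B) C (i (+) j) k ∘ tensS (i (+) j) k (inS A B i j) (idm (obS C k)) ∘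
    alphaS A B C i j k ∘
  tensS i (j (+) k) (idm (obS A i)) (prS B C j k) ∘ prS A (B ⊠s C) i (j (+) k).
  rewrite /pr3r comp_assoc //.
  - have k1 := prS_hom B C j k; have k2 := prS_hom A (B ⊠s C) i (j (+) k).
    by have k3 := tensS_hom i (j (+) k) (hom_id (obS A i)) k1; hm.
  - have k1 := prS_hom B C j k; have k3 := tensS_hom i (j (+) k) (hom_id (obS A i)) k1.
    by have h1 := in3l_hom A B C i j k; have h2 := alphaS_hom i j k hA hB hC; hm.
by case: d; rewrite /sum3 !e.
Qed.

Lemma assoc_hom : homDS (A ⊠s B ⊠s C) ((A ⊠s B) ⊠s C) (DS_assoc D a A B C).
Proof.
by move=> d; rewrite assocE; apply: sum3_hom => i j k <-; exact: assoc_block_hom.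
Qed.
Lemma assocV_hom : homDS ((A ⊠s B) ⊠s C) (A ⊠s B ⊠s C) (DS_assocV A B C).
Proof.
move=> d; have -> : arS (DS_assocV A B C) d = sum3
  (fun i j k => in3r A B C i j k ∘ alphaVS A B C i j k ∘ pr3l A B C i j k) d by case: d.
by apply: sum3_hom => i j k <-; exact: assocV_block_hom.
Qed.

Lemma assoc_inS i j k : arS (DS_assoc D a A B C) ((i (+) j) (+) k) ∘ in3r A B C i j k =
  in3l A B C i j k ∘ alphaS A B C i j k.
Proof.
rewrite assocE; apply: (@sum3_block (obS (A ⊠s B ⊠s C) ((i (+) j) (+) k))
  (obS ((A ⊠s B) ⊠s C) ((i (+) j) (+) k)) (ot3r A B C) (ot3l A B C)); last first.
  by have := in3r_hom A B C i j k; rewrite addbA.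
move=> i' j' k' e; split; [|exact: alphaS_hom| |].
- by have := in3l_hom A B C i' j' k'; rewrite e.
- by have := pr3r_hom A B C i' j' k'; rewrite addbA e.
by apply: pr3r_in3r; rewrite !addbA.
Qed.

Lemma assocV_inS i j k : arS (DS_assocV A B C) ((i (+) j) (+) k) ∘ in3l A B C i j k =
  in3r A B C i j k ∘ alphaVS A B C i j k.
Proof.
have -> : arS (DS_assocV A B C) ((i (+) j) (+) k) = sum3
  (fun i j k => in3r A B C i j k ∘ alphaVS A B C i j k ∘ pr3l A B C i j k) ((i (+) j) (+) k).
  by rewrite /arS; case: (_ (+) k).
apply: (@sum3_block (obS ((A ⊠s B) ⊠s C) ((i (+) j) (+) k))
  (obS (A ⊠s B ⊠s C) ((i (+) j) (+) k)) (ot3l A B C) (ot3r A B C)); last exact: in3l_hom.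
move=> i' j' k' e; split; [|exact: alphaVS_hom| |exact: pr3l_in3l].
- by have := in3r_hom A B C i' j' k'; rewrite addbA e.
- by have := pr3l_hom A B C i' j' k'; rewrite e.
Qed.
End Triple.

(** * Linearity and inverses in the direct sum *)

Local Notation homC P Q d f := (@isHom CD P Q (mkc d f)).

Lemma ok_act P : C_isOb H P -> match P with Ob0 M => act M ∈ H ⊠ M ⟶ M | Ob1 _ => True end.
Proof. by case: P => //= M []. Qed.

Lemma homC_comp P Q R d f g : C_isOb H P -> C_isOb H Q -> C_isOb H R ->
  homC P Q d f -> homC Q R d g -> homC P R d (g ∘ f).
Proof.
move=> /ok_act hP /ok_act hQ /ok_act hR.
case: P Q R d hP hQ hR => [P|P] [Q|Q] [R|R] [] //= hP hQ hR hf hg; last by hm.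
exact: comp_mod hP hQ hR hf hg.
Qed.

Lemma homC_add P Q d f g : C_isOb H P -> C_isOb H Q ->
  homC P Q d f -> homC P Q d g -> homC P Q d (f +' g).
Proof.
move=> /ok_act hP /ok_act hQ.
case: P Q d hP hQ => [P|P] [Q|Q] [] //= hP hQ hf hg; last exact: add_hom.
exact: add_mod.
Qed.

Lemma homC_id A d : okDS A -> homC (obc A d) (obc A d) d (idm (obS A d)).
Proof. by case: d => //= [|[hA _ _]]; [move=> _; exact: hom_id | exact: id_mod]. Qed.

(** Arrows of degree one carry no condition, so linearity is inherited from the
    free module in the product of two of them. *)
Lemma homC_tensS P P' Q Q' i j f g : C_isOb H P -> C_isOb H P' -> C_isOb H Q -> C_isOb H Q' ->
  homC P P' i f -> homC Q Q' j g ->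
  homC (C_tensO H P Q) (C_tensO H P' Q') (i (+) j) (tensS i j f g).
Proof.
move=> /ok_act hP /ok_act hP' /ok_act hQ /ok_act hQ'.
case: P P' Q Q' i j hP hP' hQ hQ' => [P|P] [P'|P'] [Q|Q] [Q'|Q'] [] [] //= hP hP' hQ hQ' hf hg.
- exact: tens_mod.
- case: hf => hf _; exact: (tensS_hom false true hf hg).
- case: hg => hg _; exact: (tensS_hom true false hf hg).
- by apply: free_mod => //; hm.
Qed.

Lemma tensD_ok A B : okDS A -> okDS B -> okDS (A ⊠s B).
Proof.
move=> hA hB; apply: mod_sum_ok => //; [exact: mod_tens_ok | exact: mod_free_ok].
Qed.
Lemma dualD_ok A : okDS A -> okDS (DS_dual H A).
Proof. exact: mod_dual_ok. Qed.

Lemma homC_inS A B i j : okDS A -> okDS B ->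
  homC (C_tensO H (obc A i) (obc B j)) (obc (A ⊠s B) (i (+) j)) (i (+) j) (inS A B i j).
Proof.
move=> hA hB; have [h1 _ _] := mod_tens_ok S_sym hA hB;
  have [h2 _ _] := mod_free_ok S_sym H (A.2 ⊠ B.2).
case: i; case: j.
- exact: in2_mod h1 h2.
- exact: in2_hom.
- exact: in1_hom.
- exact: in1_mod h1 h2.
Qed.
Lemma homC_prS A B i j : okDS A -> okDS B ->
  homC (obc (A ⊠s B) (i (+) j)) (C_tensO H (obc A i) (obc B j)) (i (+) j) (prS A B i j).
Proof.
move=> hA hB; have [h1 _ _] := mod_tens_ok S_sym hA hB;
  have [h2 _ _] := mod_free_ok S_sym H (A.2 ⊠ B.2).
case: i; case: j.
- exact: pr2_mod h1 h2.
- exact: pr2_hom.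
- exact: pr1_hom.
- exact: pr1_mod h1 h2.
Qed.

Lemma assocV_block_mod A B C i j k : okDS A -> okDS B -> okDS C ->
  homC (obc ((A ⊠s B) ⊠s C) ((i (+) j) (+) k)) (obc (A ⊠s B ⊠s C) ((i (+) j) (+) k))
    ((i (+) j) (+) k) (in3r A B C i j k ∘ alphaVS A B C i j k ∘ pr3l A B C i j k).
Proof.
move=> hA hB hC.
have hAB := tensD_ok hA hB; have hBC := tensD_ok hB hC.
have hAi := obc_ok i hA; have hBj := obc_ok j hB; have hCk := obc_ok k hC.
have o1 := C_tens_ok S_sym (C_tens_ok S_sym hAi hBj) hCk.
have o2' := C_tens_ok S_sym hAi (C_tens_ok S_sym hBj hCk).
have o3 := C_tens_ok S_sym hAi (obc_ok (j (+) k) hBC).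
have o4 := C_tens_ok S_sym (obc_ok (i (+) j) hAB) hCk.
have o5 := obc_ok ((i (+) j) (+) k) (tensD_ok hAB hC).
have o6 := obc_ok ((i (+) j) (+) k) (tensD_ok hA hBC).
apply: (homC_comp o5 o1 o6); last first.
  apply: (homC_comp o1 o2' o6).
    have [h _ _] := C_assoc_inv S_sym Ad_sig_invol hAi hBj hCk.
    by move: h {o1 o2' o3 o4 o5 o6 hAi hBj hCk}; rewrite /alphaVS; case: i; case: j; case: k.
  apply: (homC_comp o2' o3 o6).
    rewrite -addbA; apply: homC_tensS => //;
      [exact: C_tens_ok|exact: obc_ok|exact: homC_id|exact: homC_inS].
  by rewrite -addbA; exact: homC_inS.
apply: (homC_comp o5 o4 o1); first exact: homC_prS.
by apply: homC_tensS => //; [exact: obc_ok|exact: C_tens_ok|exact: homC_prS|exact: homC_id].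
Qed.

Lemma assocV_mod A B C : okDS A -> okDS B -> okDS C ->
  module_hom H ((A ⊠s B) ⊠s C).1 (A ⊠s B ⊠s C).1 (DS_assocV A B C).1.
Proof.
move=> hA hB hC.
have o5 := obc_ok false (tensD_ok (tensD_ok hA hB) hC).
have o6 := obc_ok false (tensD_ok hA (tensD_ok hB hC)).
have h i j k := assocV_block_mod i j k hA hB hC.
apply: (homC_add (d := false) o5 o6); apply: (homC_add (d := false) o5 o6).
- exact: (h false false false).
- exact: (h false true true).
- exact: (h true false true).
- exact: (h true true false).
Qed.

(** The tensor product is additive, hence preserves the decomposition of its
    second factor. *)
Lemma tensS_epir B C i m X V f g : f ∈ otensS i m X (obS (B ⊠s C) m) ⟶ V ->
  g ∈ otensS i m X (obS (B ⊠s C) m) ⟶ V ->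
  (forall j k, j (+) k = m ->
     f ∘ tensS i m (idm X) (inS B C j k) = g ∘ tensS i m (idm X) (inS B C j k)) -> f = g.
Proof.
move=> hf hg e.
have h1 j : inS B C j (j (+) m) ∈ otensS j (j (+) m) (obS B j) (obS C (j (+) m)) ⟶ obS (B ⊠s C) m.
  by have := inS_hom B C j (j (+) m); rewrite addKb.
have k1 j : prS B C j (j (+) m) ∈ obS (B ⊠s C) m ⟶ otensS j (j (+) m) (obS B j) (obS C (j (+) m)).
  by have := prS_hom B C j (j (+) m); rewrite addKb.
have H1 j := tensS_hom i m (hom_id X) (h1 j); have K1 j := tensS_hom i m (hom_id X) (k1 j).
have c j : inS B C j (j (+) m) ∘ prS B C j (j (+) m) ∈ obS (B ⊠s C) m ⟶ obS (B ⊠s C) m.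
  by have a1 := h1 j; have a2 := k1 j; hm.
have E : idm (otensS i m X (obS (B ⊠s C) m)) =
   (tensS i m (idm X) (inS B C false (false (+) m)) ∘ tensS i m (idm X)
     (prS B C false (false (+) m)))
   +' (tensS i m (idm X) (inS B C true (true (+) m)) ∘ tensS i m (idm X)
     (prS B C true (true (+) m))).
  rewrite -tensS_id -inS_prS (tensS_addr _ _ (hom_id X) (c false) (c true)).
  by rewrite (tensS_idl _ _ _ (k1 false) (h1 false)) (tensS_idl _ _ _ (k1 true) (h1 true)).
have C1 j := hom_comp (K1 j) (H1 j) erefl.
rewrite -(idrm hf) -(idrm hg) E (add_compr a hf (C1 false) (C1 true)) (add_compr a hg (C1 false)
  (C1 true)).
have q j x : x ∈ otensS i m X (obS (B ⊠s C) m) ⟶ V ->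
  x ∘ (tensS i m (idm X) (inS B C j (j (+) m)) ∘ tensS i m (idm X) (prS B C j (j (+) m))) =
  x ∘ tensS i m (idm X) (inS B C j (j (+) m)) ∘ tensS i m (idm X) (prS B C j (j (+) m)).
  by move=> hx; have a1 := H1 j; have a2 := K1 j; rewrite comp_assoc //; hm.
by rewrite !q // !e // addKb.
Qed.

Lemma tensS_epil A B m k X V f g : f ∈ otensS m k (obS (A ⊠s B) m) X ⟶ V ->
  g ∈ otensS m k (obS (A ⊠s B) m) X ⟶ V ->
  (forall i j, i (+) j = m ->
     f ∘ tensS m k (inS A B i j) (idm X) = g ∘ tensS m k (inS A B i j) (idm X)) -> f = g.
Proof.
move=> hf hg e.
have h1 j : inS A B j (j (+) m) ∈ otensS j (j (+) m) (obS A j) (obS B (j (+) m)) ⟶ obS (A ⊠s B) m.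
  by have := inS_hom A B j (j (+) m); rewrite addKb.
have k1 j : prS A B j (j (+) m) ∈ obS (A ⊠s B) m ⟶ otensS j (j (+) m) (obS A j) (obS B (j (+) m)).
  by have := prS_hom A B j (j (+) m); rewrite addKb.
have H1 j := tensS_hom m k (h1 j) (hom_id X); have K1 j := tensS_hom m k (k1 j) (hom_id X).
have c j : inS A B j (j (+) m) ∘ prS A B j (j (+) m) ∈ obS (A ⊠s B) m ⟶ obS (A ⊠s B) m.
  by have a1 := h1 j; have a2 := k1 j; hm.
have E : idm (otensS m k (obS (A ⊠s B) m) X) =
   (tensS m k (inS A B false (false (+) m)) (idm X) ∘ tensS m k (prS A B false (false (+) m))
     (idm X))
   +' (tensS m k (inS A B true (true (+) m)) (idm X) ∘ tensS m k (prS A B true (true (+) m))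
     (idm X)).
  rewrite -tensS_id -inS_prS (tensS_addl _ _ (hom_id X) (c false) (c true)).
  by rewrite (tensS_idr _ _ _ (k1 false) (h1 false)) (tensS_idr _ _ _ (k1 true) (h1 true)).
have C1 j := hom_comp (K1 j) (H1 j) erefl.
rewrite -(idrm hf) -(idrm hg) E (add_compr a hf (C1 false) (C1 true)) (add_compr a hg (C1 false)
  (C1 true)).
have q j x : x ∈ otensS m k (obS (A ⊠s B) m) X ⟶ V ->
  x ∘ (tensS m k (inS A B j (j (+) m)) (idm X) ∘ tensS m k (prS A B j (j (+) m)) (idm X)) =
  x ∘ tensS m k (inS A B j (j (+) m)) (idm X) ∘ tensS m k (prS A B j (j (+) m)) (idm X).
  by move=> hx; have a1 := H1 j; have a2 := K1 j; rewrite comp_assoc //; hm.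
by rewrite !q // !e // addKb.
Qed.

Lemma in3r_epi A B C d V f g : f ∈ obS (A ⊠s B ⊠s C) d ⟶ V -> g ∈ obS (A ⊠s B ⊠s C) d ⟶ V ->
  (forall i j k, (i (+) j) (+) k = d -> f ∘ in3r A B C i j k = g ∘ in3r A B C i j k) -> f = g.
Proof.
move=> hf hg e; apply: (inS_epi hf hg) => i m im.
have h1 := inS_hom A (B ⊠s C) i m; rewrite im in h1.
apply: (@tensS_epir B C i m (obS A i) V); [hm|hm|].
move=> j k jk; have := e i j k; rewrite /in3r -addbA jk im => /(_ erefl).
have h2 := inS_hom B C j k; rewrite jk in h2; have h3 := tensS_hom i m (hom_id (obS A i)) h2.
by rewrite !comp_assoc //; hm.
Qed.

Lemma in3l_epi A B C d V f g : f ∈ obS ((A ⊠s B) ⊠s C) d ⟶ V -> g ∈ obS ((A ⊠s B) ⊠s C) d ⟶ V ->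
  (forall i j k, (i (+) j) (+) k = d -> f ∘ in3l A B C i j k = g ∘ in3l A B C i j k) -> f = g.
Proof.
move=> hf hg e; apply: (inS_epi hf hg) => m k mk.
have h1 := inS_hom (A ⊠s B) C m k; rewrite mk in h1.
apply: (@tensS_epil A B m k (obS C k) V); [hm|hm|].
move=> i j ij; have := e i j k; rewrite /in3l ij mk => /(_ erefl).
have h2 := inS_hom A B i j; rewrite ij in h2; have h3 := tensS_hom m k h2 (hom_id (obS C k)).
by rewrite !comp_assoc //; hm.
Qed.

(** Inverses can be tested degree by degree; linearity of the inverse is what
    has to be added. *)
Definition inverse_of A B F G : Prop :=
  [/\ @isHom DS B A G, homDS A B F, forall d, arS G d ∘ arS F d = idm (obS A d) &
      forall d, arS F d ∘ arS G d = idm (obS B d)].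

Lemma DS_hom_homDS A B F : @isHom DS A B F -> homDS A B F.
Proof. by case=> -[h1 _] h2 [|]. Qed.

Lemma DS_inv_eq A B F G : inverse_of A B F G -> inv (C := DS) A B F = G.
Proof.
case=> hG hF e1 e2; apply: inv_eq.
  split=> //; first by case: G F e1 {hG hF e2} => [g0 g1] [f0 f1] e; congr pair;
    [exact: (e false)|exact: (e true)].
  by case: G F e2 {hG hF e1} => [g0 g1] [f0 f1] e; congr pair; [exact: (e false)|exact: (e true)].
move=> K [/DS_hom_homDS hK k1 _]; have {}hG := DS_hom_homDS hG.
case: K k1 hK => [k0 k1']; case: F hF e1 e2 => [f0 f1] hF _ e2 [ke0 ke1] hK.
case: G hG e2 => [g0 g1] hG e2; congr pair.
  exact: (two_inv S_sym (hF false) (hG false) (hK false) ke0 (e2 false)).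
exact: (two_inv S_sym (hF true) (hG true) (hK true) ke1 (e2 true)).
Qed.

Lemma assoc_invE A B C : okDS A -> okDS B -> okDS C ->
  inv (C := DS) (A ⊠s B ⊠s C) ((A ⊠s B) ⊠s C) (DS_assoc D a A B C) = DS_assocV A B C.
Proof.
move=> hA hB hC; apply: DS_inv_eq.
have h := assoc_hom hA hB hC; have h' := assocV_hom hA hB hC.
split => //.
- by split; [exact: assocV_mod | exact: (h' true)].
- move=> d; have hd := h d; have hd' := h' d.
  apply: (@in3r_epi A B C d (obS (A ⊠s B ⊠s C) d)); [hm|hm|].
  move=> i j k e; have h1 := in3r_hom A B C i j k; have h2 := in3l_hom A B C i j k.
  have h3 := alphaS_hom i j k hA hB hC; have h4 := alphaVS_hom i j k hA hB hC.
  have a1 := assoc_inS hA hB hC i j k; have a2 := assocV_inS hA hB hC i j k.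
  rewrite addbA in h1; rewrite e in h1 h2 a1 a2.
  rewrite (idlm h1) -comp_assoc; [|hm|hm].
  rewrite a1 comp_assoc; [|hm|hm].
  rewrite a2 -comp_assoc; [|hm|hm].
  by rewrite alphaSK // (idrm h1).
- move=> d; have hd := h d; have hd' := h' d.
  apply: (@in3l_epi A B C d (obS ((A ⊠s B) ⊠s C) d)); [hm|hm|].
  move=> i j k e; have h1 := in3r_hom A B C i j k; have h2 := in3l_hom A B C i j k.
  have h3 := alphaS_hom i j k hA hB hC; have h4 := alphaVS_hom i j k hA hB hC.
  have a1 := assoc_inS hA hB hC i j k; have a2 := assocV_inS hA hB hC i j k.
  rewrite addbA in h1; rewrite e in h1 h2 a1 a2.
  rewrite (idlm h2) -comp_assoc; [|hm|hm].
  rewrite a2 comp_assoc; [|hm|hm].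
  rewrite a1 -comp_assoc; [|hm|hm].
  by rewrite alphaVSK // (idrm h2).
Qed.

(** * Adjuncts and duals in the direct sum *)

Local Notation η := (uni H).
Local Notation ε := (counit H).
Local Notation dD := (DS_dual H).
Local Notation uD := (DS_unit H a).
Local Notation idD A := (idm (mcar A.1), idm A.2).
Implicit Types (W Z : DS_ob S) (e : bool).

Lemma uD_ok : okDS uD. Proof. exact: mod_unit_ok. Qed.

Lemma idD_hom A : homDS A A (idD A).
Proof. by case; exact: hom_id. Qed.
Lemma arS_idD A d : arS (idD A) d = idm (obS A d). Proof. by case: d. Qed.

Lemma arS_runit A d : arS (DS_runit H a A) d = prS A uD d false. Proof. by case: d. Qed.
Lemma arS_lunit A d : arS (DS_lunit H a A) d = prS uD A false d. Proof. by case: d. Qed.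

Lemma runit_invE A : okDS A ->
  inv (C := DS) (A ⊠s uD) A (DS_runit H a A) = (inS A uD false false, inS A uD true false).
Proof.
move=> hA; apply: DS_inv_eq => //; split.
- have h d : @isHom CD (obc A d) (obc (A ⊠s uD) d) (mkc d (inS A uD d false)).
    have hAd := obc_ok d hA; have [h1 _ _] := C_runit_inv S_sym D hAd.
    have h2 := homC_inS d false hA uD_ok; rewrite addbF in h2.
    have hi : inS A uD d false ∘ idm (obS A d) = inS A uD d false.
      have := inS_hom A uD d false => /hom_cast h; apply: idrm; apply: h => //.
      by rewrite /otensS andbF otens_1r.
    rewrite -hi; apply: (homC_comp hAd (C_tens_ok S_sym hAd (obc_ok false uD_ok)) _ _ h2).
      by rewrite -[d]addbF; apply: obc_ok; apply: tensD_ok uD_ok.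
    by case: (d) h1.
  by split; [exact: (h false) | exact: (h true)].
- move=> d; rewrite arS_runit; have := prS_hom A uD d false; rewrite addbF => h.
  by apply: hom_cast h _ _ => //; rewrite /otensS andbF otens_1r.
- move=> d; rewrite arS_runit; have -> : arS (inS A uD false false,
  inS A uD true false) d = inS A uD d false by case: d.
  have := inS_prS A uD d; case: d.
  + rewrite (_ : prS A uD false true = O (obS (A ⊠s uD) true) (A.1 ⊠ zob a)); last first.
      by apply: zobr_in; exact: (prS_hom A uD false true).
    rewrite (comp0r a _ (W := obS (A ⊠s uD) true)) ?(add0l a (U := obS (A ⊠s uD) true)
      (V := obS (A ⊠s uD) true)) //.
      have h1 := prS_hom A uD true false; have h2 := inS_hom A uD true false; hm.
    exact: (inS_hom A uD false true).
  + rewrite (_ : prS A uD true true = O (obS (A ⊠s uD) false) (H ⊠ A.2 ⊠ zob a)); last first.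
      by rewrite otens_assoc; apply: zobr_in; rewrite -otens_assoc; exact: (prS_hom A uD true true).
    rewrite (comp0r a _ (W := obS (A ⊠s uD) false)) ?(add0r a (U := obS (A ⊠s uD) false)
      (V := obS (A ⊠s uD) false)) //.
      have h1 := prS_hom A uD false false; have h2 := inS_hom A uD false false; hm.
    exact: (inS_hom A uD true true).
- move=> d; rewrite arS_runit; have -> : arS (inS A uD false false,
  inS A uD true false) d = inS A uD d false by case: d.
  by rewrite prS_inS /otensS andbF otens_1r.
Qed.

Lemma otensS_unitl A d : otensS false d (obS uD false) (obS A d) = obS A d.
Proof. exact: otens_1l. Qed.
Lemma otensS_unitr A d : otensS d false (obS A d) one = obS A d.
Proof. by rewrite /otensS andbF otens_1r. Qed.

Section Adjunct.
Context (W Z V : DS_ob S) (hW : okDS W) (hZ : okDS Z) (hV : okDS V).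
Context (F : DS_ar S) (hF : homDS (W ⊠s Z) uD F).
Context (c : bool -> ar S) (hc : forall e, c e ∈ one ⟶ otensS e e (obS Z e) (obS V e)).

Let h_in d e : tensS d false (idm (obS W d)) (c e) ∈ obS W d ⟶ ot3r W Z V d e e.
Proof.
have h := tensS_hom d false (hom_id (obS W d)) (hc e); apply: hom_cast h _ _.
  by rewrite /otensS andbF otens_1r.
by rewrite /ot3r addbb.
Qed.

Let h_in3r d e : in3r W Z V d e e ∈ ot3r W Z V d e e ⟶ obS (W ⊠s Z ⊠s V) d.
Proof. by have := in3r_hom W Z V d e e; rewrite addbb addbF. Qed.

(** Adjuncts and dual maps are composites of this form. A coevaluation [c e] of
    degree e puts the source, of degree d, next to a factor of degree e, and
    [F] maps their product to the unit object, whose odd part is projected away: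
    only e = d contributes. *)
Lemma adjunctS_term d e :
  prS uD V false d ∘ arS (DS_tensA H a F (idD V)) d ∘ arS (DS_assoc D a W Z V) d ∘
    (in3r W Z V d e e ∘ tensS d false (idm (obS W d)) (c e)) =
  if e == d then tensS false d (F.1 ∘ inS W Z d d) (idm (obS V d)) ∘ alphaS W Z V d d d
                  ∘ tensS d false (idm (obS W d)) (c d)
  else O (obS W d) (obS V d).
Proof.
have h1 := h_in d e; have h2 := h_in3r d e; have h3 := in3l_hom W Z V d e e.
have h4 := alphaS_hom d e e hW hZ hV.
have h5 := assoc_hom hW hZ hV d.
have h6 := tens_hom hF (idD_hom V) d.
have h7 : prS uD V false d ∈ obS (uD ⊠s V) d ⟶ obS V d.
  by have := prS_hom uD V false d; rewrite otensS_unitl.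
have e1 := assoc_inS hW hZ hV d e e.
have e2 := @tens_inS (W ⊠s Z) uD V V F (idD V) (d (+) e) e hF (idD_hom V).
rewrite arS_idD in e2; rewrite addbK in e1 e2 h3.
have h8 := hF (d (+) e); have h9 := inS_hom W Z d e.
have h10 := tensS_hom (d (+) e) e h8 (hom_id (obS V e)).
have h11 := tensS_hom (d (+) e) e h9 (hom_id (obS V e)).
have h12 := inS_hom (W ⊠s Z) V (d (+) e) e; rewrite addbK in h12.
have h13 := inS_hom uD V (d (+) e) e; rewrite addbK in h13.
have h14 := tensS_idr (d (+) e) e (obS V e) h9 h8.
have h15 := tensS_hom (d (+) e) e (hom_comp h9 h8 erefl) (hom_id (obS V e)).
rewrite /in3l in e1 h3; rewrite /ot3l in h3 h4.
transitivity ((prS uD V false d ∘ inS uD V (d (+) e) e) ∘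
   tensS (d (+) e) e (arS F (d (+) e) ∘ inS W Z d e) (idm (obS V e)) ∘ alphaS W Z V d e e ∘
   tensS d false (idm (obS W d)) (c e)).
  net (e1, e2, h14).
case: (e =P d) => [ed|ned].
  subst e; rewrite addbb in h4 h8 h9 h10 h11 h15 *.
  by rewrite prS_inS (idlm h15).
rewrite prS_inS0 ?addbK //; last by case: (d) (e) ned => [] [].
by rewrite (comp0l a _ h15) (comp0l a _ h4) (comp0l a _ h1) otensS_unitl.
Qed.

Lemma adjunctS d :
  prS uD V false d ∘ arS (DS_tensA H a F (idD V)) d ∘ arS (DS_assoc D a W Z V) d ∘
    (inS W (Z ⊠s V) d false ∘ tensS d false (idm (obS W d))
       ((inS Z V false false ∘ c false) +' (inS Z V true true ∘ c true))) =
  tensS false d (F.1 ∘ inS W Z d d) (idm (obS V d)) ∘ alphaS W Z V d d d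
    ∘ tensS d false (idm (obS W d)) (c d).
Proof.
have k e : inS Z V e e ∈ otensS e e (obS Z e) (obS V e) ⟶ obS (Z ⊠s V) false.
  by have := inS_hom Z V e e; rewrite addbb.
have kc e : inS Z V e e ∘ c e ∈ one ⟶ obS (Z ⊠s V) false.
  by have h1 := k e; have h2 := hc e; hm.
rewrite (tensS_addr d false (hom_id (obS W d)) (kc false) (kc true)).
rewrite -!(tensS_idl d false (obS W d) (hc _) (k _)).
have b e : in3r W Z V d e e ∘ tensS d false (idm (obS W d)) (c e) =
   inS W (Z ⊠s V) d false ∘ (tensS d false (idm (obS W d)) (inS Z V e e) ∘
     tensS d false (idm (obS W d)) (c e)).
  have h1 := tensS_hom d false (hom_id (obS W d)) (k e).
  have h2 := tensS_hom d false (hom_id (obS W d)) (hc e).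
  have h3 := inS_hom W (Z ⊠s V) d false.
  rewrite /in3r addbb comp_assoc //; hm.
have hb e : in3r W Z V d e e ∘ tensS d false (idm (obS W d)) (c e) ∈ obS W d ⟶ obS (W ⊠s Z ⊠s V) d.
  by have h1 := h_in d e; have h2 := h_in3r d e; hm.
have h3 := inS_hom W (Z ⊠s V) d false.
have q e : tensS d false (idm (obS W d)) (inS Z V e e) ∘ tensS d false (idm (obS W d)) (c e) ∈
   otensS d false (obS W d) one ⟶ otensS d false (obS W d) (obS (Z ⊠s V) false).
  have h1 := tensS_hom d false (hom_id (obS W d)) (k e).
  have h2 := tensS_hom d false (hom_id (obS W d)) (hc e); hm.
rewrite (add_compr a h3 (q false) (q true)) -!b.
have h7 : prS uD V false d ∈ obS (uD ⊠s V) d ⟶ obS V d.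
  by have := prS_hom uD V false d; rewrite otensS_unitl.
have h5 := assoc_hom hW hZ hV d.
have h6 := tens_hom hF (idD_hom V) d.
rewrite (@add_compr _ a (obS W d) (obS (W ⊠s Z ⊠s V) d) (obS V d)) //; last by hm.
rewrite !adjunctS_term.
have h0 : tensS false d (F.1 ∘ inS W Z d d) (idm (obS V d)) ∘ alphaS W Z V d d d
    ∘ tensS d false (idm (obS W d)) (c d) ∈ obS W d ⟶ obS V d.
  have hii : inS W Z d d ∈ otensS d d (obS W d) (obS Z d) ⟶ obS (W ⊠s Z) false.
    by have := inS_hom W Z d d; rewrite addbb.
  have h1 := h_in d d; have h4 := alphaS_hom d d d hW hZ hV.
  have h8 := hF false; have h10 := tensS_hom false d (hom_comp hii h8 erefl) (hom_id (obS V d)).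
  rewrite /ot3l addbb in h4; rewrite otensS_unitl in h10; hm.
by case: (d) h0 => h0; [exact: add0l h0 | exact: add0r h0].
Qed.
End Adjunct.

Definition coevS A d : ar S := under (C_coev D (obc A d)).
Definition evS A d : ar S := under (C_ev H (obc A d)).

Lemma coevS_hom A d : coevS A d ∈ one ⟶ otensS d d (obS A d) (obS (dD A) d).
Proof.
case: d; rewrite /coevS /=; last exact: hom_coev.
have h := Lambda_hom D; rewrite /otensS /=; hm.
Qed.
Lemma evS_hom A d : evS A d ∈ otensS d d (obS (dD A) d) (obS A d) ⟶ one.
Proof.
case: d; rewrite /evS /=; last exact: hom_ev.
rewrite /otensS /=; hm.
Qed.

Lemma inS_dd A B d : inS A B d d ∈ otensS d d (obS A d) (obS B d) ⟶ obS (A ⊠s B) false.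
Proof. by have := inS_hom A B d d; rewrite addbb. Qed.

Lemma coevE A : (DS_coev D a A).1 =
  (inS A (dD A) false false ∘ coevS A false) +' (inS A (dD A) true true ∘ coevS A true).
Proof. by []. Qed.

Lemma coev_homD A : homDS uD (A ⊠s dD A) (DS_coev D a A).
Proof.
case; first exact: azero_hom.
rewrite [arS _ false]coevE.
have h0 := inS_dd A (dD A) false; have h1 := inS_dd A (dD A) true.
have c0 := coevS_hom A false; have c1 := coevS_hom A true.
by apply: add_hom; hm.
Qed.

Lemma ev_homD A : homDS (dD A ⊠s A) uD (DS_ev H a A).
Proof.
case; first exact: azero_hom.
by apply: (@glue_hom (dD A) A one (fun i j => evS A i) false) => i j; case: i; case: j => // _;
  exact: evS_hom.
Qed.

Lemma ev_inS A d : (DS_ev H a A).1 ∘ inS (dD A) A d d = evS A d.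
Proof.
have := @glue_inS (dD A) A one (fun i j => evS A i) d d; rewrite addbb; apply.
by move=> i j; case: i; case: j => // _; exact: evS_hom.
Qed.

Lemma arS_comp F G d : arS (compA (r := DS) G F) d = arS G d ∘ arS F d.
Proof. by case: d. Qed.

Lemma coev_right W A d :
  arS (DS_tensA H a (idD W) (DS_coev D a A)) d ∘ inS W uD d false =
  inS W (A ⊠s dD A) d false ∘ tensS d false (idm (obS W d)) (DS_coev D a A).1.
Proof.
have := @tens_inS W W uD (A ⊠s dD A) (idD W) (DS_coev D a A) d false (idD_hom W) (coev_homD A).
by rewrite addbF arS_idD.
Qed.

Lemma arS_runitV W d : arS (inS W uD false false, inS W uD true false) d = inS W uD d false.
Proof. by case: d. Qed.

Lemma inS_runit_hom W d : inS W uD d false ∈ obS W d ⟶ obS (W ⊠s uD) d.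
Proof.
by have := inS_hom W uD d false; rewrite addbF /otensS andbF [_ ⊠ _]otens_1r.
Qed.

(** So adjuncts are formed degree by degree; as in [C_curry1], φ(Λ) = 1. *)
Lemma DS_curryE W Z F : okDS W -> okDS Z -> homDS (W ⊠s Z) uD F ->
  curry (C := DS) W Z F =
  (transp (obS W false) (obS Z false) (F.1 ∘ inS W Z false false),
   transp (obS W true) (obS Z true)
     (F.1 ∘ inS W Z true true ∘ (η ⊗ idm (obS W true ⊠ obS Z true)))).
Proof.
move=> hW hZ hF.
have cd d : arS (curry (C := DS) W Z F) d =
   tensS false d (F.1 ∘ inS W Z d d) (idm (obS (dD Z) d)) ∘ alphaS W Z (dD Z) d d d
    ∘ tensS d false (idm (obS W d)) (coevS Z d).
  rewrite /curry !arS_comp.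
  have el : arS (lunitA (r := DS) (dualO (r := DS) Z)) d = prS uD (dD Z) false d
    by exact: arS_lunit.
  rewrite [inv _ _ _](runit_invE hW) arS_runitV el.
  have h1 : prS uD (dD Z) false d ∈ obS (uD ⊠s dD Z) d ⟶ obS (dD Z) d.
    by have := prS_hom uD (dD Z) false d; rewrite otensS_unitl.
  have h2 := tens_hom hF (idD_hom (dD Z)) d.
  have h3 := assoc_hom hW hZ (dualD_ok hZ) d.
  have h4 := tens_hom (idD_hom W) (coev_homD Z) d.
  have h5 := inS_runit_hom W d.
  rewrite -comp_assoc; [|exact: hom_match h5 h4 erefl|exact: hom_match h4 (hom_comp h3 (hom_comp h2
    h1 erefl) erefl) erefl].
  rewrite [X in _ ∘ X](coev_right W Z d) coevE.
  exact: (@adjunctS W Z (dD Z) hW hZ (dualD_ok hZ) F hF (coevS Z) (coevS_hom Z) d).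
have := cd true; have := cd false; case: (curry _ _ _) => x y /= {cd} ex ey.
have f0 : F.1 ∘ inS W Z false false ∈ W.1 ⊠ Z.1 ⟶ one.
  exact: hom_comp (inS_dd W Z false) (hF false) erefl.
have f1 : F.1 ∘ inS W Z true true ∈ H ⊠ W.2 ⊠ Z.2 ⟶ one.
  exact: hom_comp (inS_dd W Z true) (hF false) erefl.
congr pair.
  rewrite ex /coevS /alphaS /=; set f := F.1 ∘ _ in f0 *; rewrite /obS /tensS /=; mcars.
  rewrite /transp; net.
rewrite ey /coevS /alphaS /=; set f := F.1 ∘ _ in f1 *;
  rewrite /obS /tensS /= (braiVE S_sym) /transp.
have hL := Lambda_hom D; have h := phi_hom D.
symmetry; net (esym (phi_Lambda S_sym D)).
Qed.

Lemma DS_dual_arrE A B f : okDS A -> okDS B -> @isHom DS A B f ->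
  dual_arr (C := DS) A B f = (dualm f.1, dualm f.2).
Proof.
move=> hA hB hf0; have hf := DS_hom_homDS hf0.
have hdB := dualD_ok hB; have hdA := dualD_ok hA.
pose c e := tensS e e (arS f e) (idm (obS (dD A) e)) ∘ coevS A e.
have hc e : c e ∈ one ⟶ otensS e e (obS B e) (obS (dD A) e).
  have h1 := coevS_hom A e; have h2 := tensS_hom e e (hf e) (hom_id (obS (dD A) e)).
  rewrite /c; hm.
have hfi := tens_hom hf (idD_hom (dD A)).
have cd d : arS (dual_arr (C := DS) A B f) d =
   tensS false d ((DS_ev H a B).1 ∘ inS (dD B) B d d) (idm (obS (dD A) d)) ∘
     alphaS (dD B) B (dD A) d d d
    ∘ tensS d false (idm (obS (dD B) d)) (c d).
  rewrite /dual_arr !arS_comp.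
  have el : arS (lunitA (r := DS) (dualO (r := DS) A)) d = prS uD (dD A) false d
    by exact: arS_lunit.
  rewrite [inv _ _ _](runit_invE hdB) arS_runitV el.
  have h1 : prS uD (dD A) false d ∈ obS (uD ⊠s dD A) d ⟶ obS (dD A) d.
    by have := prS_hom uD (dD A) false d; rewrite otensS_unitl.
  have h2 := tens_hom (ev_homD B) (idD_hom (dD A)) d.
  have h3 := assoc_hom hdB hB hdA d.
  have h4 := tens_hom (idD_hom (dD B)) (coev_homD A) d.
  have h5 := inS_runit_hom (dD B) d.
  have h6 := tens_hom (idD_hom (dD B)) hfi d.
  have e1 := coev_right (dD B) A d.
  have e2 := @tens_inS (dD B) (dD B) (A ⊠s dD A) (B ⊠s dD A) (idD (dD B))
     (DS_tensA H a f (idD (dD A))) d false (idD_hom (dD B)) hfi.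
  rewrite addbF arS_idD in e2.
  have k : (DS_coev D a A).1 ∈ one ⟶ obS (A ⊠s dD A) false := coev_homD A false.
  have k' := hfi false.
  have e3 := tensS_idl d false (obS (dD B) d) k k'.
  have h7 := inS_hom (dD B) (B ⊠s dD A) d false; rewrite addbF in h7.
  have h8 := inS_hom (dD B) (A ⊠s dD A) d false; rewrite addbF in h8.
  have h9 := tensS_hom d false (hom_id (obS (dD B) d)) k.
  have h10 := tensS_hom d false (hom_id (obS (dD B) d)) k'.
  rewrite otensS_unitr in h9.
  have e4 : arS (DS_tensA H a f (idD (dD A))) false ∘ (DS_coev D a A).1 =
     (inS B (dD A) false false ∘ c false) +' (inS B (dD A) true true ∘ c true).
    have t e : arS (DS_tensA H a f (idD (dD A))) false ∘ (inS A (dD A) e e ∘ coevS A e) =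
       inS B (dD A) e e ∘ c e.
      have q := @tens_inS A B (dD A) (dD A) f (idD (dD A)) e e hf (idD_hom (dD A)).
      rewrite addbb arS_idD in q.
      have a1 := inS_dd A (dD A) e; have a2 := coevS_hom A e; have a3 := inS_dd B (dD A) e.
      have a4 := tensS_hom e e (hf e) (hom_id (obS (dD A) e)).
      by rewrite comp_assoc ?q /c ?comp_assoc //; hm.
    have r e := hom_comp (coevS_hom A e) (inS_dd A (dD A) e) erefl.
    by rewrite coevE (add_compr a k' (r false) (r true)) !t.
  rewrite -(@adjunctS (dD B) B (dD A) hdB hB hdA (DS_ev H a B) (ev_homD B) c hc d) -e4.
  rewrite -e3.
  transitivity (prS uD (dD A) false d ∘ arS (DS_tensA H a (DS_ev H a B) (idD (dD A))) d
    ∘ arS (DS_assoc D a (dD B) B (dD A)) d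
    ∘ arS (DS_tensA H a (idD (dD B)) (DS_tensA H a f (idD (dD A)))) d
    ∘ arS (DS_tensA H a (idD (dD B)) (DS_coev D a A)) d ∘ inS (dD B) uD d false); first by [].
  net (e1, e2).
have := cd true; have := cd false; rewrite !ev_inS /c; case: (dual_arr _ _ _) => x y /= {cd} ex ey.
have f0 : f.1 ∈ A.1 ⟶ B.1 := hf false.
have f1 : f.2 ∈ A.2 ⟶ B.2 := hf true.
congr pair.
  rewrite ex /coevS /evS /alphaS /=; rewrite /obS /tensS /=; mcars.
  rewrite (dualmE S_sym f0) /transp; net.
rewrite ey /coevS /evS /alphaS /=; rewrite /obS /tensS /= (braiVE S_sym) (dualmE S_sym f1) /transp.
have hL := Lambda_hom D; have h := phi_hom D.
net (phi_Lambda S_sym D, counit_uni H).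
Qed.

(** * Duals of tensor products in the direct sum *)

(** In degree zero, naturality in the first argument is its H-linearity. *)
Lemma C_assoc_nat P Q P1 P2 d i j f : C_isOb H P -> C_isOb H Q -> C_isOb H P1 -> C_isOb H P2 ->
  homC P Q d f -> homC P1 P1 i (idm (uob P1)) -> homC P2 P2 j (idm (uob P2)) ->
  under (C_assoc D Q P1 P2) ∘ tensS d (i (+) j) f (idm (otensS i j (uob P1) (uob P2))) =
  tensS (d (+) i) j (tensS d i f (idm (uob P1))) (idm (uob P2)) ∘ under (C_assoc D P P1 P2).
Proof.
move=> hP hQ h1 h2.
have k1 := gamma_hom S_sym D; have k2 := delta_hom S_sym D; have k3 := phi_hom D.
case: P hP => [P|P] hP; case: Q hQ => [Q|Q] hQ; case: d => //= hf;
 case: P1 h1 => [P1|P1] h1; case: i => //= _; case: P2 h2 => [P2|P2] h2; case: j => //= _;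
 try (have {hP} [hP _ _] := hP); try (have {hQ} [hQ _ _] := hQ);
 try (have {h1} [h1 _ _] := h1); try (have {h2} [h2 _ _] := h2);
 rewrite /tensS /otensS /act2 ?(braiVE S_sym) /=.
- have [hf' ef] := hf. net.
- have [hf' ef] := hf. net.
- have [hf' ef] := hf. net (esym ef).
- have [hf' ef] := hf. net (esym ef).
- net.
- net.
- net.
- net.
Qed.

Lemma runit_hom A : homDS (A ⊠s uD) A (DS_runit H a A).
Proof.
move=> d; rewrite arS_runit; have := prS_hom A uD d false; rewrite addbF => h.
by apply: hom_cast h _ _ => //; rewrite otensS_unitr.
Qed.

(** The evaluation of A vanishes on products of odd degree, and the unit
    isomorphism is the projection that undoes an inclusion. *)
Lemma mid_ev A B i j i' : okDS A -> okDS B ->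
  arS (DS_runit H a B) ((j (+) i) (+) i') ∘
    arS (DS_tensA H a (idD B) (DS_ev H a A)) ((j (+) i) (+) i') ∘
    arS (DS_assocV B (dD A) A) ((j (+) i) (+) i') ∘ in3l B (dD A) A j i i' =
  if i == i' then tensS j false (idm (obS B j)) (evS A i) ∘ alphaVS B (dD A) A j i i
  else O (ot3l B (dD A) A j i i') (obS B ((j (+) i) (+) i')).
Proof.
move=> hA hB; have hA' := dualD_ok hA.
have h1 := @runit_hom B ((j (+) i) (+) i').
have hev := ev_homD A.
have h2 := tens_hom (idD_hom B) hev ((j (+) i) (+) i').
have h3 := assocV_hom hB hA' hA ((j (+) i) (+) i').
have h4 := in3l_hom B (dD A) A j i i'.
have h5 := alphaVS_hom j i i' hB hA' hA.
have h6 := in3r_hom B (dD A) A j i i'; rewrite addbA in h6.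
have e1 := assocV_inS hB hA' hA j i i'.
have e2 := @tens_inS B B (dD A ⊠s A) uD (idD B) (DS_ev H a A) j (i (+) i') (idD_hom B) hev.
rewrite arS_idD addbA in e2.
have h7 := inS_hom (dD A) A i i'.
have h8 := hev (i (+) i').
have h9 := tensS_hom j (i (+) i') (hom_id (obS B j)) h7.
have h10 := tensS_hom j (i (+) i') (hom_id (obS B j)) h8.
have e3 := tensS_idl j (i (+) i') (obS B j) h7 h8.
have h11 := tensS_hom j (i (+) i') (hom_id (obS B j)) (hom_comp h7 h8 erefl).
have h12 := inS_hom B uD j (i (+) i'); rewrite addbA in h12.
have h13 := inS_hom B (dD A ⊠s A) j (i (+) i'); rewrite addbA in h13.
transitivity (arS (DS_runit H a B) ((j (+) i) (+) i') ∘ inS B uD j (i (+) i') ∘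
   tensS j (i (+) i') (idm (obS B j)) (arS (DS_ev H a A) (i (+) i') ∘ inS (dD A) A i i') ∘
     alphaVS B (dD A) A j i i').
  rewrite /in3r in e1; rewrite /ot3r in h5; net (e1, e2, e3).
case: eqP => [ii'|nii'].
  subst i'; rewrite arS_runit; move: h1 h12 h11 h5 {h2 h3 h4 h6 e1 e2 h7 h8 h9 h10 e3 h13}.
  rewrite -addbA addbb addbF => h1 h12 h11 h5.
  by rewrite prS_inS (idlm h11) [arS _ false ∘ _](ev_inS A i).
have -> : arS (DS_ev H a A) (i (+) i') ∘ inS (dD A) A i i' = O (otensS i i' (obS (dD A) i)
  (obS A i')) (obS uD (i (+) i')).
  have -> : arS (DS_ev H a A) (i (+) i') = O (obS (dD A ⊠s A) (i (+) i')) (obS uD (i (+) i')).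
    by case: (i) (i') nii' => [] [].
  exact: comp0l h7.
rewrite (tensS_0r _ _ _ _ (hom_id _)) (comp0r a _ (W := obS B ((j (+) i) (+) i'))); last by hm.
exact: comp0l h5.
Qed.

(** On summands of matching degrees the pairing is that of C; on the others it
    is zero by [mid_ev]. *)
Lemma evtens_inS A B i j i' j' : okDS A -> okDS B -> j (+) i = i' (+) j' ->
  arS (ev_tens (C := DS) A B) false ∘
   (inS (dD B ⊠s dD A) (A ⊠s B) (j (+) i) (i' (+) j') ∘
     tensS (j (+) i) (i' (+) j') (inS (dD B) (dD A) j i) (inS A B i' j')) =
  if i == i' then under (ev_tens (C := CD) (obc A i) (obc B j))
  else O (otensS (j (+) i) (i' (+) j') (otensS j i (obS (dD B) j) (obS (dD A) i))
    (otensS i' j' (obS A i') (obS B j'))) one.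
Proof.
move=> hA hB h.
have hA' := dualD_ok hA; have hB' := dualD_ok hB.
have hW := tensD_ok hB' hA'.
have q : (j (+) i) (+) i' = j' by rewrite h addbAC addbb.
have hX := mid_ev i j i' hA hB'.
rewrite /ev_tens [inv _ _ _](assoc_invE hB' hA' hA) !arS_comp.
have h1 := @runit_hom (dD B); have h2 := tens_hom (idD_hom (dD B)) (ev_homD A).
have h3 := assocV_hom hB' hA' hA.
have g1 := assoc_hom hW hA hB false.
have g2 := tens_hom h3 (idD_hom B) false.
have g3 := tens_hom h2 (idD_hom B) false.
have g4 := tens_hom h1 (idD_hom B) false.
have g5 := ev_homD B false.
have hij := inS_hom (dD B) (dD A) j i.
have hij' := inS_hom A B i' j'.
have k1 := tensS_hom (j (+) i) (i' (+) j') hij (hom_id (otensS i' j' (obS A i') (obS B j'))).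
have k2 := tensS_hom (j (+) i) (i' (+) j') (hom_id (obS (dD B ⊠s dD A) (j (+) i))) hij'.
have hk : tensS (j (+) i) (i' (+) j') (inS (dD B) (dD A) j i) (inS A B i' j') =
  tensS (j (+) i) (i' (+) j') (idm (obS (dD B ⊠s dD A) (j (+) i))) (inS A B i' j') ∘
  tensS (j (+) i) (i' (+) j') (inS (dD B) (dD A) j i) (idm (otensS i' j' (obS A i') (obS B j'))).
  rewrite -(tensS_comp _ _ hij (hom_id _) (hom_id _) hij').
  by rewrite (idlm hij) (idrm hij').
rewrite hk.
have hl : in3l (dD B) (dD A) A j i i' ∈ ot3l (dD B) (dD A) A j i i' ⟶ obS ((dD B ⊠s dD A) ⊠s A) j'.
  by have := in3l_hom (dD B) (dD A) A j i i'; rewrite q.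
rewrite q in hX.
have q0 : ((j (+) i) (+) i') (+) j' = false by rewrite q addbb.
have o1 := obc_ok i' hA; have o2' := obc_ok j' hB; have o3 := obc_ok (j (+) i) hW.
have oP := C_tens_ok S_sym (obc_ok j hB') (obc_ok i hA').
have en := C_assoc_nat oP o3 o1 o2' (homC_inS j i hB' hA') (homC_id i' hA) (homC_id j' hB).
have al' : under (C_assoc D (obc (dD B ⊠s dD A) (j (+) i)) (obc A i')
  (obc B j')) = alphaS (dD B ⊠s dD A) A B (j (+) i) i' j' by [].
rewrite al' -[uob (obc A i')]/(obS A i') -[uob (obc B j')]/(obS B j') in en.
have ha := alphaS_hom (j (+) i) i' j' hW hA hB.
have e1 := assoc_inS hW hA hB (j (+) i) i' j'.
have hla := inS_hom (dD B ⊠s dD A) A (j (+) i) i'.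
have hlb := inS_hom ((dD B ⊠s dD A) ⊠s A) B ((j (+) i) (+) i') j'.
have hii := inS_hom (dD B ⊠s dD A) (A ⊠s B) (j (+) i) (i' (+) j'); have qq : (j (+) i) (+)
  (i' (+) j') = false by rewrite h addbb.
rewrite qq in hii.
have hlc := tensS_hom (j (+) i) i' hij (hom_id (obS A i')).
rewrite q0 /in3r /in3l in e1.
rewrite q addbb in hlb; rewrite q in e1 hla en.
rewrite /ot3l /ot3r q in ha.
have e2 := tens_inS j' j' h3 (idD_hom B).
have e3 := tens_inS j' j' h2 (idD_hom B).
have e4 := tens_inS j' j' h1 (idD_hom B).
rewrite arS_idD addbb in e2 e3 e4.
have b1 := h1 j'; have b2 := h2 j'; have b3 := h3 j'.
have m1 := tensS_idr j' j' (obS B j') b2 b1.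
have m2 := tensS_idr j' j' (obS B j') b3 (hom_comp b2 b1 erefl).
have m3 := tensS_idr j' j' (obS B j') hlc hla.
have m4 := tensS_idr j' j' (obS B j') hl (hom_comp b3 (hom_comp b2 b1 erefl) erefl).
have m3' : inS (dD B ⊠s dD A) A (j (+) i) i' ∘ tensS (j (+) i) i' (inS (dD B) (dD A) j i)
  (idm (obS A i')) =
  in3l (dD B) (dD A) A j i i' by [].
rewrite m3' in m3.
have c1 := tensS_hom j' j' b1 (hom_id (obS B j')).
have c2 := tensS_hom j' j' b2 (hom_id (obS B j')).
have c3 := tensS_hom j' j' b3 (hom_id (obS B j')).
have c4 := tensS_hom j' j' hl (hom_id (obS B j')).
have c5 := tensS_hom j' j' hla (hom_id (obS B j')).
have c6 := tensS_hom j' j' hlc (hom_id (obS B j')).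
have c7 := tensS_hom j' j' (hom_comp b2 b1 erefl) (hom_id (obS B j')).
have c8 := tensS_hom j' j' (hom_comp b3 (hom_comp b2 b1 erefl) erefl) (hom_id (obS B j')).
have c9 := tensS_hom j' j' (hom_comp hl (hom_comp b3 (hom_comp b2 b1 erefl) erefl) erefl)
  (hom_id (obS B j')).
have d1 := inS_dd ((dD B ⊠s dD A) ⊠s A) B j'.
have d2 := inS_dd (dD B ⊠s dD A ⊠s A) B j'.
have d3 := inS_dd (dD B ⊠s uD) B j'.
have d4 := inS_dd (dD B) B j'.
have hP : under (C_assoc D (C_tensO H (obc (dD B) j) (obc (dD A) i)) (obc A i') (obc B j')) ∈
   otensS (j (+) i) (i' (+) j') (otensS j i (obS (dD B) j) (obS (dD A) i)) (otensS i' j' (obS A i')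
     (obS B j')) ⟶
   otensS j' j' (otensS (j (+) i) i' (otensS j i (obS (dD B) j) (obS (dD A) i)) (obS A i'))
     (obS B j').
  have := C_assoc_typed S_sym D oP o1 o2'; rewrite -{2 3}q /obc.
  by case: (i); case: (j); case: (i') (j') h => [] [].
transitivity (arS (DS_ev H a B) false ∘ inS (dD B) B j' j' ∘
   tensS j' j' (arS (DS_runit H a (dD B)) j' ∘ arS (DS_tensA H a (idD (dD B)) (DS_ev H a A)) j'
       ∘ arS (DS_assocV (dD B) (dD A) A) j' ∘ in3l (dD B) (dD A) A j i i') (idm (obS B j')) ∘
    under (C_assoc D (C_tensO H (obc (dD B) j) (obc (dD A) i)) (obc A i') (obc B j'))).
  rewrite -m4 -m2 -m1 -m3.
  transitivity (arS (DS_ev H a B) false ∘ arS (DS_tensA H a (DS_runit H a (dD B)) (idD B)) false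
    ∘ arS (DS_tensA H a (DS_tensA H a (idD (dD B)) (DS_ev H a A)) (idD B)) false
    ∘ arS (DS_tensA H a (DS_assocV (dD B) (dD A) A) (idD B)) false
    ∘ arS (DS_assoc D a (dD B ⊠s dD A) A B) false ∘
     (inS (dD B ⊠s dD A) (A ⊠s B) (j (+) i) (i' (+) j')
     ∘ (tensS (j (+) i) (i' (+) j') (idm (obS (dD B ⊠s dD A) (j (+) i))) (inS A B i' j')
        ∘ tensS (j (+) i) (i' (+) j') (inS (dD B) (dD A) j i)
            (idm (otensS i' j' (obS A i') (obS B j')))))); first by [].
  net (e1, en, e2, e3, e4).
rewrite hX [arS (DS_ev H a B) false ∘ _](ev_inS B j').
case: eqP => [ii'|_]; last first.
  rewrite (tensS_0l j' j' _ _ (hom_id (obS B j'))) (comp0r a _ (evS_hom B j')).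
  by rewrite (comp0l a _ hP).
subst i'; rewrite -addbA addbb addbF in q; clear - q hA hB hA' hB' S_sym Ad_sig_invol; subst j'.
rewrite [inv _ _ _](C_assoc_invE S_sym Ad_sig_invol (C_dual_ok S_sym (obc_ok j hB))
  (C_dual_ok S_sym (obc_ok i hA)) (obc_ok i hA)).
have k1 := cop_hom D; have k2 := delta_hom S_sym D; have k3 := phi_hom D.
have k4 := phiV_hom D; have k5 := gamma_hom S_sym D.
have [a1 _ _] := hA; have [b1 _ _] := hB; have [a2 _ _] := hA'; have [b2 _ _] := hB'.
rewrite /= in a2 b2.
case: (i) (j) => [] []; rewrite /evS /alphaVS; cbn [obc fst snd]; unC;
  rewrite /tensS /obS /= ?(braiVE S_sym); net.
Qed.

(** The object of degree zero that two objects of degree d form in C contains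
    their plain tensor product, by the unit of H if d is odd. *)
Definition unitS d (U V : ob S) : ar S := if d then η ⊗ idm (U ⊠ V) else idm (U ⊠ V).
Lemma unitS_hom d (U V : ob S) : unitS d U V ∈ U ⊠ V ⟶ otensS d d U V.
Proof. by rewrite /unitS /otensS; case: d; hm. Qed.
Lemma unitS_nat d (U V X Y : ob S) (f g : ar S) : f ∈ U ⟶ X -> g ∈ V ⟶ Y ->
  tensS d d f g ∘ unitS d U V = unitS d X Y ∘ (f ⊗ g).
Proof. by rewrite /unitS /tensS; case: d => hf hg /=; net. Qed.

(** The canonical map from B^∨ ⊗ A^∨ to the dual of A ⊗ B, in degree d. *)
Definition dtensS A B d : ar S := arS (dual_tens (C := DS) A B) d.
Definition evtensS A B d : ar S :=
  arS (ev_tens (C := DS) A B) false ∘ inS (dD B ⊠s dD A) (A ⊠s B) d d ∘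
    unitS d (obS (dD B ⊠s dD A) d) (obS (A ⊠s B) d).

Section Tens.
Context (A B : DS_ob S) (hA : okDS A) (hB : okDS B).
Let hA' : okDS (dD A) := dualD_ok hA.
Let hB' : okDS (dD B) := dualD_ok hB.
Let hW : okDS (dD B ⊠s dD A) := tensD_ok hB' hA'.
Let hZ : okDS (A ⊠s B) := tensD_ok hA hB.

Lemma evtens_hom : homDS ((dD B ⊠s dD A) ⊠s (A ⊠s B)) uD (ev_tens (C := DS) A B).
Proof.
move=> d; rewrite /ev_tens [inv _ _ _](assoc_invE hB' hA' hA) !arS_comp.
have g1 := assoc_hom hW hA hB d.
have g2 := tens_hom (assocV_hom hB' hA' hA) (idD_hom B) d.
have g3 := tens_hom (tens_hom (idD_hom (dD B)) (ev_homD A)) (idD_hom B) d.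
have g4 := tens_hom (@runit_hom (dD B)) (idD_hom B) d.
have g5 := ev_homD B d.
exact: hom_comp g1 (hom_comp g2 (hom_comp g3 (hom_comp g4 g5 erefl) erefl) erefl) erefl.
Qed.

Lemma evtensS_hom d : evtensS A B d ∈ obS (dD B ⊠s dD A) d ⊠ obS (A ⊠s B) d ⟶ one.
Proof.
have h1 := evtens_hom false; have h2 := inS_dd (dD B ⊠s dD A) (A ⊠s B) d.
have h3 := unitS_hom d (obS (dD B ⊠s dD A) d) (obS (A ⊠s B) d); rewrite /evtensS; hm.
Qed.

Lemma dtensS_E d : dtensS A B d = transp (obS (dD B ⊠s dD A) d) (obS (A ⊠s B) d) (evtensS A B d).
Proof.
rewrite /dtensS; have := DS_curryE hW hZ evtens_hom.
rewrite -[dual_tens (C := DS) A B]/(curry (C := DS) (dD B ⊠s dD A) (A ⊠s B)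
  (ev_tens (C := DS) A B)).
move=> ->; rewrite /evtensS; case: d => //=.
have h1 := evtens_hom false; have h2 := inS_dd (dD B ⊠s dD A) (A ⊠s B) false.
by rewrite (idrm (hom_comp h2 h1 erefl)).
Qed.

Lemma dtensS_hom d : dtensS A B d ∈ obS (dD B ⊠s dD A) d ⟶ (obS (A ⊠s B) d)^∨.
Proof. rewrite dtensS_E; exact: hom_transp (evtensS_hom d). Qed.

Definition dtensC i j : ar S := dtens D (obc A i) (obc B j).
Lemma dtensC_hom i j : dtensC i j ∈ otensS j i (obS (dD B) j)
  (obS (dD A) i) ⟶ (otensS i j (obS A i) (obS B j))^∨.
Proof.
by have := dtens_hom D (obc_ok i hA) (obc_ok j hB); rewrite /dtensC; case: i; case: j.
Qed.
Definition pairC i j : ar S := pairT D (obc A i) (obc B j).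
Lemma pairC_hom i j : pairC i j ∈ otensS j i (obS (dD B) j) (obS (dD A) i) ⊠ otensS i j (obS A i)
  (obS B j) ⟶ one.
Proof.
by have := pairT_hom D (obc_ok i hA) (obc_ok j hB); rewrite /pairC; case: i; case: j.
Qed.
Lemma dtensC_E i j : dtensC i j = transp (otensS j i (obS (dD B) j) (obS (dD A) i))
  (otensS i j (obS A i) (obS B j)) (pairC i j).
Proof. by rewrite /dtensC /pairC; case: i; case: j. Qed.

Lemma evtensS_inS i j i' j' : j (+) i = i' (+) j' ->
  evtensS A B (j (+) i) ∘ (inS (dD B) (dD A) j i ⊗ inS A B i' j') =
  if i == i' then pairC i j
  else O (otensS j i (obS (dD B) j) (obS (dD A) i) ⊠ otensS i' j' (obS A i') (obS B j')) one.
Proof.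
move=> h; have e := @evtens_inS A B i j i' j' hA hB h.
have q : i == i' -> j = j' by move=> /eqP ii'; subst i'; move: h; rewrite addbC => /addbI.
have h0 := evtens_hom false.
have h1 := inS_hom (dD B) (dD A) j i; have h2 := inS_hom A B i' j'.
rewrite -h in e h2.
have n := unitS_nat (j (+) i) h1 h2.
have h3 := inS_dd (dD B ⊠s dD A) (A ⊠s B) (j (+) i).
have h4 := tensS_hom (j (+) i) (j (+) i) h1 h2.
have h5 := unitS_hom (j (+) i) (otensS j i (obS (dD B) j) (obS (dD A) i)) (otensS i' j' (obS A i')
  (obS B j')).
have h6 := unitS_hom (j (+) i) (obS (dD B ⊠s dD A) (j (+) i)) (obS (A ⊠s B) (j (+) i)).
transitivity (arS (ev_tens (C := DS) A B) false ∘
   (inS (dD B ⊠s dD A) (A ⊠s B) (j (+) i) (j (+) i) ∘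
     tensS (j (+) i) (j (+) i) (inS (dD B) (dD A) j i) (inS A B i' j')) ∘
     unitS (j (+) i) (otensS j i (obS (dD B) j) (obS (dD A) i)) (otensS i' j' (obS A i')
       (obS B j'))).
  rewrite /evtensS; symmetry; net n.
rewrite e; case: (i =P i') q => [ii' q|_ _]; last exact: comp0l h5.
have hp := pairC_hom i j; rewrite (ev_tensE S_sym Ad_sig_invol (obc_ok i hA) (obc_ok j hB)).
have {q} jj' := q isT; move: hp; rewrite /pairC; clear - S_sym ii' jj'; subst i' j'.
move: (pairT _ _ _) => p; case: (i) (j) => [] [] /= hp; rewrite /otensS /= in hp *.
- exact: idrm hp.
- net (counit_uni H).
- net (counit_uni H).
- exact: idrm hp.
Qed.

(** The canonical map is the sum of the canonical maps of C: both sides have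
    the same pairing with each summand of A ⊗ B. *)
Lemma dtensS_inS i j :
  dtensS A B (j (+) i) ∘ inS (dD B) (dD A) j i = dualm (prS A B i j) ∘ dtensC i j.
Proof.
have h1 := inS_hom (dD B) (dD A) j i; have h2 := dtensS_hom (j (+) i).
have h3 := prS_hom A B i j; rewrite addbC in h3.
have h4 := dtensC_hom i j; have h5 := dualm_hom S_sym h3; have e5 := ev_dualm S_sym h3.
have h6 := evtensS_hom (j (+) i); have h7 := pairC_hom i j.
have eT := ev_transp h6; rewrite -dtensS_E in eT.
have eD := ev_transp h7; rewrite -dtensC_E in eD.
apply: (@ev_inj S S_sym (otensS j i (obS (dD B) j) (obS (dD A) i)) (obS (A ⊠s B) (j (+) i)));
  [hm|hm|].
transitivity (evtensS A B (j (+) i) ∘ (inS (dD B) (dD A) j i ⊗ idm (obS (A ⊠s B) (j (+) i)))).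
  net eT.
transitivity (pairC i j ∘ (idm (otensS j i (obS (dD B) j) (obS (dD A) i)) ⊗ prS A B i j));
  last first.
  symmetry; net (e5, eD).
have K X f g : f ∈ X ⊠ obS (A ⊠s B) (j (+) i) ⟶ one -> g ∈ X ⊠ obS (A ⊠s B) (j (+) i) ⟶ one ->
  (forall i' j', i' (+) j' = j (+) i -> f ∘ (idm X ⊗ inS A B i' j') = g ∘
    (idm X ⊗ inS A B i' j')) -> f = g.
  move=> hf hg; exact: (@tensS_epir A B false (j (+) i) X one f g hf hg).
apply: K; [hm|hm|] => i' j' h; have h8 := inS_hom A B i' j'; rewrite h in h8.
transitivity (evtensS A B (j (+) i) ∘ (inS (dD B) (dD A) j i ⊗ inS A B i' j')); first by net.
rewrite evtensS_inS; last exact: esym h.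
transitivity (pairC i j ∘ (idm (otensS j i (obS (dD B) j) (obS (dD A) i)) ⊗ (prS A B i j ∘
  inS A B i' j'))); last by net.
case: eqP h => [ii' h|ii' h].
  subst i'; move: h; rewrite addbC => /addIb h; subst j'.
  by rewrite prS_inS tens_id (idrm h7).
rewrite prS_inS0; [|by rewrite h addbC|by apply/eqP].
by rewrite (tens0r a _ _ (hom_id _)) (comp0r a _ h7).
Qed.
End Tens.
Section TensInverse.
Context (A B : DS_ob S) (hA : okDS A) (hB : okDS B).
Let hA' : okDS (dD A) := dualD_ok hA.
Let hB' : okDS (dD B) := dualD_ok hB.
Let hW : okDS (dD B ⊠s dD A) := tensD_ok hB' hA'.
Let hZ : okDS (A ⊠s B) := tensD_ok hA hB.

Definition dtensVC i j : ar S := dtensV D (obc A i) (obc B j).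
Lemma dtensVC_hom i j : dtensVC i j ∈ (otensS i j (obS A i)
  (obS B j))^∨ ⟶ otensS j i (obS (dD B) j) (obS (dD A) i).
Proof.
by have := dtensV_hom D (obc_ok i hA) (obc_ok j hB); rewrite /dtensVC; case: i; case: j.
Qed.
Lemma dtensCK i j : dtensVC i j ∘ dtensC A B i j = idm (otensS j i (obS (dD B) j) (obS (dD A) i)).
Proof.
by have := dtensK S_sym D (obc_ok i hA) (obc_ok j hB); rewrite /dtensVC; case: i; case: j.
Qed.
Lemma dtensVCK i j : dtensC A B i j ∘ dtensVC i j = idm (otensS i j (obS A i) (obS B j))^∨.
Proof.
by have := dtensVK S_sym D (obc_ok i hA) (obc_ok j hB); rewrite /dtensVC; case: i; case: j.
Qed.

(** The sum of the inverses of the canonical maps of C is inverse to the sum of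
    these maps. *)
Definition dtensV_block i j : ar S := inS (dD B) (dD A) j i ∘ dtensVC i j ∘ dualm (inS A B i j).
Definition dtensVS d : ar S := dtensV_block false d +' dtensV_block true (~~ d).

Lemma dtensV_block_hom i j d : i (+) j = d ->
  dtensV_block i j ∈ (obS (A ⊠s B) d)^∨ ⟶ obS (dD B ⊠s dD A) d.
Proof.
move=> <-; have h1 := inS_hom (dD B) (dD A) j i; rewrite addbC in h1.
have h2 := dtensVC_hom i j; have h3 := dualm_hom S_sym (inS_hom A B i j); rewrite /dtensV_block; hm.
Qed.
Lemma dtensVS_hom d : dtensVS d ∈ (obS (A ⊠s B) d)^∨ ⟶ obS (dD B ⊠s dD A) d.
Proof. by apply: add_hom; apply: dtensV_block_hom => //; rewrite /= negbK. Qed.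

Lemma dtens_block i j d : i (+) j = d -> dtensS A B d ∘ dtensV_block i j = dualm (inS A B i j ∘
  prS A B i j).
Proof.
move=> <-; have e := dtensS_inS hA hB i j.
have h0 := inS_hom A B i j; have h0' := prS_hom A B i j.
have h1 := inS_hom (dD B) (dD A) j i; have h2 := dtensVC_hom i j; have h3 := dualm_hom S_sym h0.
have h4 := dtensS_hom hA hB (j (+) i).
have h5 := dualm_hom S_sym h0'; have h6 := dtensC_hom hA hB i j; have k := dtensVCK i j.
rewrite (dualm_comp S_sym h0' h0) /dtensV_block; rewrite addbC in e h1 h4; net (e, k).
Qed.

Lemma dtensSK d : dtensS A B d ∘ dtensVS d = idm (obS (A ⊠s B) d)^∨.
Proof.
have h := dtensS_hom hA hB d.
have q j : (j (+) (j (+) d)) = d by rewrite addKb.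
rewrite /dtensVS (add_compr a h (dtensV_block_hom (q false)) (dtensV_block_hom (q true))).
rewrite (dtens_block (q false)) (dtens_block (q true)).
have r i : inS A B i (i (+) d) ∘ prS A B i (i (+) d) ∈ obS (A ⊠s B) d ⟶ obS (A ⊠s B) d.
  have h1 := inS_hom A B i (i (+) d); have h2 := prS_hom A B i (i (+) d).
  rewrite q in h1 h2; hm.
by rewrite -(dualm_add S_sym a (r false) (r true)) inS_prS dualm_id.
Qed.

Lemma dtensV_block_prS i j i' j' d : i' (+) j' = d -> i (+) j = d ->
  dtensV_block i' j' ∘ dualm (prS A B i j) ∘ dtensC A B i j =
  if i' == i then inS (dD B) (dD A) j i else O (otensS j i (obS (dD B) j) (obS (dD A) i))
    (obS (dD B ⊠s dD A) d).
Proof.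
move=> e' e; have h0 := inS_hom A B i' j'; have h0' := prS_hom A B i j.
have h1 := inS_hom (dD B) (dD A) j' i'; have h2 := dtensVC_hom i' j'.
rewrite addbC in h1; rewrite e' in h0 h1; rewrite e in h0'.
have h3 := dualm_hom S_sym h0; have h5 := dualm_hom S_sym h0'; have h6 := dtensC_hom hA hB i j.
have c := dualm_comp S_sym h0 h0'; have k := dtensCK i j.
transitivity (inS (dD B) (dD A) j' i' ∘ dtensVC i' j' ∘ dualm (prS A B i j ∘ inS A B i' j') ∘
  dtensC A B i j).
  by rewrite c /dtensV_block; net.
case: eqP => [ii'|ii'].
  subst i'; have ej : j' = j by move: e'; rewrite -e => /addbI.
  subst j'; rewrite prS_inS dualm_id //; net k.
rewrite prS_inS0 ?e ?e' //; last by apply/eqP => E; apply: ii'.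
rewrite dualm0 // (comp0r a _ (W := obS (dD B ⊠s dD A) d)); last by hm.
exact: comp0l h6.
Qed.

Lemma dtensVSK d : dtensVS d ∘ dtensS A B d = idm (obS (dD B ⊠s dD A) d).
Proof.
have h := dtensS_hom hA hB d; have hV := dtensVS_hom d.
apply: (@inS_epi (dD B) (dD A) d (obS (dD B ⊠s dD A) d)); [hm|hm|].
move=> j i h1; have e := dtensS_inS hA hB i j; rewrite h1 in e.
have h2 := inS_hom (dD B) (dD A) j i; rewrite h1 in h2.
have h3 := prS_hom A B i j; rewrite addbC h1 in h3.
have h5 := dualm_hom S_sym h3; have h6 := dtensC_hom hA hB i j.
have q j' : (j' (+) (j' (+) d)) = d by rewrite addKb.
have k j' := dtensV_block_hom (q j').
have hh : i (+) j = d by rewrite addbC.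
rewrite -comp_assoc; [|hm|hm]; rewrite e comp_assoc; [|hm|hm].
rewrite (idlm h2) /dtensVS (add_compl a h5 (k false) (k true)).
have k' j' := hom_comp h5 (k j') erefl.
rewrite (add_compl a h6 (k' false) (k' true)) !(dtensV_block_prS (q _) hh).
by case: (i) h2 => h2; [exact: (add0l a h2)|exact: (add0r a h2)].
Qed.

Lemma dtensS_prS i j d : i (+) j = d ->
  dualm (inS A B i j) ∘ dtensS A B d = dtensC A B i j ∘ prS (dD B) (dD A) j i.
Proof.
move=> hd; have h := dtensS_hom hA hB d.
have h0 := inS_hom A B i j; rewrite hd in h0; have h1 := dualm_hom S_sym h0.
have h2 := dtensC_hom hA hB i j; have h3 := prS_hom (dD B) (dD A) j i; rewrite addbC hd in h3.
apply: (@inS_epi (dD B) (dD A) d (otensS i j (obS A i) (obS B j))^∨); [hm|hm|].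
move=> j' i' h'; have h4 := inS_hom (dD B) (dD A) j' i'; rewrite h' in h4.
have e := dtensS_inS hA hB i' j'; rewrite h' in e.
have h5 := prS_hom A B i' j'; rewrite addbC h' in h5; have h6 := dualm_hom S_sym h5.
have h7 := dtensC_hom hA hB i' j'.
rewrite -comp_assoc; [|hm|hm]; rewrite e comp_assoc; [|hm|hm].
rewrite -(dualm_comp S_sym h0 h5) -comp_assoc; [|hm|hm].
case: (i =P i') => [ii'|ii'].
  subst i'; have ej : j' = j by move: h'; rewrite addbC -hd => /addbI.
  by subst j'; rewrite !prS_inS dualm_id // (idlm h7) (idrm h7).
rewrite prS_inS0; [|by rewrite hd addbC h'|by apply/eqP => E; apply: ii'].
rewrite prS_inS0; [|by rewrite h' addbC hd|].
  by rewrite dualm0 // (comp0l a _ h7) (comp0r a _ h2).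
by apply/eqP => jj; apply: ii'; subst j'; move: h'; rewrite addbC -hd => /addIb.
Qed.

Lemma homC_dtensVS d : homC (C_dual H (obc (A ⊠s B) d)) (obc (dD B ⊠s dD A) d) d (dtensVS d).
Proof.
have oZ := C_dual_ok S_sym (obc_ok d hZ); have oW := obc_ok d hW.
have h i j : i (+) j = d -> homC (C_dual H (obc (A ⊠s B) d))
  (obc (dD B ⊠s dD A) d) d (dtensV_block i j).
  move=> hd; have oA := obc_ok i hA; have oB := obc_ok j hB.
  have oAB := C_tens_ok S_sym oA oB.
  have oBA := C_tens_ok S_sym (obc_ok j hB') (obc_ok i hA').
  have h1 := homC_inS j i hB' hA'; rewrite addbC hd in h1.
  have h2 := dtensV_homC S_sym D oA oB; have h3 := homC_inS i j hA hB; rewrite hd in h3.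
  apply: (homC_comp (Q := C_dual H (C_tensO H (obc A i) (obc B j))) oZ (C_dual_ok S_sym oAB) oW).
    have := obc_ok d hZ; move: oAB h3; clear - S_sym hd.
    by move: (inS A B i j) => f; subst d; case: i; case: j => o1 h otensS;
      (exact: dualm_hom || exact: dualm_mod).
  apply: (homC_comp (C_dual_ok S_sym oAB) oBA oW) h1.
  by move: h2; rewrite /dtensVC; clear - hd; subst d; case: i; case: j.
by apply: (homC_add oZ oW); apply: h => //; rewrite /= negbK.
Qed.

Lemma dual_tens_pair : dual_tens (C := DS) A B = (dtensS A B false, dtensS A B true).
Proof. by rewrite /dtensS; case: (dual_tens _ _). Qed.

Lemma dual_tens_homD : @isHom DS (dD B ⊠s dD A) (dD (A ⊠s B)) (dual_tens (C := DS) A B).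
Proof.
rewrite dual_tens_pair; split; last exact: (dtensS_hom hA hB true).
have [h1 _ _] := hW; have [h2 _ _] := mod_dual_ok S_sym hZ.
exact: (mod_hom_inv S_sym h2 h1 (homC_dtensVS false) (dtensS_hom hA hB false)
  (dtensSK false) (dtensVSK false)).
Qed.

Lemma dual_dual_tensE :
  dual_arr (C := DS) (dD B ⊠s dD A) (dD (A ⊠s B)) (dual_tens (C := DS) A B) =
  (dualm (dtensS A B false), dualm (dtensS A B true)).
Proof.
rewrite (DS_dual_arrE hW (dualD_ok hZ) dual_tens_homD).
by rewrite dual_tens_pair.
Qed.

Lemma dual_dual_tens_inv :
  inv (C := DS) (dD (dD (A ⊠s B))) (dD (dD B ⊠s dD A))
    (dual_arr (C := DS) (dD B ⊠s dD A) (dD (A ⊠s B)) (dual_tens (C := DS) A B)) =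
  (dualm (dtensVS false), dualm (dtensVS true)).
Proof.
rewrite dual_dual_tensE; apply: (DS_inv_eq).
have hT := dtensS_hom hA hB.
split.
- split; last exact: (dualm_hom S_sym (dtensVS_hom true)).
  exact: (dualm_mod S_sym (mod_dual_ok S_sym hZ) hW (homC_dtensVS false)).
- by case; [exact: (dualm_hom S_sym (hT true)) | exact: (dualm_hom S_sym (hT false))].
- have E d : dualm (dtensVS d) ∘ dualm (dtensS A B d) = idm (obS (dD (dD (A ⊠s B))) d).
    by rewrite -(dualm_comp S_sym (dtensVS_hom d) (hT d)) dtensSK dualm_id //; case: d.
  by case; exact: E.
- have E d : dualm (dtensS A B d) ∘ dualm (dtensVS d) = idm (obS (dD (dD B ⊠s dD A)) d).
    by rewrite -(dualm_comp S_sym (hT d) (dtensVS_hom d)) dtensVSK dualm_id //; case: d.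
  by case; exact: E.
Qed.

Local Notation deltaS A d := (udelta D (obc A d)).
(** * The pivotal structure on the direct sum *)

Lemma deltaS_hom E d : okDS E -> deltaS E d ∈ obS E d ⟶ (obS E d)^∨^∨.
Proof. by move=> hE; exact: udelta_hom (obc_ok d hE). Qed.
Lemma arS_delta E d : arS (DS_delta D E) d = deltaS E d. Proof. by case: d. Qed.
Lemma delta_homD E : okDS E -> homDS E (dD (dD E)) (DS_delta D E).
Proof. by move=> hE d; rewrite arS_delta; have := deltaS_hom d hE; case: d. Qed.

(** Monoidality is tested on the summands A_i ⊗ B_j, where it is [dtens_delta]:
    δ is natural for their inclusions, which are linear. *)
Lemma dual_dtensS_delta d :
  dualm (dtensS A B d) ∘ deltaS (A ⊠s B) d =
  dtensS (dD B) (dD A) d ∘ arS (DS_tensA H a (DS_delta D A) (DS_delta D B)) d.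
Proof.
have hT := dtensS_hom hA hB d; have hT' := dualm_hom S_sym hT.
have hU := dtensS_hom hB' hA' d.
have hAB := tens_hom (delta_homD hA) (delta_homD hB) d.
have hd := deltaS_hom d hZ.
have hd' : deltaS (A ⊠s B) d ∈ obS (A ⊠s B) d ⟶ (obS (A ⊠s B) d)^∨^∨ by [].
apply: (@inS_epi A B d (obS (dD B ⊠s dD A) d)^∨).
- exact: hom_comp hd' hT' erefl.
- have hU' : dtensS (dD B) (dD A) d ∈ obS (dD (dD A) ⊠s dD (dD B)) d ⟶ (obS (dD B ⊠s dD A) d)^∨
  by exact: hU.
  exact: hom_comp hAB hU' erefl.
move=> i j hij.
have h0 := inS_hom A B i j; rewrite hij in h0.
have oA := obc_ok i hA; have oB := obc_ok j hB; have oAB := C_tens_ok S_sym oA oB.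
have ni : deltaS (A ⊠s B) d ∘ inS A B i j = dualm (dualm (inS A B i j)) ∘
  udelta D (C_tensO H (obc A i) (obc B j)).
  have := homC_inS i j hA hB; rewrite hij => k.
  have := udelta_nat S_sym S_twist oAB (obc_ok d hZ) k.
  by case: (d).
have hD : udelta D (C_tensO H (obc A i) (obc B j)) ∈ otensS i j (obS A i)
  (obS B j) ⟶ (otensS i j (obS A i) (obS B j))^∨^∨.
  by have := udelta_hom S_sym S_twist Ad_sig_invol oAB; clear; case: i; case: j.
have hi1 := dualm_hom S_sym h0; have hi2 := dualm_hom S_sym hi1.
have hp := prS_hom (dD B) (dD A) j i; rewrite addbC hij in hp; have hp' := dualm_hom S_sym hp.
have hdt := dtensC_hom hA hB i j; have hdt' := dualm_hom S_sym hdt.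
have e1 := dtensS_prS hij.
have e2 := dualm_comp S_sym hT hi1; have e3 := dualm_comp S_sym hp hdt.
rewrite e1 e3 in e2.
have e4 : dualm (dtensC A B i j) ∘ udelta D (C_tensO H (obc A i) (obc B j)) =
   dtensC (dD B) (dD A) j i ∘ tensS i j (deltaS A i) (deltaS B j).
  have := dtens_delta S_sym S_twist Ad_sig_invol oA oB.
  by clear; case: i; case: j.
have e5 := dtensS_inS hB' hA' j i; rewrite hij in e5.
have e6 := @tens_inS A (dD (dD A)) B (dD (dD B)) (DS_delta D A) (DS_delta D B) i j
   (delta_homD hA) (delta_homD hB).
rewrite !arS_delta hij in e6.
have hl1 := delta_homD hA i; have hl2 := delta_homD hB j; rewrite !arS_delta in hl1 hl2.
have hl := tensS_hom i j hl1 hl2.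
have hdt2 := dtensC_hom hB' hA' j i.
have hii2 := inS_hom (dD (dD A)) (dD (dD B)) i j; rewrite hij in hii2.
net (ni, esym e2, e4, esym e5, esym e6).
Qed.

Lemma delta_tensD :
  DS_delta D (A ⊠s B) =
  compA (r := DS) (ddual_tens (C := DS) A B) (DS_tensA H a (DS_delta D A) (DS_delta D B)).
Proof.
rewrite /ddual_tens [inv _ _ _]dual_dual_tens_inv.
have k d : deltaS (A ⊠s B) d = dualm (dtensVS d) ∘ dtensS (dD B) (dD A) d ∘
   arS (DS_tensA H a (DS_delta D A) (DS_delta D B)) d.
  have hT := dtensS_hom hA hB d; have hV := dtensVS_hom d.
  have hU : dtensS (dD B) (dD A) d ∈ obS (dD (dD A) ⊠s dD (dD B)) d ⟶ (obS (dD B ⊠s dD A) d)^∨ :=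
    dtensS_hom hB' hA' d.
  have hAB := tens_hom (delta_homD hA) (delta_homD hB) d.
  have hT' := dualm_hom S_sym hT; have hV' := dualm_hom S_sym hV; have hd := deltaS_hom d hZ.
  rewrite -comp_assoc; [|hm|hm].
  rewrite -dual_dtensS_delta comp_assoc; [|hm|hm].
  by rewrite -(dualm_comp S_sym hV hT) dtensSK dualm_id // (idlm hd).
by congr pair; [rewrite -[LHS]/(deltaS (A ⊠s B) false)
  (k false) | rewrite -[LHS]/(deltaS (A ⊠s B) true) (k true)].
Qed.
End TensInverse.

Lemma delta_isoD A : okDS A -> is_iso (C := DS) A (dD (dD A)) (DS_delta D A).
Proof.
move=> hA; have [h0 [[g0|g0]]] := delta_iso S_sym S_twist Ad_sig_invol (obc_ok false hA);
  case=> // k0 e0 e0'.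
have [h1 [[g1|g1]]] := delta_iso S_sym S_twist Ad_sig_invol (obc_ok true hA); case=> // k1 e1 e1'.
split; first by split; [exact: h0|exact: h1].
case: e0 => e0; case: e0' => e0'; case: e1 => e1; case: e1' => e1'.
by exists (g0, g1); split; [split; [exact: k0|exact: k1]|congr pair|congr pair].
Qed.

Lemma dual_homD A B f : okDS A -> okDS B -> @isHom DS A B f ->
  @isHom DS (dD B) (dD A) (dualm f.1, dualm f.2).
Proof.
move=> hA hB [h0 h1]; split; [exact: (dualm_mod S_sym hA hB h0)|exact: (dualm_hom S_sym h1)].
Qed.

Lemma delta_natD A B f : okDS A -> okDS B -> @isHom DS A B f ->
  compA (r := DS) (DS_delta D B) f = compA (r := DS) (ddual_arr (C := DS) A B f) (DS_delta D A).
Proof.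
move=> hA hB hf; rewrite /ddual_arr (DS_dual_arrE hA hB hf).
rewrite (DS_dual_arrE (dualD_ok hB) (dualD_ok hA) (dual_homD hA hB hf)).
have [h0 h1] := hf.
have n0 := udelta_nat S_sym S_twist (D := D) (obc_ok false hA) (obc_ok false hB) (f := Ar0 f.1) h0.
have n1 := udelta_nat S_sym S_twist (D := D) (obc_ok true hA) (obc_ok true hB) (f := Ar1 f.2) h1.
by congr pair; [exact: n0|exact: n1].
Qed.

Local Notation z := (zob a).
(** The unit has a zero object in degree one, which every arrow into or out of
    it annihilates. *)
Lemma dual_unitD : dual_unit DS = (coev one, O z z^∨).
Proof.
rewrite /dual_unit.
have h := coev_one_hom S; congr pair; last first.
  apply: zob_out; have k1 := prS_hom uD (dD uD) false true; rewrite otensS_unitl in k1.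
  exact: hom_comp (azero_hom a z (bsum a (one ⊠ z^∨) (z ⊠ one^∨))) k1 erefl.
have h0 := inS_dd uD (dD uD) false; have h1 := inS_dd uD (dD uD) true.
have c0 := coevS_hom uD false; have c1 := coevS_hom uD true.
have p0 := prS_hom uD (dD uD) false false; rewrite addbb in p0.
transitivity (prS uD (dD uD) false false ∘ (DS_coev D a uD).1); first by [].
rewrite (coevE uD).
rewrite (add_compr a p0 (hom_comp c0 h0 erefl) (hom_comp c1 h1 erefl)).
rewrite comp_assoc; [|hm|hm]; rewrite prS_inS (idlm c0).
rewrite comp_assoc; [|hm|hm]; rewrite prS_inS0 // (comp0l a _ c1).
exact: (add0r a c0).
Qed.

Lemma delta_unitD : DS_delta D uD = ddual_unit DS.
Proof.
have hu := uD_ok; have hu' := dualD_ok hu.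
have h := coev_one_hom S; have h' := ev_one_hom S.
have d := dualm_hom S_sym h; have d' := dualm_hom S_sym h'.
have hm1 : @isHom DS uD (dD uD) (coev one, O z z^∨).
  by split; [exact: coev_one_mod | exact: azero_hom].
have [hd _ _] := mod_dual_ok S_sym (mod_unit_ok S_sym H).
have [hh _ _] := mod_unit_ok S_sym H.
have hm2 : module_hom H (mod_dual H (mod_unit H)) (mod_unit H) (ev one).
  exact: (mod_hom_inv S_sym hh hd (coev_one_mod S_sym H) h' (ev_coev_one S_sym)
    (coev_ev_one S_sym)).
have z1 : idm z^∨ = O z^∨ z^∨ by rewrite -dualm_id // zobP dualm0.
have z2 : idm z^∨^∨ = O z^∨^∨ z^∨^∨ by rewrite -dualm_id // z1 dualm0.
have hz := azero_hom a z z^∨; have hz' := azero_hom a z^∨ z^∨^∨.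
have E : dual_arr (C := DS) uD (dD uD) (coev one, O z z^∨) = (dualm (coev one), dualm (O z z^∨)).
  exact: (DS_dual_arrE hu hu' hm1).
rewrite /ddual_unit dual_unitD [dual_arr _ _ _]E.
have -> : inv (C := DS) (dD (dD uD)) (dD uD) (dualm (coev (@one S)), dualm (O z z^∨)) =
   (dualm (ev one), O z^∨ z^∨^∨).
  apply: (DS_inv_eq); split.
  - by split; [exact: (dualm_mod S_sym hu' hu hm2) | exact: hz'].
  - by case; [exact: (dualm_hom S_sym hz) | exact: d].
  - case; last by rewrite -[LHS](dualm_comp S_sym h' h) coev_ev_one // dualm_id.
    by rewrite -[RHS]/(idm z^∨^∨) z2; exact: (comp0l a _ (dualm_hom S_sym hz)).
  - case; last by rewrite -[LHS](dualm_comp S_sym h h') ev_coev_one // dualm_id.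
    by rewrite -[RHS]/(idm z^∨) z1 -[LHS]/(dualm (O z z^∨) ∘ O z^∨ z^∨^∨)
      (comp0r a _ (dualm_hom S_sym hz)).
congr pair; last first.
  by rewrite -[LHS]/(piv z) (comp0l a _ hz); apply: zob_out; exact: piv_hom.
have [_ _ _ e] := C_pivotal S_sym S_twist Ad_sig_invol.
have e2 := C_ddual_unitE S_sym S_twist D; rewrite -e in e2.
case: e2 => e2; rewrite [RHS](piv_one S_sym S_twist); exact: e2.
Qed.

Theorem DS_pivotal : @is_pivotal DS (DS_delta D).
Proof.
split.
- exact: delta_isoD.
- exact: delta_natD.
- exact: delta_tensD.
- exact: delta_unitD.
Qed.
End DS.

Theorem proposition4p15 (S : ribbon) (S_sym : symmetric S)
    (S_twist : trivial_twist S) (om : involution S) (H : hopf_alg S)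
    (D : braiding_datum om H)
    (Ad_sig_invol : Adj H (sig D) (sigV D) ∘ Adj H (sig D) (sigV D) = idm H) :
  @is_pivotal (C_data D) (C_delta D) /\
  (forall a : additive S, @is_pivotal (DS_data D a) (DS_delta D)).
Proof.
split; first exact: (C_pivotal S_sym S_twist Ad_sig_invol).
move=> a; exact: (DS_pivotal S_sym S_twist a Ad_sig_invol).
Qed.
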